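(* Let $\rho_0\in\mathcal M(X)$ be an infinite ($\rho_0(X)=\infty$) and diffuse measure, and let $V$ be a probability measure (prior) on $[0,1)\times\mathcal M(X)$ concentrated on $$\Theta=(0,1)\times\{w\rho_0: w\in(0,\infty)\}\ \cup\ \{(0,0)\}.$$ Let $\mathsf S_V=\int\mathsf S_{z,\rho}\,V(\mathrm dz,\mathrm d\rho)$ and $\mathsf D_V=\int\mathsf D_{z,\rho}\,V(\mathrm dz,\mathrm d\rho)$, so that $\mathsf S_V$ is the Cox process $\int\mathbf P_\kappa\,\mathsf D_V(\mathrm d\kappa)$ directed by $\mathsf D_V$. Let $U(\mu)$ and $U^*(\mu)$ be the densities (with respect to $\rho_0$) of points of $\mu$ with and without multiplicity, respectively. Then: 1. $V$ is ergodically decomposable for the family $\{\mathsf S_{z,w\rho_0}: z\in(0,1),\,w\in(0,\infty)\text{ or }z=w=0\}$: the Bayes kernel $\tilde B_V$ for the parameters, defined by $$\iint f(\mu,z,\rho)\,\mathsf S_{z,\rho}(\mathrm d\mu)\,V(\mathrm dz,\mathrm d\rho)=\iint f(\mu,z,\rho)\,\tilde B_V(\mu,\mathrm d(z,\rho))\,\mathsf S_V(\mathrm d\mu)$$ for all non-negative measurable $f$, is given, for $\mathsf S_V$-almost every $\mu$, by $$\tilde B_V(\mu,\,\cdot\,)=\delta_{(Z(\mu),\,W(\mu)\rho_0)},$$ where $(Z(\mu),W(\mu))\in\big((0,1)\times(0,\infty)\big)\cup\{(0,0)\}$ is the unique solution $(z,w)$ of the equations $$w\,\frac{z}{1-z}=U(\mu),\qquad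 -w\log(1-z)=U^*(\mu),$$ and $Z$ and $W$ are $\mathcal E_\infty$-measurable. 2. The Bayes kernel $B_V$ of the Cox process, defined by $$\iint f(\mu,\kappa)\,\mathbf P_\kappa(\mathrm d\mu)\,\mathsf D_V(\mathrm d\kappa)=\iint f(\mu,\kappa)\,B_V(\mu,\mathrm d\kappa)\,\mathsf S_V(\mathrm d\mu)$$ for all non-negative measurable $f$, is given, for $\mathsf S_V$-almost every $\mu$, by $$B_V(\mu,\,\cdot\,)=\mathsf D_{Z'(\mu),\,W(\mu)\rho_0+\mu},\qquad Z'(\mu)=\frac{Z(\mu)}{1+Z(\mu)};$$ hence the Bayes estimator $b_V[\mu]=\int\kappa\,B_V(\mu,\mathrm d\kappa)$ for the random intensity measure is, for $\mathsf S_V$-almost every $\mu$, $$b_V[\mu]=Z(\mu)\big(W(\mu)\rho_0+\mu\big).$$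
   Context: $X$ is a Polish space, $\mathcal B_0$ the ring of bounded Borel sets of $X$ (for a fixed complete metric). $\mathcal M(X)$ is the space of locally finite measures on $X$ (finite on every $B\in\mathcal B_0$) and $\mathcal M^{\cdot\cdot}(X)$ the subset of locally finite point measures (non-negative integer-valued, multiple points allowed), both with the $\sigma$-algebra generated by the maps $\mu\mapsto\mu(B)$, $B\in\mathcal B_0$. A random measure is a probability measure on $\mathcal M(X)$; it is a point process if concentrated on $\mathcal M^{\cdot\cdot}(X)$. $\mathbf P_\kappa$ denotes the Poisson process with intensity measure $\kappa\in\mathcal M(X)$. Kernels defined through disintegration identities are determined up to $\mathsf S_V$-null sets. $\int\kappa\,B_V(\mu,\mathrm d\kappa)$ is the intensity measure $A\mapsto\int\kappa(A)\,B_V(\mu,\mathrm d\kappa)$. For $z\in(0,1)$ and $\rho\in\mathcal M(X)$, the Poisson-Gamma random measure $\mathsf D_{z,\rho}$ is the infinitely divisible random measure on $X$ whose Lévy measure is the image of $\rho\otimes\tau_z$ under $(x,r)\mapsto r\delta_x$, where $\tau_z(\mathrm dr)=\frac1r e^{-\frac{1-z}{z}r}\,\mathrm dr$ on $(0,\infty)$; equivalently, its Laplace transform is $\int e^{-\kappa(h)}\,\mathsf D_{z,\rho}(\mathrm d\kappa)=\exp\left[-\iint(1-e^{-rh(x)})\,\tau_z(\mathrm dr)\,\rho(\mathrm dx)\right]$ for bounded non-negative measurable $h$. The Pólya sum process $\mathsf S_{z,\rho}$ is the unique point process $\mathsf P$ on $X$ satisfying $\iint h(x,\mu)\,\mu(\mathrm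 dx)\,\mathsf P(\mathrm d\mu)=z\iint h(x,\mu+\delta_x)\,(\rho+\mu)(\mathrm dx)\,\mathsf P(\mathrm d\mu)$ for all bounded non-negative measurable $h$ on $X\times\mathcal M^{\cdot\cdot}(X)$. It is known that $\mathsf S_{z,\rho}=\int\mathbf P_\kappa\,\mathsf D_{z,\rho}(\mathrm d\kappa)$. Convention: $\mathsf S_{0,0}$ and $\mathsf D_{0,0}$ are the Dirac measures at the zero measure. For $\mu\in\mathcal M^{\cdot\cdot}(X)$ let $\mu^*$ be the simple point measure with the same support as $\mu$ (each point counted once). For $B\in\mathcal B_0$, $\mathcal E_B$ is the $\sigma$-algebra on $\mathcal M^{\cdot\cdot}(X)$ generated by $\mu\mapsto\mu(B)$, $\mu\mapsto\mu^*(B)$ (the numbers of points inside $B$ with and without multiplicity) and all $\mu\mapsto\mu(A)$ with $A\in\mathcal B_0$, $A\cap B=\emptyset$; $\mathcal E_\infty=\bigcap_{B\in\mathcal B_0}\mathcal E_B$. The densities of points with and without multiplicity are $U(\mu)=\lim_n\mu(B_n)/\rho_0(B_n)$ and $U^*(\mu)=\lim_n\mu^*(B_n)/\rho_0(B_n)$ along a fixed increasing sequence $(B_n)$ in $\mathcal B_0$ such that every bounded set is contained in some $B_n$; these limits exist $\mathsf S_V$-almost surely (on the exceptional null set where the limits do not exist or the equations for $(z,w)$ have no solution, put $Z=W=0$). A prior is called ergodically decomposable for a parametrized family of point processes if its posterior on the parameters is a Dirac measure for almost every observation. *)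

(* Defs.v *)
From HB Require Import structures.
From mathcomp Require Import all_boot all_order all_algebra.
From mathcomp Require Import all_classical all_reals all_analysis.
From mathcomp Require Import measurable_realfun giry.

Set Implicit Arguments.
Unset Strict Implicit.
Unset Printing Implicit Defensive.

Import Order.TTheory GRing.Theory Num.Theory.
Import numFieldNormedType.Exports.

Local Open Scope classical_set_scope.
Local Open Scope ring_scope.
Local Open Scope ereal_scope.

(** The complete metric is part of the structure: it determines which sets are
    bounded. *)

HB.mixin Record Metric_isSeparable (R : realType) T & Metric R T := {
  separable_dense : exists2 D : set T, countable D & dense D
}.

#[short(type="polishType")]
HB.structure Definition Polish (R : realType) :=
  { T of Metric R T & Complete T & Metric_isSeparable R T }.

Definition borel {R : realType} (X : polishType R) :=
  g_sigma_algebraType (@open X).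

Definition bounded_borel {R : realType} (X : polishType R) : set (set (borel X)) :=
  [set B : set (borel X) |
    measurable B /\ exists (x : X) (r : R), (B : set X) `<=` ball x r].

Definition initial_sets {R : realType} {T : Type} (f : T -> \bar R) :
    set (set T) :=
  preimage_set_system setT f (@measurable _ (\bar R)).

(** Measures of the library are functions on all
    subsets; two of them are identified through [measure_eq], equality on
    measurable sets. The sigma-algebra below does not separate such
    measures. *)

Record lfmeasure {R : realType} (X : polishType R) := LFMeasure {
  lfm_val :> {measure set (borel X) -> \bar R} ;
  lfm_fin : forall B, bounded_borel B -> lfm_val B < +oo
}.

Section lfmeasure_ops.
Context {R : realType} {X : polishType R}.

Lemma lfm_zero_fin (B : set (borel X)) : bounded_borel B ->
  (mzero : {measure set (borel X) -> \bar R}) B < +oo.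
Proof. by move=> _; rewrite /= /mzero ltry. Qed.

Definition lfm_zero : lfmeasure X := LFMeasure lfm_zero_fin.

Lemma lfm_dirac_fin (x : X) (B : set (borel X)) : bounded_borel B ->
  (\d_(x : borel X) : {measure set (borel X) -> \bar R}) B < +oo.
Proof. by move=> _; rewrite /= diracE ltry. Qed.

Definition lfm_dirac (x : X) : lfmeasure X := LFMeasure (@lfm_dirac_fin x).

Lemma lfm_add_fin (mu nu : lfmeasure X) (B : set (borel X)) :
  bounded_borel B -> measure_add mu nu B < +oo.
Proof. by move=> bB; rewrite measure_addE lte_add_pinfty// lfm_fin. Qed.

Definition lfm_add (mu nu : lfmeasure X) : lfmeasure X :=
  LFMeasure (@lfm_add_fin mu nu).

Lemma lfm_scale_fin (w : R) (mu : lfmeasure X) (B : set (borel X)) :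
  bounded_borel B -> mscale (`|w|%:nng)%R mu B < +oo.
Proof. by move=> bB; rewrite /mscale lte_mul_pinfty// lfm_fin. Qed.

(* [w * mu] for [0 <= w]; the absolute value only makes the operation total. *)
Definition lfm_scale (w : R) (mu : lfmeasure X) : lfmeasure X :=
  LFMeasure (@lfm_scale_fin w mu).

End lfmeasure_ops.

Section lfmeasure_measurable.
Context {R : realType} (X : polishType R).

HB.instance Definition _ := gen_eqMixin (lfmeasure X).
HB.instance Definition _ := gen_choiceMixin (lfmeasure X).
HB.instance Definition _ := isPointed.Build (lfmeasure X) lfm_zero.

Definition lfm_gen : set (set (lfmeasure X)) :=
  \bigcup_(B in @bounded_borel R X)
    initial_sets (fun mu : lfmeasure X => mu B).

HB.instance Definition _ := @isMeasurable.Build (sigma_display lfm_gen)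
  (lfmeasure X) <<s lfm_gen >> (@sigma_algebra0 _ setT lfm_gen)
  (@sigma_algebraC _ lfm_gen) (@sigma_algebra_bigcup _ setT lfm_gen).

End lfmeasure_measurable.

(** Point measures, with multiple points allowed: on a Polish space these are
    the locally finite measures with integer values on bounded Borel sets. *)

Record pmeasure {R : realType} (X : polishType R) := PMeasure {
  pm_val :> lfmeasure X ;
  pm_int : forall B, bounded_borel B -> exists n : nat, pm_val B = n%:R%:E
}.

Section pmeasure_ops.
Context {R : realType} {X : polishType R}.

Lemma pm_zero_int (B : set (borel X)) : bounded_borel B ->
  exists n : nat, (lfm_zero : lfmeasure X) B = n%:R%:E.
Proof. by move=> _; exists 0%N. Qed.

Definition pm_zero : pmeasure X := PMeasure pm_zero_int.

Lemma pm_add1_int (mu : pmeasure X) (x : X) (B : set (borel X)) :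
  bounded_borel B ->
  exists n : nat, lfm_add mu (lfm_dirac x) B = n%:R%:E.
Proof.
move=> bB; have [n mun] := pm_int mu bB.
exists (n + (x \in B))%N.
rewrite [LHS](measure_addE mu (lfm_dirac x)) mun natrD EFinD.
by congr (_ + _); exact: diracE.
Qed.

Definition pm_add1 (mu : pmeasure X) (x : X) : pmeasure X :=
  PMeasure (@pm_add1_int mu x).

End pmeasure_ops.

Section pmeasure_measurable.
Context {R : realType} (X : polishType R).

HB.instance Definition _ := gen_eqMixin (pmeasure X).
HB.instance Definition _ := gen_choiceMixin (pmeasure X).
HB.instance Definition _ := isPointed.Build (pmeasure X) pm_zero.

Definition pm_gen : set (set (pmeasure X)) :=
  \bigcup_(B in @bounded_borel R X)
    initial_sets (fun mu : pmeasure X => mu B).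

HB.instance Definition _ := @isMeasurable.Build (sigma_display pm_gen)
  (pmeasure X) <<s pm_gen >> (@sigma_algebra0 _ setT pm_gen)
  (@sigma_algebraC _ pm_gen) (@sigma_algebra_bigcup _ setT pm_gen).

End pmeasure_measurable.

Section processes.
Context {R : realType} {X : polishType R}.
Implicit Types (z : R) (rho kappa : lfmeasure X).

(* The second argument of [poisson_prob] is a dummy of the library. *)
Definition is_poisson_process kappa (P : probability (pmeasure X) R) :=
  forall (n : nat) (B : 'I_n -> set (borel X)) (k : 'I_n -> nat),
    (forall i, bounded_borel (B i)) -> trivIset setT B ->
    P [set mu : pmeasure X | forall i, mu (B i) = (k i)%:R%:E] =
    \prod_(i < n) poisson_prob (fine (kappa (B i))) 0%N [set k i].

(* The density of tau_z with respect to Lebesgue measure on (0, +oo). *)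
Definition tau_density z (r : R) : R :=
  (r^-1 * expR (- ((1 - z) / z * r)))%R.

(* Infinite divisibility with Levy measure the image of rho x tau_z under
   (x, r) |-> r \d_x, written as the formula for the Laplace transform. *)
Definition poisson_gamma_laplace z rho (Q : probability (lfmeasure X) R) :=
  forall h : borel X -> R, measurable_fun setT h -> (forall x, 0 <= h x)%R ->
    (exists M : R, forall x, h x <= M)%R ->
    \int[Q]_kappa expeR (- \int[kappa]_x (h x)%:E) =
    expeR (- \int[rho]_x
        \int[@lebesgue_measure R]_(r in `]0%R, +oo[)
          ((1 - expR (- (r * h x))) * tau_density z r)%:E).

Definition polya_sum_equation z rho (P : probability (pmeasure X) R) :=
  forall h : borel X * pmeasure X -> R, measurable_fun setT h ->
    (forall y, 0 <= h y)%R -> (exists M : R, forall y, h y <= M)%R ->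
    \int[P]_mu \int[mu]_x (h (x, mu))%:E =
    z%:E * \int[P]_mu \int[lfm_add rho mu]_x (h (x, pm_add1 mu x))%:E.

(* The parameters at which D_{z,rho} and S_{z,rho} are defined are
   (0,1) * M(X) and (0,0); the families are unconstrained elsewhere. *)
Definition poisson_gamma_family (D : R * lfmeasure X -> probability (lfmeasure X) R) :=
  (forall z rho, (0 < z < 1)%R -> poisson_gamma_laplace z rho (D (z, rho))) /\
  (forall rho, measure_eq rho lfm_zero ->
    measure_eq (D (0%R, rho)) (\d_(@lfm_zero R X))).

Definition polya_sum_family (S : R * lfmeasure X -> probability (pmeasure X) R) :=
  (forall z rho, (0 < z < 1)%R -> polya_sum_equation z rho (S (z, rho))) /\
  (forall rho, measure_eq rho lfm_zero ->
    measure_eq (S (0%R, rho)) (\d_(@pm_zero R X))).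

(* A subset of [0,1) * M(X), so a prior on [0,1) * M(X) carried by Theta is the
   same as a probability on [R * lfmeasure X] carried by Theta. *)
Definition Theta (rho0 : lfmeasure X) : set (R * lfmeasure X) :=
  [set p : R * lfmeasure X | ((0 < p.1 < 1)%R /\
            exists2 w : R, (0 < w)%R & measure_eq p.2 (lfm_scale w rho0)) \/
           (p.1 = 0%R /\ measure_eq p.2 lfm_zero)].

End processes.

Section bayes.
Context {R : realType} {d d'} {T : measurableType d} {O : measurableType d'}.
(* [C] is a set of parameters carrying the prior [V]; the family [K] of laws of
   the observation need not be meaningful outside [C]. *)
Variables (C : set T) (V : probability T R) (K : T -> probability O R).

Definition is_mixture (P : probability O R) :=
  forall A : set O, measurable A -> P A = \int[V]_(t in C) K t A.

Definition is_bayes_kernel (P : probability O R) (B : R.-pker O ~> T) :=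
  forall f : O * T -> \bar R, measurable_fun setT f -> (forall y, 0 <= f y) ->
    \int[V]_(t in C) \int[K t]_o f (o, t) = \int[P]_o \int[B o]_t f (o, t).

Definition ergodically_decomposable (P : probability O R) :=
  forall B : R.-pker O ~> T, is_bayes_kernel P B ->
    {ae P, forall o, exists2 t, C t & measure_eq (B o) (\d_t)}.

End bayes.

Section densities.
Context {R : realType} {X : polishType R}.
Implicit Types (mu : pmeasure X) (A B : set (borel X)).

Definition msupport (mu : lfmeasure X) : set X :=
  [set x | forall U : set X, open U -> U x -> 0 < mu U].

(* mu^*(A), for the simple point measure mu^* with the same support as mu. *)
Definition mstar mu (A : set (borel X)) : \bar R := counting (msupport mu `&` A).

(* The sigma-algebra E_B. *)
Definition tailB B : set (set (pmeasure X)) :=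
  <<s initial_sets (fun mu => mu B)
      `|` initial_sets (fun mu => mstar mu B)
      `|` \bigcup_(A in [set A | bounded_borel A /\ A `&` B = set0])
            initial_sets (fun mu => mu A) >>.

(* The sigma-algebra E_infty. *)
Definition tail : set (set (pmeasure X)) :=
  \bigcap_(B in @bounded_borel R X) tailB B.

Definition tail_measurable (f : pmeasure X -> R) :=
  forall Y : set R, measurable Y -> tail (f @^-1` Y).

Variables (rho0 : lfmeasure X) (B : (set (borel X))^nat).

Definition density_seq mu : R^nat :=
  fun n => (fine (mu (B n)) / fine (rho0 (B n)))%R.

Definition density_star_seq mu : R^nat :=
  fun n => (fine (mstar mu (B n)) / fine (rho0 (B n)))%R.

Definition U mu : R := limn (density_seq mu).

Definition Ustar mu : R := limn (density_star_seq mu).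

Definition solutions mu : set (R * R) :=
  [set zw | [/\ (0 < zw.1 < 1)%R /\ (0 < zw.2)%R \/ zw = (0%R, 0%R),
      cvgn (density_seq mu), cvgn (density_star_seq mu),
      (zw.2 * (zw.1 / (1 - zw.1)) = U mu)%R &
      (- zw.2 * ln (1 - zw.1) = Ustar mu)%R]].

(* (0, 0) where the limits do not exist or there is no solution *)
Definition ZW mu : R * R := xget (0%R, 0%R) (solutions mu).

Definition Z mu : R := (ZW mu).1.

Definition W mu : R := (ZW mu).2.

Definition Z' mu : R := (Z mu / (1 + Z mu))%R.

End densities.

(* Main.v *)
(** Laws on the spaces of measures are compared through Laplace functionals
    [E exp (- sum_i a_i mu(B_i))] with disjoint bounded [B_i].  For the Pólya
    sum process the defining equation, tested with [h(x, mu)] equal to [1_B(x)]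
    times a function of [mu(B)] and of [mu] outside [B], is the recurrence
    [(k + 1) p_(k+1) = z (rho(B) + k) p_k], so [mu(B)] is negative binomial and
    counts of disjoint sets are independent.  Comparing Laplace functionals on
    the product space gives the conjugacy
    [D_{z,rho}(d kappa) P_kappa(d mu) = S_{z,rho}(d mu) D_{z/(1+z),rho+mu}(d kappa)],
    hence the Cox representation and, for known [(z, rho)], the posterior.

    Second moments of [mu(B)] and of the number of distinct points
    [mu^*(B)], the latter approximated by counting occupied cells of finer and
    finer partitions, yield strong laws of large numbers along [B_n].  So
    [U = w z / (1 - z)] and [U^* = - w log (1 - z)] almost surely under
    [S_{z,w rho0}], and in the variable [y = - log (1 - z)] the ratio
    [U / U^* = (exp y - 1) / y] is strictly increasing in [y], which recovers
    [(z, w)] from the observation. *)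
Require Import Defs.
From HB Require Import structures.
From mathcomp Require Import all_boot all_order all_algebra.
From mathcomp Require Import finmap.
From mathcomp Require Import all_classical all_reals all_analysis.
From mathcomp Require Import measurable_realfun giry.
From mathcomp Require Import ring lra.

Set Implicit Arguments.
Unset Strict Implicit.
Unset Printing Implicit Defensive.

Import Order.TTheory GRing.Theory Num.Theory.
Import numFieldNormedType.Exports.

Local Open Scope classical_set_scope.
Local Open Scope ring_scope.

(** * Monotone class argument *)

(** The families [D] and [S] are prescribed only at admissible parameters, and nothing is said about
    how their laws depend on the parameter, whereas iterated integrals against the prior need this
    dependence to be measurable. One monotone class theorem, for multiplicative classes of functions
    with values in [0,1], therefore serves twice: finite measures with equal Laplace functionals
    agree, and laws whose Laplace functionals are measurable in the parameter form a measurable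
    family. [Theta] is not known to be measurable, so integrals over it are exchanged for integrals
    over all parameters, once the families are replaced by Dirac measures at zero for z outside
    (0,1). The posterior for an unknown parameter takes two moves: conjugacy at a fixed [t], then
    replacement of [t] by [parameters mu], legitimate almost surely under the law at [t]. The
    degenerate parameter (0,0) costs one extra fact: almost surely, [Z mu = 0] forces an empty
    configuration. Uniqueness of Bayes kernels needs one null set for all test functions, hence
    countable determining classes, built on a countable base of [X]. *)

Lemma expr1B_le {R : realFieldType} (y : R) (N : nat) : 0 <= y <= 1 ->
  (1 - y) ^+ N <= (1 + N%:R * y)^-1.
Proof.
move=> /andP[y0 y1]; have Ny0 : 0 <= N%:R * y by rewrite mulr_ge0.
rewrite -[leRHS]mul1r ler_pdivlMr; last by rewrite ltr_pwDl.
elim: N Ny0 => [|N IHN] Ny0; first by rewrite expr0 mul0r addr0 mulr1.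
rewrite exprSr (le_trans _ (IHN _))// ?mulr_ge0// -mulrA.
rewrite ler_wpM2l// ?exprn_ge0 ?subr_ge0//.
rewrite -(natr1 N) mulrDl mul1r.
have : 0 <= N%:R * y * y + y * y by rewrite addr_ge0// !mulr_ge0.
by lra.
Qed.

Lemma expr1B_ge {R : realFieldType} (y : R) (N : nat) : 0 <= y <= 1 ->
  1 - (1 - y) ^+ N <= N%:R * y.
Proof.
move=> /andP[y0 y1]; elim: N => [|N IHN]; first by rewrite expr0 subrr mul0r.
rewrite exprSr -(natr1 N) mulrDl mul1r.
have : (1 - y) ^+ N * y <= y.
  by rewrite ler_piMl// exprn_ile1// ?subr_ge0// lerBlDr lerDl.
by move: IHN; rewrite mulrBr mulr1; lra.
Qed.

(* [1 - (1 - y^n)^N] is a polynomial approximation of the indicator of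
   [y > c]. *)
Lemma threshold {R : realType} (c c' e : R) : 0 <= c -> c < c' -> c' <= 1 -> 0 < e ->
  exists n N : nat, forall y, 0 <= y <= 1 ->
    (y <= c -> 1 - (1 - y ^+ n) ^+ N <= e) /\ (c' <= y -> (1 - y ^+ n) ^+ N <= e).
Proof.
move=> c0 cc' c'1 e0; have c'0 : 0 < c' by exact: le_lt_trans cc'.
have d0 : 0 < e / (e^-1 + 1) by rewrite divr_gt0// ltr_pwDr// invr_ge0 ltW.
have q0 : 0 <= c / c' by rewrite divr_ge0// ltW.
have q1 : `|c / c'| < 1.
  by rewrite ger0_norm// ltr_pdivrMr// mul1r.
have /cvgrPdist_le /(_ _ d0) [n _ /(_ n (leqnn n))/=] := cvg_expr q1.
rewrite sub0r normrN ger0_norm ?exprn_ge0// => hn.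
have {}hn : c ^+ n * (e^-1 + 1) <= e * c' ^+ n.
  move: hn; rewrite ler_pdivlMr; last by rewrite ltr_pwDr// invr_ge0 ltW.
  by rewrite exprMn exprVn mulrAC ler_pdivrMr ?exprn_gt0.
have ec0 : 0 < e * c' ^+ n by rewrite mulr_gt0// exprn_gt0.
(* [N] is just above 1/(e c'^n). Above [c'] this gives (1 - y^n)^N <= 1/(N c'^n) <= e. Below [c] the
   error is at most N c^n <= (1/e + 1)(c/c')^n, which the choice of [n] keeps under [e]. *)
exists n, (Num.truncn (e * c' ^+ n)^-1).+1 => y /andP[y0 y1].
have yn1 : 0 <= y ^+ n <= 1 by rewrite exprn_ge0//= exprn_ile1.
split=> yc.
  apply: (le_trans (expr1B_ge _ yn1)).
  have ync : y ^+ n <= c ^+ n by rewrite lerXn2r// nnegrE// (le_trans y0).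
  apply: (le_trans (ler_wpM2l _ ync)) => //.
  have : (Num.truncn (e * c' ^+ n)^-1)%:R <= (e * c' ^+ n)^-1.
    by rewrite truncn_le// invr_ge0 ltW.
  rewrite -natr1 => h.
  have cn0 : 0 <= c ^+ n by rewrite exprn_ge0.
  apply: (@le_trans _ _ (((e * c' ^+ n)^-1 + 1) * c ^+ n)).
    by rewrite ler_wpM2r// lerD2r.
  have c'n1 : c' ^+ n <= 1 by rewrite exprn_ile1// ltW.
  have c'n0 : 0 < c' ^+ n by rewrite exprn_gt0.
  apply: (@le_trans _ _ ((c ^+ n * (e^-1 + 1)) / c' ^+ n)); last first.
    by rewrite ler_pdivrMr.
  rewrite mulrDl mulrDr mulrDl lerD//.
    by rewrite invfM mulrC mulrA.
  by rewrite mul1r mulr1 ler_peMr// -[1]invr1 lef_pV2 ?posrE.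
apply: (le_trans (expr1B_le _ yn1)).
have ync : c' ^+ n <= y ^+ n by rewrite lerXn2r// nnegrE// ltW.
rewrite -[leRHS]invrK lef_pV2 ?posrE ?invr_gt0//; last first.
  by rewrite ltr_pwDl// mulr_ge0//; case/andP: yn1.
apply: (@le_trans _ _ ((Num.truncn (e * c' ^+ n)^-1).+1%:R * c' ^+ n)); last first.
  by rewrite ler_wpDl// ler_wpM2l.
have := truncnS_gt (e * c' ^+ n)^-1 => /ltW.
rewrite -ler_pdivrMr ?exprn_gt0//.
by rewrite invfM.
Qed.

Section functional_monotone_class.
Context {R : realType} {T : Type}.
Variables (E H : set (T -> R)).
Hypothesis E01 : forall e, E e -> forall x, 0 <= e x <= 1.
Hypothesis E1 : E (cst 1).
Hypothesis EM : forall e f, E e -> E f -> E (e \* f).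
Hypothesis EH : E `<=` H.
Hypothesis HB : forall f g, H f -> H g -> (forall x, 0 <= g x <= f x) ->
  (forall x, f x <= 1) -> H (f \- g).
Hypothesis HL : forall (f : nat -> T -> R) g, (forall n, H (f n)) ->
  (forall n x, 0 <= f n x <= 1) -> (forall x, f n x @[n --> \oo] --> g x) -> H g.

(** [H] is closed only under bounded differences and bounded limits, so [L] is visibly closed under
    proper differences but not under intersection. Its stabilizer [L2] under intersection is closed
    under intersection by construction and becomes a sigma-algebra. *)
Let L : set (set T) := [set A | forall e, E e -> H (e \* \1_A)].
Let L2 : set (set T) := [set A | forall B, L B -> L (A `&` B)].

Let E_ge0 e x : E e -> 0 <= e x. Proof. by move=> /E01/(_ x)/andP[]. Qed.
Let E_le1 e x : E e -> e x <= 1. Proof. by move=> /E01/(_ x)/andP[]. Qed.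

Let indic01 (A : set T) x : 0 <= (\1_A x : R) <= 1.
Proof. by rewrite indicE; case: (x \in A); rewrite ?lexx ?ler01. Qed.

Let Eindic01 e (A : set T) x : E e -> 0 <= e x * \1_A x <= 1.
Proof.
move=> Ee; have /andP[? ?] := indic01 A x; have /andP[? ?] := E01 Ee x.
by rewrite mulr_ge0//= mulr_ile1.
Qed.

Let LT : L setT.
Proof.
move=> e Ee; rewrite (_ : _ \* _ = e); first exact: EH.
by apply/funext => x; rewrite /= indicT mulr1.
Qed.

Let LD A B : A `<=` B -> L A -> L B -> L (B `\` A).
Proof.
move=> AB LA LB e Ee.
rewrite (_ : _ \* _ = (e \* \1_B) \- (e \* \1_A)).
  apply: HB; [exact: LB|exact: LA| |by move=> x; case/andP: (Eindic01 B x Ee)].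
  move=> x; have /andP[-> _]/= := Eindic01 A x Ee.
  rewrite ler_wpM2l// ?E_ge0// !indicE ler_nat.
  by case: (boolP (x \in A)) => // /set_mem/AB/mem_set ->.
apply/funext => x /=; rewrite -mulrBr !indicE in_setD.
by case: (boolP (x \in A)) => [/set_mem/AB/mem_set ->|_];
  rewrite ?andbF ?andbT ?subrr ?subr0.
Qed.

Let L2I A B : L2 A -> L2 B -> L2 (A `&` B).
Proof. by move=> LA LB C LC; rewrite -setIA; apply/LA/LB. Qed.

Let L2C A : L2 A -> L2 (~` A).
Proof.
move=> LA B LB; have -> : ~` A `&` B = B `\` (A `&` B).
  apply/seteqP; split=> x /=; first by move=> [nA Bx]; split=> // -[].
  by move=> [Bx nAB]; split=> // Ax; apply: nAB.
by apply: LD => //; exact: LA.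
Qed.

Let L20 : L2 set0.
Proof. by move=> B LB; rewrite set0I -(setDv setT); exact: LD. Qed.

Let L2U A B : L2 A -> L2 B -> L2 (A `|` B).
Proof. by move=> LA LB; rewrite -[_ `|` _]setCK setCU; apply/L2C/L2I; exact: L2C. Qed.

Let L2_sigma : sigma_algebra setT L2.
Proof.
split; first exact: L20.
  by move=> A LA; rewrite setTD; exact: L2C.
move=> F LF B LB e Ee.
pose G n := \big[setU/set0]_(i < n) F i.
have LG n : L2 (G n).
  elim: n => [|n IHn]; rewrite /G; first by rewrite big_ord0; exact: L20.
  by rewrite big_ord_recr; exact: L2U.
apply: (@HL (fun n => e \* \1_(G n `&` B)) _) => [n|n x|x].
- exact: LG.
- exact: Eindic01.
- apply: cvgMr; apply: cvg_near_cst.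
  have [[[k _ Fkx] Bx]|nFB] := pselect ((\bigcup_k F k `&` B) x).
    exists k.+1 => // n /= kn; rewrite !indicE !mem_set//; split=> //.
      by exists k.
    by rewrite /G -bigcup_mkord; exists k.
  exists 0%N => // n _ /=; rewrite !indicE !memNset// => -[Gx Bx].
  by apply: nFB; split => //; move: Gx; rewrite /G -bigcup_mkord => -[k _ ?]; exists k.
Qed.

Let EX e n : E e -> E (fun x => e x ^+ n).
Proof.
move=> Ee; elim: n => [|n IHn]; first exact: E1.
rewrite (_ : (fun _ => _) = e \* (fun x => e x ^+ n)); first exact: EM.
by apply/funext => x; rewrite /= exprS.
Qed.

(** The indicator of a superlevel set is a bounded limit of polynomials in [e], and each of these
    can be reached from [E] by products and differences alone. *)
Let L2_gt e c : E e -> L2 [set x | c < e x].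
Proof.
move=> Ee B LB.
have [c1|c1] := leP 1 c.
  rewrite (_ : [set x | c < e x] = set0); first exact: L20.
  by apply/seteqP; split=> // x /=; rewrite ltNge (le_trans (E_le1 x Ee)).
have [c0|c0] := ltP c 0.
  rewrite (_ : [set x | c < e x] = setT) ?setTI//.
  by apply/seteqP; split=> // x _ /=; rewrite (lt_le_trans c0)// E_ge0.
move=> g Eg.
(* The upper thresholds decrease to [c] while the accuracy 1/(j+1) improves, so [1 - p j] tends to
   the indicator of [c < e] also at points where [e x] is barely above [c]. *)
pose cn (j : nat) := c + (1 - c) / j.+1%:R.
have c_lt j : c < cn j by rewrite /cn ltrDl divr_gt0// subr_gt0.
have cn1 j : cn j <= 1.
  by rewrite /cn -lerBrDl ler_piMr ?subr_ge0 ?(ltW c1)// invf_le1 ?ltr0n// ler1n.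
have inv0 (j : nat) : 0 < j.+1%:R^-1 :> R by rewrite invr_gt0.
have /choice[n /choice[N nN]] :=
  fun j => threshold c0 (c_lt j) (cn1 j) (inv0 j).
pose p j x := (1 - e x ^+ n j) ^+ N j.
have en01 k x : 0 <= 1 - e x ^+ k <= 1.
  by rewrite subr_ge0 lerBlDr lerDl exprn_ge0 ?E_ge0// andbT exprn_ile1 ?E_ge0 ?E_le1.
have p01 j x : 0 <= p j x <= 1.
  by case/andP: (en01 (n j) x) => ? ?; rewrite exprn_ge0//= exprn_ile1.
(* One factor at a time, as the difference of the terms for [f] and for f e^n. The second multiplier
   lies again in [E], which is why [f] is generalized in the induction. *)
have Hp j m f : E f -> H (fun x => f x * \1_B x * (1 - e x ^+ n j) ^+ m).
  elim: m f => [|m IHm] f Ef.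
    under eq_fun do rewrite expr0 mulr1; exact: LB.
  rewrite (_ : (fun _ => _) = (fun x => f x * \1_B x * (1 - e x ^+ n j) ^+ m) \-
      (fun x => (f x * e x ^+ n j) * \1_B x * (1 - e x ^+ n j) ^+ m)); last first.
    by apply/funext => x /=; rewrite exprSr; ring.
  have q0 x : 0 <= f x * \1_B x * (1 - e x ^+ n j) ^+ m.
    by rewrite mulr_ge0 ?exprn_ge0//; [case/andP: (Eindic01 B x Ef)
                                       |case/andP: (en01 (n j) x)].
  apply: HB => [||x|x].
  - exact: IHm.
  - by apply: (IHm (fun x => f x * e x ^+ n j)); apply: EM => //; exact: EX.
  - rewrite (_ : f x * _ * _ * _ = f x * \1_B x * (1 - e x ^+ n j) ^+ m * e x ^+ n j).
      by rewrite mulr_ge0 ?exprn_ge0 ?E_ge0//= ler_piMr// exprn_ile1 ?E_ge0 ?E_le1.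
    by ring.
  - have /andP[? ?] := Eindic01 B x Ef; have /andP[? ?] := en01 (n j) x.
    by rewrite mulr_ile1// ?exprn_ge0// exprn_ile1.
apply: (@HL (fun j x => g x * \1_B x - g x * \1_B x * p j x) _) => [j|j x|x].
- apply: HB => [||x|x]; [exact: LB|exact: Hp| |].
    have /andP[? ?] := Eindic01 B x Eg; have /andP[? ?] := p01 j x.
    by rewrite mulr_ge0//= ler_piMr.
  by case/andP: (Eindic01 B x Eg).
- have /andP[? ?] := Eindic01 B x Eg; have /andP[? ?] := p01 j x.
  rewrite subr_ge0 ler_piMr//= lerBlDr (@le_trans _ _ 1)// lerDl mulr_ge0//.
have inv_cvg : (j.+1%:R^-1 : R) @[j --> \oo] --> 0 by exact: cvg_harmonic.
have pcvg : (fun j => 1 - p j x) @ \oo --> (\1_[set x | c < e x] x : R).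
  have [ec|ec] := ltP c (e x).
    rewrite indicE mem_set// -[X in _ --> X]subr0; apply: cvgB; first exact: cvg_cst.
    apply/(@squeeze_cvgr _ _ _ _ (cst 0) (fun j => j.+1%:R^-1)) => //.
      have : \forall j \near \oo, cn j < e x.
        have : cn j @[j --> \oo] --> c.
          rewrite -[X in _ --> X]addr0 /cn; apply: cvgD; first exact: cvg_cst.
          by rewrite -[X in _ --> X](mulr0 (1 - c)); apply: cvgMr.
        by move/cvgr_lt; apply.
      apply: filterS => j cje.
      have [|_ /(_ (ltW cje)) ple] := nN j (e x); first exact: E01.
      by rewrite ple andbT; case/andP: (p01 j x).
    exact: cvg_cst.
  rewrite indicE memNset/=; last by rewrite ltNge ec.
  apply/(@squeeze_cvgr _ _ _ _ (cst 0) (fun j => j.+1%:R^-1)) => //.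
    near=> j; have [|/(_ ec) ple _] := nN j (e x); first exact: E01.
    by rewrite ple andbT subr_ge0; case/andP: (p01 j x).
  exact: cvg_cst.
rewrite (_ : (g \* _) x = g x * \1_B x * \1_[set x | c < e x] x); last first.
  by rewrite /= setIC indicI /= mulrA.
under eq_fun do rewrite -[X in X - _]mulr1 -mulrBr.
exact: cvgMr.
Unshelve. all: by end_near.
Qed.

Lemma functional_monotone_class (A : set T) :
  <<s \bigcup_(e in E) [set [set x | c < e x] | c in [set: R]] >> A -> H \1_A.
Proof.
move=> /(_ L2) /(_ _) LA; have {LA} : L2 A.
  apply: LA; split; first exact: L2_sigma.
  by move=> _ [e Ee [c _ <-]]; exact: L2_gt.
move=> /(_ _ LT _ E1); rewrite setIT (_ : _ \* _ = \1_A)//.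
by apply/funext => x /=; rewrite mul1r.
Qed.

End functional_monotone_class.

(** * A binomial series *)

Lemma is_derive_0_cst_itv {R : realType} (g : R -> R) (a b : R) : a <= b ->
  (forall x : R, a <= x <= b -> is_derive x (1 : R) g 0) -> g b = g a.
Proof.
move=> ab dg.
have [||c _] := @MVT_segment _ g (fun=> 0) _ _ ab.
- by move=> x; rewrite in_itv/= => /andP[ax xb]; apply: dg; rewrite !ltW.
- apply: continuous_in_subspaceT => x; rewrite inE/= in_itv/= => axb.
  apply/differentiable_continuous/derivable1_diffP.
  by have [] := dg x axb.
- by rewrite mul0r => /eqP; rewrite subr_eq0 => /eqP.
Qed.

Section negative_binomial_series.
Context {R : realType}.
Implicit Types (c p u : nat -> R) (z m s q K : R).

Lemma ratio_test u q : 0 < q < 1 -> (forall n, 0 <= u n) ->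
  (\forall n \near \oo, u n.+1 <= q * u n) -> cvgn (series u).
Proof.
move=> /andP[q0 q1] u0 [N _ uN].
have [C C0 uC] : exists2 C, 0 <= C & forall n, (n <= N)%N -> u n <= C * q ^+ n.
  elim: N {uN} => [|N [C C0 IHN]].
    by exists (u 0%N) => // n; rewrite leqn0 => /eqP ->; rewrite expr0 mulr1.
  exists (C + u N.+1 / q ^+ N.+1); first by rewrite addr_ge0// divr_ge0// exprn_ge0// ltW.
  move=> n; rewrite leq_eqVlt => /orP[/eqP ->|nN].
    rewrite mulrDl divfK ?gt_eqF ?exprn_gt0// lerDr mulr_ge0// exprn_ge0//.
    exact: ltW.
  rewrite mulrDl (le_trans (IHN _ _))// lerDl mulr_ge0 ?divr_ge0 ?exprn_ge0//;
    exact: ltW.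
have {}uC n : u n <= C * q ^+ n.
  elim: n => [|n IHn]; first exact: uC.
  have [nN|nN] := leqP n.+1 N; first exact: uC.
  rewrite (le_trans (uN n nN))// exprS mulrCA ler_wpM2l//; exact: ltW.
apply: (@series_le_cvg _ _ (geometric C q)) => //.
  by move=> n; rewrite /geometric /= mulr_ge0 ?exprn_ge0// ltW.
by apply: is_cvg_geometric_series; rewrite ger0_norm// ltW.
Qed.

(** The recurrence solved by c_k = c_0 z^k m(m+1)...(m+k-1)/k!, the coefficients of the negative
    binomial series. *)
Let pochhammer z m c := forall k, k.+1%:R * c k.+1 = z * (m + k%:R) * c k.

Let is_cvg_pseries_pochhammer z m c K : (forall k, 0 <= c k) -> pochhammer z m c ->
  0 < z -> 0 <= m -> 0 < K -> z * K < 1 -> cvgn (pseries c K).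
Proof.
move=> c0 cE z0 m0 K0 zK1; set t := z * K in zK1 *.
have t0 : 0 < t by rewrite mulr_gt0.
apply: (@ratio_test _ ((1 + t) / 2)).
- by apply/andP; split; lra.
- by move=> n; rewrite mulr_ge0// exprn_ge0// ltW.
(* From this index on t(m + n) <= (1 + t)/2 (n + 1), so consecutive terms have ratio at most (1 +
   t)/2 < 1. *)
exists (Num.truncn (t * m / ((1 - t) / 2))).+1 => // n /= hn.
have {}hn : t * m <= (1 - t) / 2 * n%:R.
  rewrite [leRHS]mulrC -ler_pdivrMr; last lra.
  by rewrite ltW// (lt_le_trans (truncnS_gt _))// ler_nat.
rewrite -(ler_pM2l (ltr0Sn R n)) [leLHS]mulrA cE.
rewrite (_ : z * (m + n%:R) * c n * K ^+ n.+1 = (t * (m + n%:R)) * (c n * K ^+ n)); last first.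
  by rewrite /t exprS; ring.
rewrite [leRHS]mulrA ler_wpM2r//; first by rewrite mulr_ge0// exprn_ge0// ltW.
by rewrite -natr1; lra.
Qed.

(** Differentiation only shifts [m], so the convergence criterion applies unchanged to the derived
    series that termwise differentiation asks for. *)
Let pochhammer_diffs z m c : pochhammer z m c -> pochhammer z (m + 1) (pseries_diffs c).
Proof. by move=> cE k; rewrite /pseries_diffs [in LHS]cE -!natr1; ring. Qed.

(* [p] satisfies the recurrence of the coefficients of [(1 - z s)^-m]. *)
Lemma negative_binomial_series z m p s :
  0 < z < 1 -> 0 <= m -> (forall k, 0 <= p k) ->
  (forall k, k.+1%:R * p k.+1 = z * (m + k%:R) * p k) -> 0 <= s <= 1 ->
  series (fun k => p k * s ^+ k) @ \oo --> p 0%N * expR (- (m * ln (1 - z * s))).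
Proof.
move=> /andP[z0 z1] m0 p0 pE /andP[s0 s1].
(* A point strictly between 1 and the radius of convergence 1/z: convergence at [K] puts all of
   [0,1], endpoint 1 included, inside the disc. *)
pose K := (1 + z^-1) / 2.
have zV1 : 1 < z^-1 by rewrite invf_gt1.
have K1 : 1 < K by rewrite /K; lra.
have K0 : 0 < K by lra.
have zK1 : z * K < 1.
  by rewrite /K mulrA ltr_pdivrMr// mul1r mulrDr mulr1 divff ?gt_eqF//; lra.
have m10 : 0 <= m + 1 by rewrite addr_ge0.
have dp0 k : 0 <= pseries_diffs p k by rewrite /pseries_diffs mulr_ge0.
have ddp0 k : 0 <= pseries_diffs (pseries_diffs p) k by rewrite mulr_ge0.
have dE := pochhammer_diffs pE.
have Ck : cvgn (pseries p K) by exact: (is_cvg_pseries_pochhammer p0 pE).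
have Cdk : cvgn (pseries (pseries_diffs p) K) by exact: (is_cvg_pseries_pochhammer dp0 dE).
have Cddk : cvgn (pseries (pseries_diffs (pseries_diffs p)) K).
  apply: (is_cvg_pseries_pochhammer ddp0 (pochhammer_diffs dE)) => //.
  by rewrite addr_ge0.
have inK (x : R) : 0 <= x <= 1 -> `|x| < `|K|.
  by move=> /andP[x0 x1]; rewrite !ger0_norm ?(ltW K0)// (le_lt_trans x1).
pose f x := limn (pseries p x).
(* The recurrence amounts to the differential equation (1 - zx) f' = z m f, proved as [fE]. Hence
   the series times (1 - zx)^m has derivative zero. *)
pose g x := f x * expR (m * ln (1 - z * x)).
have zx (x : R) : 0 <= x <= 1 -> 0 < 1 - z * x.
  by move=> /andP[x0 x1]; rewrite subr_gt0 (le_lt_trans _ z1)// ler_piMr// ltW.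
have df (x : R) : 0 <= x <= 1 -> is_derive x (1 : R) f (limn (pseries (pseries_diffs p) x)).
  by move=> x01; exact: (pseries_snd_diffs Ck Cdk Cddk (inK _ x01)).
have fE (x : R) : 0 <= x <= 1 -> (1 - z * x) * limn (pseries (pseries_diffs p) x) = z * m * f x.
  move=> x01.
  have Cf : cvgn (pseries p x) := is_cvg_pseries_inside Ck (inK _ x01).
  have Cd : cvgn (pseries (pseries_diffs p) x) := is_cvg_pseries_inside Cdk (inK _ x01).
  have h1 := pseries_diffs_equiv Cd.
  have h2 : series (fun i => z * m * (p i * x ^+ i)) @ \oo -->
      limn (pseries (pseries_diffs p) x) - z * x * limn (pseries (pseries_diffs p) x).
    rewrite (_ : series _ = (fun n => pseries (pseries_diffs p) x n -
        z * x * series (fun i => i%:R * p i * x ^+ i.-1) n)); last first.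
      apply/funext => n; rewrite /pseries /series /= mulr_sumr -sumrB.
      apply: eq_bigr => -[|i] _; rewrite /pseries_diffs pE.
        by rewrite addr0 !mul0r !mulr0 subr0; ring.
      by rewrite (_ : i.+1.-1 = i)// exprS; ring.
    by apply: cvgB => //; apply: cvgMr.
  have h3 : series (fun i => z * m * (p i * x ^+ i)) @ \oo --> z * m * f x.
    rewrite (_ : series _ = (fun n => z * m * pseries p x n)); last first.
      by apply/funext => n; rewrite /pseries /series /= mulr_sumr.
    by apply: cvgMr.
  by rewrite mulrBl mul1r; apply: cvg_unique h2 h3.
have dg (x : R) : 0 <= x <= 1 -> is_derive x (1 : R) g 0.
  move=> x01; have zx0 := zx _ x01; have dfx := df _ x01.
  have dl : is_derive (1 - z * x) 1 (@ln R) (1 - z * x)^-1 by exact: is_derive1_ln.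
  rewrite /g.
  apply: is_derive_eq.
  rewrite /GRing.scale /=; have := fE _ x01.
  set F' := limn _ => /(canRL (mulKf (lt0r_neq0 zx0))) ->.
  by field; rewrite lt0r_neq0.
have gs : g s = g 0.
  by apply: is_derive_0_cst_itv s0 _ => x /andP[x0 xs]; apply: dg; rewrite x0 (le_trans xs).
have f0 : f 0 = p 0%N.
  apply: lim_near_cst => //; near=> n; rewrite -[n]prednK; last by near: n.
  rewrite /pseries /series /= big_nat_recl//= expr0 mulr1 big1 ?addr0// => i _.
  by rewrite exprS mul0r mulr0.
have s01 : 0 <= s <= 1 by rewrite s0.
rewrite (_ : _ * _ = f s); first exact: (is_cvg_pseries_inside Ck (inK _ s01)).
move: gs; rewrite /g mulr0 subr0 ln1 mulr0 expR0 mulr1 f0 => <-.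
by rewrite -mulrA -expRD subrr expR0 mulr1.
Unshelve. all: by end_near. Qed.

End negative_binomial_series.

Local Open Scope ereal_scope.

(** * Determining classes and kernels *)

Section probability_families.
Context {d d'} {T : measurableType d} {O : measurableType d'} {R : realType}.

Definition measurable_family (K : T -> probability O R) :=
  forall A, measurable A -> measurable_fun setT (fun t => K t A).

Section pkern.
Variable K : T -> probability O R.

(** The measurability proof is an argument so that the kernel structures can be attached to a bare
    function into probabilities. *)
Definition pkern (mK : measurable_family K) (t : T) : {measure set O -> \bar R} :=
  K t.

Hypothesis mK : measurable_family K.

HB.instance Definition _ := isKernel.Build _ _ _ _ _ (pkern mK) mK.

Let pkernT t : pkern mK t setT = 1.
Proof. exact: probability_setT. Qed.

HB.instance Definition _ := Kernel_isProbability.Build _ _ _ _ _ (pkern mK) pkernT.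

Lemma measurable_fun_integral_family2 (f : T * O -> \bar R) :
  measurable_fun setT f -> (forall x, 0 <= f x) ->
  measurable_fun setT (fun t => \int[K t]_o f (t, o)).
Proof. by move=> mf f0; exact: (measurable_fun_integral_finite_kernel f (pkern mK)). Qed.

Lemma measurable_fun_integral_family (f : O -> \bar R) :
  measurable_fun setT f -> (forall x, 0 <= f x) ->
  measurable_fun setT (fun t => \int[K t]_o f o).
Proof.
move=> mf f0; apply: (@measurable_fun_integral_family2 (fun x => f x.2)) => //.
exact: measurableT_comp.
Qed.

End pkern.

Section mixture.
Variables (V : probability T R) (K : T -> probability O R).

Definition mixture (mK : measurable_family K) (A : set O) := \int[V]_t K t A.

Hypothesis mK : measurable_family K.

Let mixture0 : mixture mK set0 = 0.
Proof. by rewrite /mixture (eq_integral (cst 0)) ?integral0// => t _; rewrite measure0. Qed.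

Let mixture_ge0 A : 0 <= mixture mK A.
Proof. exact: integral_ge0. Qed.

Let mixture_sigma_additive : semi_sigma_additive (mixture mK).
Proof.
move=> U mU tU mUU; rewrite [X in _ --> X](_ : _ = \int[V]_y (\sum_(n <oo) K y (U n))).
  apply/cvg_closeP; split.
    by apply: is_cvg_nneseries => n _ _; exact: integral_ge0.
  by rewrite closeE// integral_nneseries// => n; exact: mK.
apply: eq_integral => y _; apply/esym/cvg_lim => //.
exact/measure_semi_sigma_additive.
Qed.

HB.instance Definition _ := isMeasure.Build _ _ _ (mixture mK)
  mixture0 mixture_ge0 mixture_sigma_additive.

Let mixtureT : mixture mK setT = 1.
Proof.
rewrite /mixture (eq_integral (cst 1)).
  by rewrite integral_cst// mul1e; exact: probability_setT.
by move=> t _; exact: probability_setT.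
Qed.

HB.instance Definition _ := @Measure_isProbability.Build _ _ _ (mixture mK) mixtureT.

End mixture.
End probability_families.

Lemma integral_mixture {d d'} {T : measurableType d} {O : measurableType d'}
    {R : realType} (V : probability T R) (K : T -> probability O R)
    (P : {measure set O -> \bar R}) (f : O -> \bar R) :
  measurable_family K -> (forall A, measurable A -> P A = \int[V]_t K t A) ->
  measurable_fun setT f -> (forall x, 0 <= f x) ->
  \int[P]_o f o = \int[V]_t \int[K t]_o f o.
Proof.
move=> mK PE mf f0.
have mV : measurable_family (fun _ : unit => V) by move=> A mA; exact: measurable_cst.
have mK2 : measurable_family (fun x : unit * T => K x.2).
  by move=> A mA; exact: measurableT_comp (mK A mA) measurable_snd.
have := integral_kcomp (pkern mV) (pkern mK2) tt f0 mf; rewrite /pkern/= => <-.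
by apply: eq_measure_integral => A mA _; rewrite PE.
Qed.

Lemma unit_integrable {d} {T : measurableType d} {R : realType}
    (P : {measure set T -> \bar R}) (e : T -> R) : P setT < +oo ->
  measurable_fun setT e -> (forall x, 0 <= e x <= 1)%R -> P.-integrable setT (EFin \o e).
Proof.
move=> Poo me e01; apply: measurable_bounded_integrable => //.
exists 1%R; split=> // r r1 x _ /=; have /andP[e0 e1] := e01 x.
by rewrite ger0_norm// (le_trans e1)// ltW.
Qed.

Section determining_class.
Context {d} {T : measurableType d} {R : realType}.

Definition unit_class (E : set (T -> R)) :=
  [/\ E (cst 1%R), forall e f, E e -> E f -> E (e \* f)%R,
      forall e, E e -> forall x, (0 <= e x <= 1)%R &
      forall e, E e -> measurable_fun setT e].

(** Stability under products is the only algebraic requirement, and exponentials exp(-Y) of additive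
    functionals meet it. *)
Definition determining_class (E : set (T -> R)) := unit_class E /\
  @measurable _ T `<=`
    <<s \bigcup_(e in E) [set [set x | (c < e x)%R] | c in [set: R]] >>.

Let integral_unitB (P : {measure set T -> \bar R}) (e f : T -> R) : P setT < +oo ->
  measurable_fun setT e -> measurable_fun setT f ->
  (forall x, 0 <= f x <= e x)%R -> (forall x, e x <= 1)%R ->
  \int[P]_x ((e \- f)%R x)%:E = \int[P]_x (e x)%:E - \int[P]_x (f x)%:E.
Proof.
move=> Poo me mf fe e1; rewrite -integralB_EFin//.
  apply: unit_integrable => // x; rewrite e1 andbT.
  by have /andP[/le_trans h /h] := fe x.
apply: unit_integrable => // x; have /andP[-> /le_trans h] := fe x.
by rewrite h// e1.
Qed.

Let integral_unit_cvg (P : {measure set T -> \bar R}) (f : nat -> T -> R) (g : T -> R) :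
  P setT < +oo ->
  (forall n, measurable_fun setT (f n)) ->
  (forall n x, 0 <= f n x <= 1)%R -> (forall x, f n x @[n --> \oo] --> g x) ->
  \int[P]_x (f n x)%:E @[n --> \oo] --> \int[P]_x (g x)%:E.
Proof.
move=> Poo mf f01 fg.
apply: (@dominated_cvg _ _ _ P setT measurableT (fun n => EFin \o f n) (EFin \o g)
  (cst 1)) => //.
- by move=> n; exact/measurable_EFinP.
- by move=> x _; apply: cvg_EFin; [exact: nearW|exact: fg].
- by apply: (@unit_integrable _ _ _ P (cst 1%R) Poo) => // x; rewrite /= lexx ler01.
- by move=> n x _ /=; rewrite lee_fin; have /andP[? ?] := f01 n x; rewrite ger0_norm.
Qed.

Lemma finite_measure_eq (P Q : {measure set T -> \bar R}) (E : set (T -> R)) :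
  determining_class E -> P setT < +oo -> Q setT < +oo ->
  (forall e, E e -> \int[P]_x (e x)%:E = \int[Q]_x (e x)%:E) -> measure_eq P Q.
Proof.
move=> [[E1 EM E01 mE] gE] Poo Qoo PQ A mA.
pose H : set (T -> R) := [set f | measurable_fun setT f /\
  \int[P]_x (f x)%:E = \int[Q]_x (f x)%:E].
suff [_] : H \1_A by rewrite !integral_indic// !setIT.
apply: (@functional_monotone_class _ _ E H) (gE _ mA) => //.
- by move=> e Ee; split; [exact: mE|exact: PQ].
- move=> f g [mf fPQ] [mg gPQ] gf f1; split; first exact: measurable_funB.
  by rewrite !integral_unitB// fPQ gPQ.
- move=> f g Hf f01 fg; split.
    by apply: (measurable_fun_cvg (fun n => (Hf n).1)) => x _; exact: fg.
  have := @integral_unit_cvg P _ _ Poo (fun n => (Hf n).1) f01 fg.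
  under eq_fun do rewrite (Hf _).2.
  move=> fP; apply: (cvg_unique _ fP) => //.
  exact: (@integral_unit_cvg Q _ _ Qoo (fun n => (Hf n).1) f01 fg).
Qed.

(** The same monotone class argument as for equality of measures, applied to the functions whose
    integral is measurable in the parameter. It turns an explicit Laplace transform into
    measurability of the family. *)
Lemma measurable_familyP {d'} {U : measurableType d'} (K : U -> probability T R)
    (E : set (T -> R)) :
  determining_class E ->
  (forall e, E e -> measurable_fun setT (fun t => \int[K t]_x (e x)%:E)) ->
  measurable_family K.
Proof.
move=> [[E1 EM E01 mE] gE] KE A mA.
have Koo t : K t setT < +oo by rewrite (le_lt_trans (probability_le1 _ _))// ltry.
pose H : set (T -> R) := [set f | measurable_fun setT f /\
  measurable_fun setT (fun t => \int[K t]_x (f x)%:E)].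
suff [_] : H \1_A.
  by under eq_fun do rewrite integral_indic// setIT.
apply: (@functional_monotone_class _ _ E H) (gE _ mA) => //.
- by move=> e Ee; split; [exact: mE|exact: KE].
- move=> f g [mf fPQ] [mg gPQ] gf f1; split; first exact: measurable_funB.
  apply: (eq_measurable_fun
    (fun t => \int[K t]_x (f x)%:E - \int[K t]_x (g x)%:E)).
    by move=> t _; rewrite (integral_unitB (Koo t)).
  exact: emeasurable_funB.
- move=> f g Hf f01 fg; split.
    by apply: (measurable_fun_cvg (fun n => (Hf n).1)) => x _; exact: fg.
  apply: (emeasurable_fun_cvg _ _ (fun n => (Hf n).2)) => t _.
  exact: (@integral_unit_cvg (K t) _ _ (Koo t) (fun n => (Hf n).1) f01 fg).
Qed.

(** Testing with the product of an indicator in [o] and [E i] in [t] gives equality outside a null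
    set depending on [i]. The enumeration by [nat] merges these sets into one before the determining
    property is used pointwise. *)
Lemma ae_kernel_unique {d'} {O : measurableType d'} (P : probability O R)
    (B1 B2 : R.-pker O ~> T) (E : nat -> T -> R) :
  determining_class (range E) ->
  (forall f : O * T -> \bar R, measurable_fun setT f -> (forall y, 0 <= f y) ->
    \int[P]_o \int[B1 o]_t f (o, t) = \int[P]_o \int[B2 o]_t f (o, t)) ->
  {ae P, forall o, measure_eq (B1 o) (B2 o)}.
Proof.
move=> dE B12; have [[E1 EM E01 mE] gE] := dE.
have Ei i : range E (E i) by exists i.
have mB (B : R.-pker O ~> T) i : measurable_fun setT (fun o => \int[B o]_t (E i t)%:E).
  apply: measurable_fun_integral_kernel => [U mU|z|].
  - exact: measurable_kernel.
  - by rewrite lee_fin; case/andP: (E01 _ (Ei i) z).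
  - by apply/measurable_EFinP; exact: mE.
have B01 (B : R.-pker O ~> T) i o : 0 <= \int[B o]_t (E i t)%:E <= 1.
  rewrite integral_ge0/=; last by move=> x _; rewrite lee_fin; case/andP: (E01 _ (Ei i) x).
  rewrite (@le_trans _ _ (\int[B o]_t (cst 1 t)))//.
    apply: ge0_le_integral => //.
    - by move=> x _; rewrite lee_fin; case/andP: (E01 _ (Ei i) x).
    - by apply/measurable_EFinP; exact: mE.
    - by move=> x _; rewrite lee_fin; case/andP: (E01 _ (Ei i) x).
  by rewrite integral_cst// mul1e prob_kernel.
have : {ae P, forall o, forall i, \int[B1 o]_t (E i t)%:E = \int[B2 o]_t (E i t)%:E}.
  apply: ae_foralln => i.
  suff : ae_eq P setT (fun o => \int[B1 o]_t (E i t)%:E) (fun o => \int[B2 o]_t (E i t)%:E).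
    by apply: filterS => o; exact.
  apply: integral_ae_eq => //.
    pose g o := fine (\int[B1 o]_t (E i t)%:E).
    rewrite (_ : (fun _ => _) = EFin \o g); last first.
      apply/funext => o; rewrite /g /= fineK//.
      have /andP[? B1o] := B01 B1 i o.
      by rewrite ge0_fin_numE// (le_lt_trans B1o)// ltry.
    apply: unit_integrable; [|exact: measurableT_comp|].
      by rewrite (le_lt_trans (probability_le1 _ _))// ltry.
    move=> o; have /andP[? B1o] := B01 B1 i o; rewrite /g fine_ge0//=.
    by rewrite -lee_fin fineK// ge0_fin_numE// (le_lt_trans B1o)// ltry.
  move=> A _ mA.
  have := B12 (fun y => (\1_A y.1 * E i y.2)%:E) _ _.
  have h (B : R.-pker O ~> T) : \int[P]_(o in A) \int[B o]_t (E i t)%:E =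
      \int[P]_o \int[B o]_t (\1_A o * E i t)%:E.
    rewrite integral_mkcond; apply: eq_integral => o _.
    under eq_integral do rewrite EFinM.
    rewrite ge0_integralZl//.
    - by rewrite patchE indicE; case: ifPn; rewrite ?mul1e ?mul0e.
    - by apply/measurable_EFinP; exact: mE.
    - by move=> x _; rewrite lee_fin; case/andP: (E01 _ (Ei i) x).
  rewrite !h; apply.
    apply/measurable_EFinP/measurable_funM; last exact: measurableT_comp (mE _ (Ei i)) _.
    by apply: measurableT_comp => //; exact: measurable_indic.
  by move=> y; rewrite lee_fin mulr_ge0//; case/andP: (E01 _ (Ei i) y.2).
apply: filterS => o EB; apply: (finite_measure_eq dE); rewrite ?prob_kernel ?ltry//.
by move=> _ [i _ <-]; exact: EB.
Qed.

End determining_class.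

Section almost_everywhere_domain.
Context {d} {T : measurableType d} {R : realType}.

(** Read off the definition by simple functions, hence valid for integrands cut off at a set whose
    measurability is unknown. *)
Let le_nnintegral (mu : {measure set T -> \bar R}) (f g : T -> \bar R) :
  (forall x, 0 <= f x) -> (forall x, f x <= g x) -> \int[mu]_x f x <= \int[mu]_x g x.
Proof.
move=> f0 fg; have g0 x : 0 <= g x by exact: le_trans (fg x).
rewrite !ge0_integralTE//; apply: le_ereal_sup => _ [h hf <-]; exists h => // x.
exact: le_trans (fg x).
Qed.

(** The integral over [C] is squeezed between the integrals of [g] over the whole space and over the
    complement of a measurable null set containing the complement of [C]. Only [g] is measurable
    here; [f] is meaningful on [C] alone. *)
Lemma integral_ae_domain (V : probability T R) (C : set T) (f g : T -> \bar R) :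
  {ae V, forall t, C t} -> measurable_fun setT g -> (forall t, 0 <= g t) ->
  (forall t, C t -> f t = g t) -> \int[V]_(t in C) f t = \int[V]_t g t.
Proof.
move=> [N [mN VN CN]] mg g0 fg.
rewrite integral_mkcond (_ : f \_ C = g \_ C); last first.
  by apply/funext => t; rewrite !patchE; case: ifPn => // /set_mem; exact: fg.
have gC0 t : 0 <= (g \_ C) t by rewrite patchE; case: ifPn.
apply/eqP; rewrite eq_le; apply/andP; split.
  by apply: le_nnintegral => // t; rewrite patchE; case: ifPn.
rewrite [leLHS](ge0_negligible_integral mN)// setTD integral_mkcond.
apply: le_nnintegral => t; rewrite patchE; case: ifPn => // /set_mem nNt.
rewrite patchE mem_set//; apply: contrapT => nCt.
by apply: nNt; apply: CN.
Qed.

End almost_everywhere_domain.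

(** * Exponential integrals and estimates *)

Lemma integral_indicM {d} {T : measurableType d} {R : realType}
    (mu : {measure set T -> \bar R}) (A : set T) (g : T -> R) :
  \int[mu]_x (\1_A x * g x)%:E = \int[mu]_(x in A) (g x)%:E.
Proof.
rewrite [RHS]integral_mkcond; apply: eq_integral => x _.
by rewrite patchE indicE; case: ifPn; rewrite ?mul1r ?mul0r.
Qed.

Section frullani.
Context {R : realType}.
Local Notation lambda := (@lebesgue_measure R).

Lemma FTC2_is_derive (F f : R -> R) (a b : R) : (a < b)%R ->
  (forall x : R, (a <= x <= b)%R -> is_derive x (1%R : R) F (f x)) ->
  (forall x : R, (a <= x <= b)%R -> {for x, continuous f}) ->
  \int[lambda]_(x in `[a, b]) (f x)%:E = (F b - F a)%:E.
Proof.
move=> ab dF cf.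
have cF x : (a <= x <= b)%R -> {for x, continuous F}.
  move=> axb; apply/differentiable_continuous/derivable1_diffP.
  by have [] := dF x axb.
rewrite EFinB; apply: continuous_FTC2 => //.
- by apply: continuous_in_subspaceT => x; rewrite inE/= in_itv/=; exact: cf.
- split.
  + by move=> x; rewrite in_itv/= => /andP[ax xb]; have [] := dF x; rewrite ?ltW.
  + by apply/cvg_at_right_filter/cF; rewrite lexx ltW.
  + by apply/cvg_at_left_filter/cF; rewrite lexx ltW.
- move=> x; rewrite in_itv/= => /andP[ax xb].
  by rewrite derive1E; have [] := dF x; rewrite ?ltW// => _ ->.
Qed.

Lemma integral_expRN (c : R) : (0 < c)%R ->
  \int[lambda]_(r in `]0%R, +oo[) (expR (- (c * r)))%:E = (c^-1)%:E.
Proof.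
move=> c0.
have me : measurable_fun setT (fun r : R => expR (- (c * r))).
  by apply: measurableT_comp => //; apply: measurableT_comp => //; exact: measurable_funM.
rewrite integral_itv_obnd_cbnd; last by apply: measurable_funTS; exact/measurable_EFinP.
have := integral_exponential_pdf c0.
rewrite [X in X = _ -> _](_ : _ =
    \int[lambda]_(r in `[0%R, +oo[) (c%:E * (expR (- (c * r)))%:E)); last first.
  rewrite [RHS]integral_mkcond; apply: eq_integral => x _.
  rewrite patchE /exponential_pdf patchE.
  by case: ifPn => // _; rewrite EFinM mulNr.
rewrite ge0_integralZl//=; last 2 first.
- by apply/measurable_EFinP; exact: measurable_funTS.
- by rewrite lee_fin ltW.
move=> /(congr1 (fun x => (c^-1)%:E * x)).
by rewrite muleA -EFinM mulVf ?gt_eqF// mul1e mule1.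
Qed.

(** Tonelli for exp(-(a + s) r) on r > 0 and 0 <= s <= h: integrating over [s] first produces (1 -
    e^{-rh})/r times e^{-ar}, integrating over [r] first produces 1/(a + s). *)
Lemma frullani (a h : R) : (0 < a)%R -> (0 <= h)%R ->
  \int[lambda]_(r in `]0%R, +oo[)
    ((1 - expR (- (r * h))) * (r^-1 * expR (- (a * r))))%:E = (ln (1 + h / a))%:E.
Proof.
move=> a0; rewrite le_eqVlt => /predU1P[<-|h0].
  rewrite mul0r addr0 ln1 integral0_eq// => r _.
  by rewrite mulr0 oppr0 expR0 subrr mul0r.
pose f (x : R * R) :=
  (\1_(`]0%R, +oo[%classic) x.1 * (\1_(`[0%R, h]%classic) x.2 * expR (- ((a + x.2) * x.1))))%:E.
have mf : measurable_fun setT f.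
  apply/measurable_EFinP; apply: measurable_funM.
    by apply: measurableT_comp => //; exact: measurable_indic.
  apply: measurable_funM.
    by apply: measurableT_comp => //; exact: measurable_indic.
  apply: measurableT_comp => //; apply: measurableT_comp => //.
  by apply: measurable_funM => //; exact: measurable_funD.
have f0 x : 0 <= f x by rewrite lee_fin !mulr_ge0// expR_ge0.
have := fubini_tonelli (m1 := lambda) (m2 := lambda) f mf f0.
rewrite [X in X = _ -> _](_ : _ = \int[lambda]_(r in `]0%R, +oo[)
    ((1 - expR (- (r * h))) * (r^-1 * expR (- (a * r))))%:E); last first.
  rewrite [RHS]integral_mkcond; apply: eq_integral => r _.
  rewrite patchE /f /= indicE; case: ifPn => [|r0]; last first.
    by rewrite integral0_eq// => s _; rewrite mul0r.
  rewrite inE/= in_itv/= andbT => r0.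
  under eq_integral do rewrite mul1r.
  rewrite integral_indicM.
  have dF (s : R) : (0 <= s <= h)%R -> is_derive s (1%R : R)
      (fun s => - r^-1 * expR (- ((a + s) * r)))%R (expR (- ((a + s) * r))).
    by move=> _; apply: is_derive_eq; rewrite /GRing.scale /=; field; rewrite gt_eqF.
  have cf (s : R) : (0 <= s <= h)%R ->
      {for s, continuous (fun s : R => expR (- ((a + s) * r)))}.
    move=> _; apply: continuous_comp; last exact: continuous_expR.
    apply: continuousN; apply: continuousM; last exact: cst_continuous.
    by apply: continuousD; [exact: cst_continuous|exact: id].
  rewrite (FTC2_is_derive h0 dF cf); congr EFin.
  rewrite addr0 (_ : (- ((a + h) * r) = - (a * r) + - (r * h))%R); last by ring.
  by rewrite expRD; ring.
move=> ->.
rewrite [LHS](_ : _ = \int[lambda]_(s in `[0%R, h]) ((a + s)^-1)%:E).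
  have dF (s : R) : (0 <= s <= h)%R -> is_derive s (1%R : R)
      (fun s => ln (a + s))%R (a + s)^-1%R.
    move=> /andP[s0 _]; have as0 : (0 < a + s)%R by rewrite ltr_wpDr.
    have dl : is_derive (a + s)%R (1%R : R) (@ln R) (a + s)^-1%R by exact: is_derive1_ln.
    by apply: is_derive_eq; rewrite /GRing.scale /=; ring.
  have cf (s : R) : (0 <= s <= h)%R -> {for s, continuous (fun s : R => (a + s)^-1%R)}.
    move=> /andP[s0 _]; apply: continuousV; first by rewrite gt_eqF// ltr_wpDr.
    by apply: continuousD; [exact: cst_continuous|exact: id].
  rewrite (FTC2_is_derive h0 dF cf) addr0 -ln_div ?posrE ?addr_gt0//.
  by congr (ln _)%:E; field; rewrite gt_eqF.
rewrite [RHS]integral_mkcond; apply: eq_integral => s _.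
rewrite patchE /f /=; case: ifPn => [|s0]; last first.
  by rewrite integral0_eq// => r _; rewrite [\1_(`[0%R, h]%classic) s]indicE (negbTE s0) mul0r mulr0.
move=> s0h; move: (s0h); rewrite inE/= in_itv/= => /andP[s0 _].
under eq_integral do rewrite [\1_(`[0%R, h]%classic) s]indicE s0h mul1r.
by rewrite integral_indicM integral_expRN// ltr_wpDr.
Qed.

End frullani.

Section exponential_estimates.
Context {R : realType}.
Implicit Types x y : R.
Local Open Scope ring_scope.

Lemma onemexpRN_le x : 1 - expR (- x) <= x.
Proof. by have := expR_ge1Dx (- x); lra. Qed.

(** From e^{-x} <= 1/(1 + x) <= 1 - x + x^2. A quadratic error is what is wanted: it will be summed
    over cells whose squared masses add up to nearly nothing. *)
Lemma onemexpRN_ge x : 0 <= x -> x - x ^+ 2 <= 1 - expR (- x).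
Proof.
move=> x0; have : expR (- x) <= (1 + x)^-1.
  by rewrite expRN lef_pV2 ?posrE ?expR_gt0 ?expR_ge1Dx// ltr_pwDl.
have : (1 + x)^-1 <= 1 - x + x ^+ 2.
  rewrite -[leLHS]mul1r ler_pdivrMr; last by rewrite ltr_pwDl.
  have := exprn_ge0 3 x0.
  by rewrite exprS; lra.
by lra.
Qed.

(* strict convexity of the exponential *)
Lemma expRB1_div_lt x y : 0 < x -> x < y -> (expR x - 1) * y < (expR y - 1) * x.
Proof.
move=> x0 xy; have y0 : 0 < y by exact: lt_trans xy.
have h1 : expR x * (1 + (y - x)) < expR y.
  rewrite -ltr_pdivlMl ?expR_gt0// -expRN -expRD [(- x + y)%R]addrC.
  by apply: expR_gt1Dx; rewrite subr_eq0 gt_eqF.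
have h2 : expR x * (1 - x) < 1.
  rewrite -ltr_pdivlMl ?expR_gt0// mulr1 -expRN.
  by apply: expR_gt1Dx; rewrite oppr_eq0 gt_eqF.
have h3 : x * (expR x * (1 + (y - x))) < x * expR y by rewrite ltr_pM2l.
have h4 : (y - x) * (expR x * (1 - x)) < (y - x) * 1 by rewrite ltr_pM2l// subr_gt0.
by have := ltrD h3 h4; lra.
Qed.

Lemma expRB1_div_surj (q : R) : 1 < q -> exists2 y, 0 < y & expR y - 1 = q * y.
Proof.
move=> q1; have q0 : 0 < q by lra.
(* A positive lower end keeps the trivial root y = 0 out of the intermediate value argument. There
   e^{-b} >= 1 - b = 1/q, so e^b - 1 <= q - 1 = q b. At 4q the quadratic term of the exponential
   already exceeds q times 4q. *)
pose b := 1 - q^-1.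
have b0 : 0 < b by rewrite subr_gt0 invf_lt1.
have bq : b <= 4 * q.
  have : 0 < q^-1 by rewrite invr_gt0.
  by rewrite /b; lra.
pose f y := expR y - 1 - q * y.
have cf : continuous f.
  move=> y; apply: cvgB; last by apply: cvgMr; exact: cvg_id.
  by apply: cvgB; [exact: continuous_expR|exact: cvg_cst].
have fb : f b <= 0.
  rewrite /f; have : expR b <= q.
    rewrite -[leRHS]invrK -[leLHS]invrK lef_pV2 ?posrE ?invr_gt0 ?expR_gt0//.
    by rewrite -expRN; have := expR_ge1Dx (- b); rewrite /b; lra.
  by rewrite /b mulrBr mulfV ?gt_eqF//; lra.
have fq : 0 <= f (4 * q).
  have := expR_ge1Dxn 1 (ltW (mulr_gt0 (ltr0Sn _ 3) q0) : 0 <= 4 * q).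
  rewrite /f => h.
  have : q * (4 * q) <= (4 * q) ^+ 2 / 2`!%:R.
    by rewrite (_ : 2`! = 2)%N// expr2 ler_pdivlMr//; have := mulr_gt0 q0 q0; lra.
  by lra.
have [|c] := @IVT _ f b (4 * q) 0 bq (continuous_subspaceT cf).
  by rewrite ge_min fb le_max fq orbT.
rewrite in_itv/= => /andP[bc _] /eqP; rewrite /f subr_eq0 => /eqP fc.
by exists c => //; exact: lt_le_trans bc.
Qed.

End exponential_estimates.

(** * Law of large numbers along a monotone sequence *)

Section law_of_large_numbers.
Context {R : realType}.

Section blocks.
Local Open Scope ring_scope.
Variables (s : nat -> R).
Hypothesis nds : {homo s : m n / (m <= n)%N >-> m <= n}.
Hypothesis s_oo : forall A, exists n, A <= s n.

Lemma first_square_index :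
  exists f : nat -> nat, forall j, j%:R ^+ 2 <= s (f j) /\
    forall n, j%:R ^+ 2 <= s n -> (f j <= n)%N.
Proof.
suff /choice[f fP] : forall j : nat, exists m, j%:R ^+ 2 <= s m /\
    forall n, j%:R ^+ 2 <= s n -> (m <= n)%N by exists f.
move=> j; have [n jn] := s_oo (j%:R ^+ 2).
have ex : exists n, j%:R ^+ 2 <= s n by exists n.
by exists (ex_minn ex); case: ex_minnP => m jm minm; split => // k; exact: minm.
Qed.

Variables (f : nat -> nat).
Hypothesis f_min : forall j, j%:R ^+ 2 <= s (f j) /\
  forall n, j%:R ^+ 2 <= s n -> (f j <= n)%N.

(** The usual upper comparison with the first index of the next block fails here, since [s] may jump
    far beyond (j+1)^2 there. At the last index of the block [s] is still below (j+1)^2. The maximum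
    covers empty blocks, where [f j.+1 = f j]. *)
Definition last_square_index j := maxn (f j) (f j.+1).-1.

Lemma le_last_square_index j : j%:R ^+ 2 <= s (last_square_index j).
Proof. by rewrite (le_trans (f_min j).1)// nds// leq_maxl. Qed.

(* Along the indices between two consecutive squares [s] varies by a factor
   tending to 1, so monotonicity reduces the convergence to the end points. *)
Lemma cvg_square_blocks (N : nat -> R) (u : R) :
  {homo N : m n / (m <= n)%N >-> m <= n} -> (forall n, 0 <= N n) ->
  N (f j) / s (f j) @[j --> \oo] --> u ->
  N (last_square_index j) / s (last_square_index j) @[j --> \oo] --> u ->
  N n / s n @[n --> \oo] --> u.
Proof.
move=> ndN N0 Nf Nl.
(* The block of [n], with J(n)^2 <= s(n) < (J(n)+1)^2. It contains [n], so it is not empty and the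
   maximum in [last_square_index] is its second entry. *)
pose J n := Num.trunc (Num.sqrt (s n)).
have J_itv n : 0 <= s n -> (J n)%:R ^+ 2 <= s n < (J n).+1%:R ^+ 2.
  move=> sn0; have /andP[h1 h2] := truncn_itv (sqrtr_ge0 (s n)).
  have -> : s n = Num.sqrt (s n) ^+ 2 by rewrite sqr_sqrtr.
  by rewrite lerXn2r ?nnegrE ?sqrtr_ge0//= ltrXn2r ?nnegrE ?sqrtr_ge0.
have s_ge j n : (f j <= n)%N -> j%:R ^+ 2 <= s n.
  by move=> fn; rewrite (le_trans (f_min j).1)// nds.
have Joo : J n @[n --> \oo] --> \oo.
  apply/cvgnyPge => A; exists (f A) => // n /= /s_ge An.
  rewrite leqNgt; apply/negP => JA.
  have sn0 : 0 <= s n by rewrite (le_trans _ An)// exprn_ge0.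
  have /andP[_] := J_itv n sn0; rewrite ltNge => /negP; apply.
  by rewrite (le_trans _ An)// lerXn2r ?nnegrE// ler_nat.
have ratio : (j%:R / j.+1%:R : R) @[j --> \oo] --> (1 : R).
  rewrite (_ : (fun _ => _) = (fun j => 1 - j.+1%:R^-1)); last first.
    by apply/funext => j; rewrite -natr1; field; rewrite natr1.
  rewrite -[X in _ --> X]subr0; apply: cvgB; first exact: cvg_cst.
  exact: cvg_harmonic.
have ratio2 : ((j%:R / j.+1%:R) ^+ 2 : R) @[j --> \oo] --> (1 : R).
  by rewrite -[X in _ --> X](mulr1 (1 : R)); apply: cvgM.
pose lo j := N (f j) / s (f j) * (j%:R / j.+1%:R) ^+ 2.
pose up j := N (last_square_index j) / s (last_square_index j) * ((j%:R / j.+1%:R) ^+ 2)^-1.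
have lou : lo j @[j --> \oo] --> u by rewrite -[X in _ --> X]mulr1; exact: cvgM.
have upu : up j @[j --> \oo] --> u.
  rewrite -[X in _ --> X]mulr1; apply: cvgM => //; rewrite -[X in _ --> X]invr1.
  by apply: cvgV => //; exact: oner_neq0.
apply: (@squeeze_cvgr _ _ _ _ (lo \o J) (up \o J)).
- exists (f 1%N) => // n /= fn.
  have sn1 : 1 <= s n by have := s_ge _ _ fn; rewrite expr1n.
  have sn0 : 0 < s n by rewrite (lt_le_trans _ sn1).
  have /andP[Js sJ] := J_itv n (ltW sn0).
  set j := J n in Js sJ *.
  have j0 : 0 < j%:R :> R.
    rewrite ltr0n lt0n; apply/eqP => j0.
    by move: sJ; rewrite j0 expr1n ltNge sn1.
  have fjn : (f j <= n)%N by exact: (f_min j).2.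
  have nfj : (n < f j.+1)%N.
    by rewrite ltnNge; apply/negP => /s_ge; rewrite leNgt sJ.
  have lE : last_square_index j = (f j.+1).-1.
    by apply/maxn_idPr; rewrite -ltnS prednK ?(leq_ltn_trans _ nfj).
  have nl : (n <= last_square_index j)%N by rewrite lE -ltnS prednK ?(leq_ltn_trans _ nfj).
  have sl : s (last_square_index j) < j.+1%:R ^+ 2.
    rewrite ltNge; apply/negP => /(f_min j.+1).2; rewrite lE leqNgt prednK ?leqnn//.
    exact: leq_ltn_trans nfj.
  have jf := (f_min j).1.
  have j20 : 0 < j%:R ^+ 2 :> R by rewrite exprn_gt0.
  have sf0 : 0 < s (f j) by rewrite (lt_le_trans j20).
  have sl0 : 0 < s (last_square_index j) by rewrite (lt_le_trans j20)// le_last_square_index.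
  have j120 : 0 < j.+1%:R ^+ 2 :> R by rewrite exprn_gt0.
  apply/andP; split; rewrite /lo /up /=.
    rewrite expr_div_n mulrACA -mulrA ler_pM//.
    + by rewrite mulr_ge0// ?invr_ge0 ?mulr_ge0 ?invr_ge0// ltW.
    + exact: ndN.
    + rewrite -[leRHS]mul1r ler_pdivlMr//.
      rewrite (_ : _ * s n = (j%:R ^+ 2 * s n) / (s (f j) * j.+1%:R ^+ 2)); last first.
        move: (s (f j)) (j.+1%:R ^+ 2) (s n) (j%:R ^+ 2) => a b c e.
        by rewrite invfM; ring.
      by rewrite ler_pdivrMr ?mulr_gt0// mul1r ler_pM// ltW.
  rewrite -exprVn invf_div expr_div_n mulrACA -mulrA ler_pM ?invr_ge0//.
  + exact: ltW.
  + exact: ndN.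
  + rewrite -[leLHS]mul1r ler_pdivrMr//.
    rewrite (_ : _ * s n = (j.+1%:R ^+ 2 * s n) / (s (last_square_index j) * j%:R ^+ 2)).
      by rewrite ler_pdivlMr ?mulr_gt0// mul1r ler_pM// ltW.
    move: (s (last_square_index j)) (j.+1%:R ^+ 2) (s n) (j%:R ^+ 2) => a b c e.
    by rewrite invfM; ring.
- exact: (cvg_comp _ _ Joo lou).
- exact: (cvg_comp _ _ Joo upu).
Qed.

End blocks.

Let nneseries_invsqr : \sum_(0 <= j <oo) ((j.+1%:R ^+ 2)^-1 : R)%:E < +oo.
Proof.
apply: (@le_lt_trans _ _ 2%:R%:E); last exact: ltry.
apply: lime_le; first by apply: is_cvg_nneseries => n _ _; rewrite lee_fin invr_ge0 exprn_ge0.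
apply: nearW => n; rewrite sumEFin lee_fin.
(* Telescoping with 1/x^2 <= 2/x - 2/(x + 1) for x >= 1. *)
suff : (\sum_(0 <= j < n) (j.+1%:R ^+ 2)^-1 <= 2 - 2 / n.+1%:R :> R)%R.
  by move=> /le_trans -> //; rewrite gerBl mulr_ge0.
elim: n => [|n IHn]; first by rewrite big_nil invr1; lra.
rewrite big_nat_recr//= (le_trans (lerD IHn (lexx _)))//.
rewrite -(natr1 n.+1); have : (1 <= n.+1%:R :> R)%R by rewrite ler1n.
move: (n.+1%:R : R) => x x1.
have x0 : (0 < x)%R by lra.
have x10 : (0 < x + 1)%R by lra.
rewrite -subr_ge0 (_ : (_ - _)%R = ((x ^+ 2 * (x + 1))^-1 * (x - 1))%R).
  by rewrite mulr_ge0 ?subr_ge0// invr_ge0 mulr_ge0 ?exprn_ge0//; exact: ltW.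
by field; rewrite !gt_eqF.
Qed.

Context {d} {T : measurableType d} (P : probability T R).

(** The sum of all squared deviations has finite integral, so it is finite almost everywhere and its
    terms tend to zero. This takes the place of Chebyshev and Borel-Cantelli. *)
Let cvg_of_second_moments (Y : nat -> T -> R) (a C : R) :
  (forall j, measurable_fun setT (Y j)) ->
  (forall j, \int[P]_x ((Y j.+1 x - a) ^+ 2)%:E <= (C / j.+1%:R ^+ 2)%:E) ->
  {ae P, forall x, Y j x @[j --> \oo] --> a}.
Proof.
move=> mY YC.
pose y j x : \bar R := ((Y j.+1 x - a) ^+ 2)%:E.
have y0 j x : 0 <= y j x by rewrite lee_fin sqr_ge0.
have my j : measurable_fun setT (y j).
  apply/measurable_EFinP; apply: measurable_funX.
  by apply: measurable_funB => //; exact: mY.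
have ysum : \int[P]_x \sum_(0 <= j <oo) y j x < +oo.
  rewrite integral_nneseries//.
  apply: (@le_lt_trans _ _ (\sum_(0 <= j <oo) (`|C|%:E * ((j.+1%:R ^+ 2)^-1 : R)%:E))).
    apply: lee_nneseries => j; first by move=> _ _; exact: integral_ge0.
    move=> _; rewrite (le_trans (YC j))// lee_fin ler_wpM2r ?ler_norm// invr_ge0 exprn_ge0//.
  rewrite nneseriesZl; last by move=> j _; rewrite lee_fin invr_ge0 exprn_ge0.
  by rewrite lte_mul_pinfty// nneseries_ge0// => j _ _; rewrite lee_fin invr_ge0 exprn_ge0.
have sum0 x : 0 <= \sum_(0 <= j <oo) y j x by exact: nneseries_ge0.
have iy : P.-integrable setT (fun x => \sum_(0 <= j <oo) y j x).
  apply/integrableP; split; first exact: ge0_emeasurable_sum.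
  by under eq_integral do rewrite gee0_abs//.
have := integrable_ae measurableT iy.
apply: filterS => x /(_ I) yfin.
have yx : y j x @[j --> \oo] --> 0.
  have tail := @nneseries_tail_cvg _ (y ^~ x) xpredT.
  apply: (@squeeze_cvge _ _ _ _ (cst 0) _ (fun N => \sum_(N <= k <oo) y k x)).
  - apply: nearW => j; rewrite y0/= (nneseries_split j 1)// addn1 big_nat1.
    by rewrite leeDl// nneseries_ge0.
  - exact: cvg_cst.
  - by apply: tail => //; rewrite ltey_eq yfin.
have {}yx : ((Y j.+1 x - a) ^+ 2)%R @[j --> \oo] --> (0 : R)%R.
  by move/fine_cvgP : yx => [].
rewrite -(cvg_shiftS (fun j => Y j x)); apply/cvgrPdist_lt => e e0.
have e20 : (0 < e ^+ 2)%R by rewrite exprn_gt0.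
move/cvgrPdist_lt : yx => /(_ _ e20); apply: filterS => j.
by rewrite sub0r normrN normrX ltr_pXn2r ?nnegrE ?(ltW e0)// distrC.
Qed.

(** A second moment linear in [s] becomes C/s after normalization, which is summable along indices
    where [s] exceeds j^2. Both ends of the blocks are such subsequences, and monotonicity fills the
    gaps. *)
Lemma lln_second_moment (N : nat -> T -> R) (s : nat -> R) (u C : R) :
  (forall n, measurable_fun setT (N n)) -> (forall n x, 0 <= N n x)%R ->
  (forall x, {homo N ^~ x : m n / (m <= n)%N >-> (m <= n)%R}) ->
  {homo s : m n / (m <= n)%N >-> (m <= n)%R} -> (forall A, exists n, (A <= s n)%R) ->
  (0 <= C)%R ->
  (forall n, \int[P]_x ((N n x - u * s n) ^+ 2)%:E <= (C * s n)%:E) ->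
  {ae P, forall x, N n x / s n @[n --> \oo] --> u}%R.
Proof.
move=> mN N0 ndN nds soo C0 NC.
have [f fP] := first_square_index soo.
have sub g : (forall j, j%:R ^+ 2 <= s (g j))%R ->
    {ae P, forall x, N (g j) x / s (g j) @[j --> \oo] --> u}%R.
  move=> gs.
  apply: (@cvg_of_second_moments (fun j x => N (g j) x / s (g j)) u C)%R.
    by move=> j; apply: measurable_funM => //; exact: mN.
  move=> j; pose t := s (g j.+1); rewrite -/t.
  have t0 : (0 < t)%R by rewrite (lt_le_trans _ (gs _))// exprn_gt0.
  rewrite (eq_integral (fun x => ((t ^+ 2)^-1)%:E * ((N (g j.+1) x - u * t) ^+ 2)%:E)); last first.
    by move=> x _; rewrite -EFinM; congr EFin; field; rewrite gt_eqF.
  rewrite ge0_integralZl//; last 3 first.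
  - apply/measurable_EFinP; apply: measurable_funX.
    by apply: measurable_funB => //; exact: mN.
  - by move=> x _; rewrite lee_fin sqr_ge0.
  - by rewrite lee_fin invr_ge0 sqr_ge0.
  rewrite (le_trans (lee_wpmul2l _ (NC _)))// ?lee_fin ?invr_ge0 ?sqr_ge0//.
  rewrite (_ : t ^- 2 * (C * s (g j.+1)) = C / t)%R; last by rewrite -/t; field; rewrite gt_eqF.
  by rewrite ler_wpM2l// lef_pV2 ?posrE ?exprn_gt0//; exact: gs.
have := sub _ (fun j => (fP j).1); have := sub _ (le_last_square_index nds fP).
apply: filterS2 => x h1 h2; exact: (cvg_square_blocks nds fP).
Qed.

End law_of_large_numbers.

(** * Spaces of locally finite measures *)

Section countable_base.
Context {R : realType} {X : polishType R}.

Lemma metric_ball_open (x : X) (r : R) : open (ball x r).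
Proof.
rewrite openE => y; rewrite ballEmdist /= => xy; apply/nbhs_ballP.
exists (r - mdist x y)%R; first by rewrite /= subr_gt0.
move=> z; rewrite !ballEmdist /= => yz.
by rewrite (le_lt_trans (metric_triangle x y z))// -ltrBrDl.
Qed.

Lemma polish_countable_base : exists A : nat -> set X, (forall n, open (A n)) /\
  forall U x, open U -> U x -> exists2 n, A n x & A n `<=` U.
Proof.
have [D /countable_injP[f finj] dD] := @separable_dense R X.
(* Since [f] is injective on [D], each union is one ball or empty. Working with codes gives a
   sequence indexed by [nat] even when [D] is finite or empty. *)
pose A (n : nat) := if choice.unpickle n is Some (k, m) then
  \bigcup_(x in [set x | D x /\ f x = k]) ball x (m.+1%:R^-1 : R) else set0.
exists A; split=> [n|U x oU Ux].
  rewrite /A; case: choice.unpickle => [[k m]|]; last exact: open0.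
  by apply: bigcup_open => y _; exact: metric_ball_open.
have /nbhs_ballP[e /= e0 xeU] : nbhs x U by apply: open_nbhs_nbhs.
have [m me] : exists m, (m.+1%:R^-1 < e / 2 :> R)%R.
  exists (Num.trunc (e / 2)^-1); rewrite invf_plt ?posrE ?divr_gt0//.
  exact: truncnS_gt.
have m0 : (0 < m.+1%:R^-1 :> R)%R by rewrite invr_gt0.
have [y [xy Dy]] := dD (ball x m.+1%:R^-1) (ex_intro _ x (ballxx x m0))
  (metric_ball_open x m.+1%:R^-1).
exists (choice.pickle (f y, m)); rewrite /A choice.pickleK.
  by exists y => //; exact: ball_sym.
move=> z [y' [Dy' /finj]]; move=> /(_ (mem_set Dy') (mem_set Dy)) -> yz.
apply: xeU; rewrite (splitr e); apply: (ball_triangle (y := y)).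
  by apply: le_ball xy; exact: ltW.
by apply: le_ball yz; exact: ltW.
Qed.

End countable_base.

Section random_measures.
Context {R : realType} {X : polishType R}.

Lemma bounded_borelW (B : set (borel X)) : bounded_borel B -> measurable B.
Proof. by case. Qed.

Lemma bounded_borelS (A B : set (borel X)) :
  measurable A -> A `<=` B -> bounded_borel B -> bounded_borel A.
Proof. by move=> mA AB [_ [x [r Bxr]]]; split=> //; exists x, r; exact: subset_trans Bxr. Qed.

Lemma bounded_borelI (A B : set (borel X)) :
  measurable A -> bounded_borel B -> bounded_borel (A `&` B).
Proof.
by move=> mA bB; apply: (bounded_borelS _ _ bB) => //; apply: measurableI => //; case: bB.
Qed.

Lemma bounded_borelD (A B : set (borel X)) :
  bounded_borel A -> measurable B -> bounded_borel (A `\` B).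
Proof.
by move=> bA mB; apply: (bounded_borelS _ _ bA) => //; apply: measurableD => //; case: bA.
Qed.

Lemma borel_open (U : set X) : open U -> measurable (U : set (borel X)).
Proof. by move=> oU; exact: sub_sigma_algebra. Qed.

Lemma bounded_borel_ball (x : X) (r : R) : bounded_borel (ball x r : set (borel X)).
Proof. by split; [exact: (borel_open (metric_ball_open x r))|exists x, r]. Qed.

Lemma measurable_singleton (x : X) : measurable ([set x] : set (borel X)).
Proof.
rewrite -[X in measurable X]setCK; apply: measurableC; apply: borel_open.
by rewrite openC; apply: accessible_closed_set1; apply: hausdorff_accessible;
  exact: metric_hausdorff.
Qed.

Lemma lfm_fin_num (kappa : lfmeasure X) (B : set (borel X)) :
  bounded_borel B -> kappa B \is a fin_num.
Proof. by move=> bB; rewrite ge0_fin_numE// lfm_fin. Qed.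

Lemma measurable_lfm_eval_bounded (B : set (borel X)) : bounded_borel B ->
  measurable_fun setT (fun kappa : lfmeasure X => kappa B).
Proof.
move=> bB _ Y mY; rewrite setTI; apply: sub_sigma_algebra.
by exists B => //; exists Y => //; rewrite setTI.
Qed.

Lemma measurable_pm_eval_bounded (B : set (borel X)) : bounded_borel B ->
  measurable_fun setT (fun mu : pmeasure X => mu B).
Proof.
move=> bB _ Y mY; rewrite setTI; apply: sub_sigma_algebra.
by exists B => //; exists Y => //; rewrite setTI.
Qed.

Lemma measurable_fun_lfm {d} {T : measurableType d} (f : T -> lfmeasure X) :
  (forall B, bounded_borel B -> measurable_fun setT (fun t => f t B)) ->
  measurable_fun setT f.
Proof.
move=> mf; apply: (measurability (@lfm_gen R X)) => //.
move=> _ [_ [B bB [Y mY <-]] <-]; rewrite !setTI.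
by have := mf B bB measurableT Y mY; rewrite setTI.
Qed.

Lemma measurable_fun_pm {d} {T : measurableType d} (f : T -> pmeasure X) :
  (forall B, bounded_borel B -> measurable_fun setT (fun t => f t B)) ->
  measurable_fun setT f.
Proof.
move=> mf; apply: (measurability (@pm_gen R X)) => //.
move=> _ [_ [B bB [Y mY <-]] <-]; rewrite !setTI.
by have := mf B bB measurableT Y mY; rewrite setTI.
Qed.

Lemma measurable_pm_val : measurable_fun setT (@pm_val R X).
Proof. by apply: measurable_fun_lfm => B bB; exact: measurable_pm_eval_bounded. Qed.

Variable Bn : nat -> set (borel X).
Hypothesis Bn_bounded : forall n, bounded_borel (Bn n).
Hypothesis Bn_increasing : forall n, Bn n `<=` Bn n.+1.
Hypothesis Bn_exhaust : forall A, bounded_borel A -> exists n, A `<=` Bn n.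

Lemma Bn_homo m n : (m <= n)%N -> Bn m `<=` Bn n.
Proof.
elim: n => [|n IHn]; first by rewrite leqn0 => /eqP ->.
rewrite leq_eqVlt => /predU1P[-> //|]; rewrite ltnS => /IHn.
by move/subset_trans; apply.
Qed.

Lemma Bn_bigcup : \bigcup_n Bn n = setT.
Proof.
apply/seteqP; split => // x _.
have [n xn] := Bn_exhaust (bounded_borel_ball x 1).
by exists n => //; apply: xn; exact: ballxx.
Qed.

Lemma cvg_measure_Bn (mu : {measure set (borel X) -> \bar R}) (A : set (borel X)) :
  measurable A -> mu (A `&` Bn n) @[n --> \oo] --> mu A.
Proof.
move=> mA; rewrite -[X in mu X](setIT A) -Bn_bigcup setI_bigcupr.
apply: nondecreasing_cvg_mu.
- by move=> n; apply: measurableI => //; exact: bounded_borelW.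
- apply: bigcup_measurable => n _; apply: measurableI => //; exact: bounded_borelW.
- by move=> m n mn; apply/subsetPset; apply: setIS; exact: Bn_homo.
Qed.

Lemma measurable_lfm_eval (A : set (borel X)) : measurable A ->
  measurable_fun setT (fun kappa : lfmeasure X => kappa A).
Proof.
move=> mA; apply: (emeasurable_fun_cvg (fun n (kappa : lfmeasure X) => kappa (A `&` Bn n))).
  by move=> n; apply: measurable_lfm_eval_bounded; exact: bounded_borelI.
by move=> kappa _; exact: cvg_measure_Bn.
Qed.

Variable A : nat -> set X.
Hypothesis A_open : forall n, open (A n).
Hypothesis A_base : forall U x, open U -> U x -> exists2 n, A n x & A n `<=` U.

(** Finite intersections of base sets form a pi-system, concatenation being intersection, and the
    index type stays countable. *)
Definition base_inter (s : seq nat) : set (borel X) :=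
  \big[setI/setT]_(i <- s) (A i : set (borel X)).

Lemma base_inter_cat s t : base_inter (s ++ t) = base_inter s `&` base_inter t.
Proof. by rewrite /base_inter big_cat. Qed.

Lemma measurable_base_inter s : measurable (base_inter s).
Proof.
elim: s => [|i s IHs]; rewrite /base_inter ?big_nil// big_cons.
by apply: measurableI => //; exact: borel_open.
Qed.

Lemma open_base_bigcup (U : set X) : open U ->
  U = \bigcup_(n in [set n | A n `<=` U]) A n.
Proof.
move=> oU; apply/seteqP; split=> [x Ux|x [n nU /nU]//].
by have [n nx nU] := A_base oU Ux; exists n.
Qed.

Lemma borel_base_inter : @measurable _ (borel X) = <<s range base_inter >>.
Proof.
apply/seteqP; split; last first.
  apply: smallest_sub; first exact: sigma_algebra_measurable.
  by move=> _ [s _ <-]; exact: measurable_base_inter.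
apply: smallest_sub; first exact: smallest_sigma_algebra.
move=> U oU; rewrite (open_base_bigcup oU).
apply: (@bigcup_measurable _ (g_sigma_algebraType (range base_inter))) => n _.
apply: sub_sigma_algebra; exists [:: n] => //.
by rewrite /base_inter big_seq1.
Qed.

(** Dynkin induction inside a fixed [Bn n]: there all masses are finite, so complements become
    subtractions, and every bounded set lies in some [Bn n]. *)
Lemma measurable_fun_base_inter {d} {T : measurableType d} (f : T -> lfmeasure X) :
  (forall s n, measurable_fun setT (fun t => f t (base_inter s `&` Bn n))) ->
  measurable_fun setT f.
Proof.
move=> mf; apply: measurable_fun_lfm => B bB.
have [n Bn'] := Bn_exhaust bB; rewrite -(setIidl Bn').
have fin t C : measurable C -> f t (C `&` Bn n) \is a fin_num.
  by move=> mC; apply: lfm_fin_num; exact: bounded_borelI.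
have : <<s range base_inter >> B by rewrite -borel_base_inter; exact: bounded_borelW.
apply: (dynkin_induction (P := fun C => measurable_fun setT (fun t => f t (C `&` Bn n)))
  borel_base_inter).
- by move=> _ _ [s _ <-] [t _ <-]; exists (s ++ t) => //; exact: base_inter_cat.
- by have := mf [::] n; rewrite /base_inter big_nil.
- by move=> _ [s _ <-]; exact: mf.
- move=> C mC mfC.
  rewrite (_ : (fun t => _) = (fun t => f t (setT `&` Bn n) - f t (C `&` Bn n))).
    by apply: emeasurable_funB => //; have := mf [::] n; rewrite /base_inter big_nil.
  apply/funext => t.
  rewrite setTI (measureDI (f t) (bounded_borelW (Bn_bounded n)) mC).
  by rewrite setDE (setIC (Bn n) C) addeK ?fin// setIC.
- move=> F mF tF mfF.
  rewrite (_ : (fun t => _) = (fun t => \sum_(0 <= k <oo) f t (F k `&` Bn n))).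
    by apply: ge0_emeasurable_sum => // k _; exact: mfF.
  apply/funext => t; rewrite setI_bigcupl measure_bigcup//.
  - by apply: eq_eseriesl => k; rewrite in_setT.
  - by move=> k _; apply: measurableI => //; exact: bounded_borelW.
  - exact: trivIset_setIr.
Qed.

End random_measures.

(** * The number of distinct points *)

Section support.
Context {R : realType} {X : polishType R}.
Variable A : nat -> set X.
Hypothesis A_open : forall n, open (A n).
Hypothesis A_base : forall U x, open U -> U x -> exists2 n, A n x & A n `<=` U.
Implicit Types (mu : pmeasure X) (B : set (borel X)).

Lemma setC_msupport (kappa : lfmeasure X) :
  ~` msupport kappa = \bigcup_(n in [set n | kappa (A n) = 0]) A n.
Proof.
apply/seteqP; split=> x /=.
  move=> /existsNP[U /not_implyP[oU /not_implyP[Ux /negP]]].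
  rewrite -leNgt measure_le0 => /eqP U0.
  have [n nx nU] := A_base oU Ux; exists n => //=.
  by apply: (subset_measure0 (mu := kappa) _ _ nU U0); exact: borel_open.
by move=> [n /= An0 nx] /(_ _ (A_open n) nx); rewrite An0 ltxx.
Qed.

Lemma measurable_msupport (kappa : lfmeasure X) :
  measurable (msupport kappa : set (borel X)).
Proof.
rewrite -[X in measurable X]setCK; apply: measurableC; rewrite setC_msupport.
by apply: bigcup_measurable => n _; exact: borel_open.
Qed.

Lemma measure_setC_msupport (kappa : lfmeasure X) : kappa (~` msupport kappa) = 0.
Proof.
rewrite setC_msupport.
have mA n : measurable (A n : set (borel X)) by exact: borel_open.
apply: measure_negligible; first by apply: bigcup_measurable => n _; exact: mA.
rewrite bigcup_mkcond; apply: negligible_bigcup => n.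
by case: ifPn => [/set_mem|_]; [move/negligibleP; apply|exact: negligible_set0].
Qed.

(** Every ball around a support point has positive integer mass, hence mass at least 1, and this
    survives the limit along balls shrinking to the point. *)
Lemma msupport_atom mu (x : X) : msupport mu x -> 1 <= mu [set x].
Proof.
move=> mux; pose b n : set (borel X) := ball x (n.+1%:R^-1 : R).
have bb n : bounded_borel (b n) by exact: bounded_borel_ball.
have b1 n : 1 <= mu (b n).
  have [k bk] := pm_int mu (bb n); rewrite bk lee_fin ler1n lt0n; apply/eqP => k0.
  have n0 : (0 < n.+1%:R^-1 :> R)%R by rewrite invr_gt0.
  by have := mux (b n) (metric_ball_open x _) (ballxx x n0); rewrite bk k0 ltxx.
have ndb m n : (m <= n)%N -> b n `<=` b m.
  move=> mn; apply: le_ball.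
  have m0 : (m.+1%:R : R) \is Num.pos by rewrite posrE.
  have n0 : (n.+1%:R : R) \is Num.pos by rewrite posrE.
  by rewrite (lef_pV2 n0 m0) ler_nat.
have bE : \bigcap_n b n = [set x].
  apply/seteqP; split=> [y yb|_ -> n _]; last by apply: ballxx; rewrite invr_gt0.
  apply/esym/(@mdist_positivity R X)/eqP; rewrite eq_le mdist_ge0 andbT.
  rewrite leNgt; apply/negP => xy.
  have := yb (Num.trunc (mdist x y)^-1) I; rewrite /b ballEmdist /= ltNge => /negP; apply.
  by rewrite ltW// invf_plt ?posrE//; exact: truncnS_gt.
have : mu (b n) @[n --> \oo] --> mu [set x].
  rewrite -bE; apply: nonincreasing_cvg_mu.
  - by rewrite lfm_fin.
  - by move=> n; exact: bounded_borelW.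
  - by rewrite bE; exact: measurable_singleton.
  - by move=> m n mn; apply/subsetPset; exact: ndb.
move=> /cvg_lim <-//; apply: lime_ge; last exact: nearW.
have bnon : nonincreasing_seq (mu \o b).
  move=> m n mn; apply: le_measure; [exact: (mem_set (bounded_borelW (bb n)))|
    exact: (mem_set (bounded_borelW (bb m)))|].
  exact: ndb.
exact: ereal_nonincreasing_is_cvgn.
Qed.

(** If [B] has mass k, then k + 1 support points in it would already carry mass k + 1. *)
Lemma msupport_finite mu B : bounded_borel B -> finite_set (msupport mu `&` B).
Proof.
move=> bB; apply: contrapT => infB.
have [k Bk] := pm_int mu bB.
have [F FB kF] := infinite_set_fset k.+1 infB.
have tF : trivIset [set` F] (fun x : X => [set x] : set (borel X)).
  by apply/trivIsetP => x y _ _ /eqP xy; apply/seteqP; split=> // z [/= -> /xy].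
have := measure_fbigsetU mu (fun x _ => measurable_singleton x) tF.
set S := \big[setU/set0]_(i <- _) _ => muS.
have SB : S `<=` B.
  rewrite /S -bigcup_fset => x [y /FB[_ By]] -> //.
have mS : measurable S by apply: bigsetU_measurable => i _; exact: measurable_singleton.
have : mu S <= mu B by apply: le_measure => //; apply/mem_set => //; exact: bounded_borelW.
rewrite muS Bk; apply/negP; rewrite -ltNge.
apply: (@lt_le_trans _ _ (\sum_(i <- F) (1 : \bar R))).
  by rewrite sumEFin lte_fin -(natr_sum _ _ xpredT (fun=> 1%N)) sum1_size ltr_nat.
rewrite big_seq [leRHS]big_seq; apply: lee_sum => x xF; apply: msupport_atom.
by have [] := FB x xF.
Qed.

(** Points with the same code form an atom of the algebra generated by the first [n] base sets.
    These partitions refine with [n] and eventually separate any finite set. *)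
Definition code (n : nat) (x : X) : {ffun 'I_n -> bool} := [ffun i => x \in A (i : 'I_n)].

Definition cell (n : nat) (c : {ffun 'I_n -> bool}) : set (borel X) :=
  [set x : X | code n x = c].

Lemma measurable_cell n (c : {ffun 'I_n -> bool}) : measurable (cell c).
Proof.
have -> : cell c = \bigcap_(i in [set: 'I_n]) (if c i then A i else ~` A i).
  apply/seteqP; split=> [x <- i _|x cx].
    by rewrite ffunE; case: ifPn => [/set_mem//|/negP xA Ax]; apply/xA/mem_set.
  apply/ffunP => i; rewrite ffunE; have := cx i I.
  by case: (c i) => h; [exact: mem_set|exact: memNset].
apply: fin_bigcap_measurable; first exact: finite_finset.
by move=> i _; case: ifP => _; [|apply: measurableC]; exact: borel_open.
Qed.

Lemma near_code_inj (s : seq X) : uniq s -> \forall n \near \oo, uniq (map (code n) s).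
Proof.
elim: s => [|x s IHs] /=; first by move=> _; exact: nearW.
move=> /andP[xs us].
suff : \forall n \near \oo, code n x \notin map (code n) s.
  by move=> h; near=> n; apply/andP; split; near: n => //; exact: IHs.
elim: s xs {us IHs} => [|y s IHs] /=; first by move=> _; exact: nearW.
rewrite inE negb_or => /andP[xy xs].
have [i xi yi] : exists2 i, A i x & ~ A i y.
  have d0 : (0 < mdist x y)%R by rewrite mdist_gt0.
  have [i Aix Ai] := A_base (metric_ball_open x (mdist x y)) (ballxx x d0).
  by exists i => // /Ai; rewrite ballEmdist /= ltxx.
near=> n; rewrite inE negb_or; apply/andP; split; last by near: n; exact: IHs.
have ni : (i < n)%N by near: n; exists i.+1.
apply/eqP => /ffunP/(_ (Ordinal ni)); rewrite !ffunE /= mem_set// memNset//.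
Unshelve. all: by end_near. Qed.

Definition occupied_cells (n : nat) (mu : set (borel X) -> \bar R) (B : set (borel X)) : R :=
  (\sum_(c : {ffun 'I_n -> bool}) (mu (B `&` cell c) != 0%E)%:R)%R.

Section occupied.
Variables (mu : pmeasure X) (B : set (borel X)).
Hypothesis bB : bounded_borel B.

Let F : seq X := fset_set (msupport mu `&` B : set X).

Let FP x : (x \in F) = (x \in (msupport mu `&` B : set X)).
Proof. by rewrite /F in_fset_set//; exact: msupport_finite. Qed.

Let measure_cell_neq0 n (c : {ffun 'I_n -> bool}) :
  (mu (B `&` cell c) != 0) = (c \in map (code n) F).
Proof.
have mB := bounded_borelW bB; have mc := measurable_cell c.
apply/idP/mapP => [h|[x + ->]].
  apply: contrapT => hn; move/eqP: h; apply.
  apply: (subset_measure0 (mu := mu) _ _ _ (measure_setC_msupport mu)).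
  - exact: measurableI.
  - by apply: measurableC; exact: measurable_msupport.
  - move=> x [Bx cx] sx; apply: hn; exists x => //.
    by rewrite FP; apply: mem_set.
rewrite FP => /set_mem[sx Bx].
rewrite gt_eqF// (lt_le_trans (@lte01 R))// (le_trans (msupport_atom sx))//.
apply: le_measure; [apply: mem_set; exact: measurable_singleton| |].
  by apply: mem_set; apply: measurableI => //; exact: measurable_cell.
by move=> _ ->.
Qed.

Let occupiedE n : occupied_cells n mu B = #|map (code n) F|%:R.
Proof.
rewrite /occupied_cells -sum1_card natr_sum big_mkcond.
rewrite [RHS]big_mkcond; apply: eq_bigr => c _; rewrite measure_cell_neq0.
by case: ifP.
Qed.

Lemma mstar_size : mstar mu B = (size F)%:R%:E.
Proof. by rewrite /mstar /counting asboolT//; exact: msupport_finite. Qed.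

(** The finitely many support points in [B] get distinct codes from some level on, and a cell is
    charged exactly when it contains one of them. The approximation becomes exact, not just
    convergent. *)
Lemma occupied_cells_mstar :
  \forall n \near \oo, (occupied_cells n mu B)%:E = mstar mu B.
Proof.
have := near_code_inj (fset_uniq (fset_set (msupport mu `&` B : set X))).
apply: filterS => n /card_uniqP h; rewrite occupiedE mstar_size h size_map//.
Qed.

Lemma mstar_fin_num : mstar mu B \is a fin_num.
Proof. by rewrite mstar_size. Qed.

Lemma mstar_le : mstar mu B <= mu B.
Proof.
have tF : trivIset [set` fset_set (msupport mu `&` B : set X)]
    (fun x : X => [set x] : set (borel X)).
  by apply/trivIsetP => x y _ _ /eqP xy; apply/seteqP; split=> // z [/= -> /xy].
have := measure_fbigsetU mu (fun x _ => measurable_singleton x) tF.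
set S := \big[setU/set0]_(i <- _) _ => muS.
apply: (@le_trans _ _ (mu S)); last first.
  apply: le_measure; [|apply: mem_set; exact: bounded_borelW|].
    by apply: mem_set; apply: bigsetU_measurable => i _; exact: measurable_singleton.
  by rewrite /S -bigcup_fset => x [y /=]; rewrite FP => /set_mem[_ By] ->.
rewrite muS mstar_size.
apply: (@le_trans _ _ (\sum_(i <- F) (1 : \bar R))).
  by rewrite sumEFin lee_fin -(natr_sum _ _ xpredT (fun=> 1%N)) sum1_size.
rewrite big_seq [leRHS]big_seq; apply: lee_sum => x xF; apply: msupport_atom.
by move: xF; rewrite FP => /set_mem[].
Qed.

End occupied.

Lemma mstar_ge0 mu B : 0 <= mstar mu B.
Proof. exact: (measure_ge0 (counting : {measure set (borel X) -> \bar R})). Qed.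

Lemma mstarD mu B C : measurable B -> measurable C ->
  mstar mu B = mstar mu (B `\` C) + mstar mu (B `&` C).
Proof.
move=> mB mC; rewrite /mstar setIDA setIA.
have ms := measurable_msupport mu.
rewrite (measureDI (counting : {measure set (borel X) -> \bar R}) _ mC)//.
exact: measurableI.
Qed.

Lemma mstar_mono mu B C : measurable B -> measurable C -> B `<=` C ->
  mstar mu B <= mstar mu C.
Proof.
move=> mB mC BC; rewrite (mstarD mu mC mB) (setIidr BC).
by rewrite leeDr// mstar_ge0.
Qed.

(** Only counts of subsets of [B] enter, through an arbitrary measurable space [T]. So the lemma
    also applies to a sub-sigma-algebra that sees nothing but what lies inside [B]. *)
Lemma measurable_mstar {d} {T : measurableType d} (f : T -> pmeasure X) B :
  bounded_borel B ->
  (forall C, measurable C -> C `<=` B -> measurable_fun setT (fun t => f t C)) ->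
  measurable_fun setT (fun t => mstar (f t) B).
Proof.
move=> bB mf.
apply: (emeasurable_fun_cvg (fun n t => (occupied_cells n (f t) B)%:E)).
  move=> n; apply/measurable_EFinP; apply: measurable_sum => c.
  rewrite (_ : (fun _ => _) = (fun t => \1_(~` [set 0]) (f t (B `&` cell c)))).
    apply: measurableT_comp => //; last first.
      apply: mf => //; apply: measurableI; first exact: bounded_borelW.
      exact: measurable_cell.
    apply: measurable_indic; apply: measurableC; exact: emeasurable_set1.
  apply/funext => t; rewrite indicE; case: eqVneq => [->|/eqP h].
    by rewrite memNset//= => /(_ erefl).
  by rewrite mem_set.
move=> t _; apply: cvg_near_cst; exact: occupied_cells_mstar.
Qed.

End support.

(** * Laplace functionals *)

(** Additivity of [Y] in its index makes the exponentials stable under products, and [Y] is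
    recovered from them by the logarithm. The last hypothesis says that the [Y m] generate the
    sigma-algebra, phrased through measurability of the identity. *)
Lemma determining_class_expRN {d} {T : measurableType d} {R : realType} (M : Type)
    (Y : M -> T -> R) (m0 : M) (mul : M -> M -> M) :
  (forall m x, 0 <= Y m x)%R -> (forall m, measurable_fun setT (Y m)) ->
  (forall x, Y m0 x = 0%R) -> (forall m m' x, Y (mul m m') x = Y m x + Y m' x)%R ->
  (forall G : set (set T), (forall m, measurable_fun (setT : set (g_sigma_algebraType G)) (Y m)) ->
    measurable_fun (setT : set (g_sigma_algebraType G)) (id : g_sigma_algebraType G -> T)) ->
  determining_class (range (fun m x => expR (- Y m x))).
Proof.
move=> Y0 mY Ym0 YD gen; split; first split.
- by exists m0 => //; apply/funext => x; rewrite Ym0 oppr0 expR0.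
- move=> _ _ [m _ <-] [m' _ <-]; exists (mul m m') => //; apply/funext => x /=.
  by rewrite YD opprD expRD.
- by move=> _ [m _ <-] x; rewrite expR_ge0/= -expR0 ler_expR oppr_le0.
- by move=> _ [m _ <-]; apply: measurableT_comp => //; exact: measurableT_comp.
set G := (X in <<s X >>).
have mG : measurable_fun (setT : set (g_sigma_algebraType G)) (id : g_sigma_algebraType G -> T).
  apply: gen => m.
  have me : measurable_fun (setT : set (g_sigma_algebraType G)) (fun x => expR (- Y m x)).
    apply: (measurability _ (RGenOInfty.measurableE R)) => _ [_ [c ->] <-].
    rewrite setTI; apply: sub_sigma_algebra.
    exists (fun x => expR (- Y m x)); first by exists m.
    by exists c => //; apply/seteqP; split=> x /=; rewrite in_itv/= andbT.
  rewrite (_ : Y m = (fun x => - ln (expR (- Y m x)))%R); last first.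
    by apply/funext => x; rewrite expRK opprK.
  by apply: measurableT_comp => //; apply: measurableT_comp me => //; exact: measurable_ln.
by move=> B mB; have := mG measurableT B mB; rewrite setTI.
Qed.

Section laplace_classes.
Context {R : realType} {X : polishType R}.
Variable Bn : nat -> set (borel X).
Hypothesis Bn_bounded : forall n, bounded_borel (Bn n).
Hypothesis Bn_increasing : forall n, Bn n `<=` Bn n.+1.
Hypothesis Bn_exhaust : forall A, bounded_borel A -> exists n, A `<=` Bn n.
Variable A : nat -> set X.
Hypothesis A_open : forall n, open (A n).
Hypothesis A_base : forall U x, open U -> U x -> exists2 n, A n x & A n `<=` U.

Definition base_set (i : seq nat * nat) : set (borel X) := base_inter A i.1 `&` Bn i.2.

Lemma bounded_base_set i : bounded_borel (base_set i).
Proof. by apply: bounded_borelI => //; exact: measurable_base_inter. Qed.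

(** Repetitions in [l] play the role of integer coefficients. Together with concatenation they give
    a countable family of Laplace functionals closed under products. *)
Definition base_sum (l : seq (seq nat * nat)) (kappa : lfmeasure X) : R :=
  (\sum_(i <- l) fine (kappa (base_set i)))%R.

Lemma base_sum_ge0 l kappa : (0 <= base_sum l kappa)%R.
Proof. by apply: sumr_ge0 => i _; exact: fine_ge0. Qed.

Lemma base_sum_cat l l' kappa :
  base_sum (l ++ l') kappa = (base_sum l kappa + base_sum l' kappa)%R.
Proof. by rewrite /base_sum big_cat. Qed.

Lemma measurable_base_sum l : measurable_fun setT (base_sum l).
Proof.
apply: measurable_sum => i; apply: measurableT_comp => //.
by apply: measurable_lfm_eval_bounded; exact: bounded_base_set.
Qed.

Lemma measurable_fun_base_sum {d} {T : measurableType d} (f : T -> lfmeasure X) :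
  (forall l, measurable_fun setT (base_sum l \o f)) -> measurable_fun setT f.
Proof.
move=> mf; apply: (measurable_fun_base_inter Bn_bounded Bn_exhaust A_open A_base).
move=> s n; have := mf [:: (s, n)] => /measurable_EFinP.
rewrite (_ : EFin \o _ = (fun t => f t (base_inter A s `&` Bn n)))//.
apply/funext => t; rewrite /base_sum /= big_seq1 fineK//.
by apply: lfm_fin_num; exact: (bounded_base_set (s, n)).
Qed.

Lemma determining_lfm :
  determining_class (range (fun l (kappa : lfmeasure X) => expR (- base_sum l kappa))).
Proof.
apply: (determining_class_expRN (m0 := [::]) (mul := cat)).
- exact: base_sum_ge0.
- exact: measurable_base_sum.
- by move=> kappa; rewrite /base_sum big_nil.
- exact: base_sum_cat.
- by move=> G mG; exact: (@measurable_fun_base_sum _ (g_sigma_algebraType G) id).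
Qed.

Lemma determining_pm :
  determining_class (range (fun l (mu : pmeasure X) => expR (- base_sum l mu))).
Proof.
apply: (determining_class_expRN (m0 := [::]) (mul := cat)).
- by move=> l mu; exact: base_sum_ge0.
- by move=> l; apply: (measurableT_comp (measurable_base_sum l)); exact: measurable_pm_val.
- by move=> mu; rewrite /base_sum big_nil.
- by move=> l l' mu; exact: base_sum_cat.
- move=> G mG; apply: measurable_fun_pm => B bB.
  apply: (measurableT_comp (measurable_lfm_eval_bounded bB)).
  exact: (@measurable_fun_base_sum _ (g_sigma_algebraType G) (@pm_val R X)).
Qed.

Lemma determining_pm_lfm :
  determining_class (range (fun (l : seq (seq nat * nat) * seq (seq nat * nat))
    (x : pmeasure X * lfmeasure X) => expR (- (base_sum l.1 x.1 + base_sum l.2 x.2)%R))).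
Proof.
apply: (determining_class_expRN (m0 := ([::], [::]))
  (mul := fun l l' => (l.1 ++ l'.1, l.2 ++ l'.2))
  (Y := fun (l : seq (seq nat * nat) * seq (seq nat * nat))
    (x : pmeasure X * lfmeasure X) => base_sum l.1 x.1 + base_sum l.2 x.2)%R).
- by move=> l x; rewrite addr_ge0 ?base_sum_ge0.
- move=> l; apply: measurable_funD.
    apply: (measurableT_comp (measurable_base_sum l.1)).
    by apply: (measurableT_comp measurable_pm_val); exact: measurable_fst.
  by apply: (measurableT_comp (measurable_base_sum l.2)); exact: measurable_snd.
- by move=> x; rewrite /base_sum !big_nil addr0.
- by move=> l l' x; rewrite !base_sum_cat addrACA.
- move=> G mG.
  rewrite (_ : id = (fun x : g_sigma_algebraType G => (x.1, x.2))); last by apply/funext => -[].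
  apply: measurable_fun_pair.
    apply: measurable_fun_pm => B bB.
    apply: (measurableT_comp (measurable_lfm_eval_bounded bB)).
    apply: (@measurable_fun_base_sum _ (g_sigma_algebraType G) (fun x => pm_val x.1)) => l.
    have := mG (l, [::]).
    by rewrite /base_sum/=; under eq_fun do rewrite big_nil addr0.
  apply: (@measurable_fun_base_sum _ (g_sigma_algebraType G) (fun x => x.2)) => l.
  have := mG ([::], l).
  by rewrite /base_sum/=; under eq_fun do rewrite big_nil add0r.
Qed.

(** The real coordinate enters as [expR x.1] because the functionals must be nonnegative; the
    logarithm gives it back. *)
Lemma determining_R_lfm :
  determining_class (range (fun (l : nat * seq (seq nat * nat)) (x : R * lfmeasure X) =>
    expR (- (l.1%:R * expR x.1 + base_sum l.2 x.2)%R))).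
Proof.
apply: (determining_class_expRN (m0 := (0%N, [::]))
  (mul := fun l l' => (l.1 + l'.1, l.2 ++ l'.2)%N)
  (Y := fun (l : nat * seq (seq nat * nat)) (x : R * lfmeasure X) => l.1%:R * expR x.1 + base_sum l.2 x.2)%R).
- by move=> l x; rewrite addr_ge0 ?base_sum_ge0// mulr_ge0// expR_ge0.
- move=> l; apply: measurable_funD.
    by apply: measurable_funM => //; apply: measurableT_comp => //; exact: measurable_fst.
  by apply: (measurableT_comp (measurable_base_sum l.2)); exact: measurable_snd.
- by move=> x; rewrite /base_sum !big_nil mul0r addr0.
- by move=> l l' x; rewrite !base_sum_cat natrD mulrDl addrACA.
- move=> G mG.
  rewrite (_ : id = (fun x : g_sigma_algebraType G => (x.1, x.2))); last by apply/funext => -[].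
  apply: measurable_fun_pair.
    have := mG (1%N, [::]).
    rewrite /base_sum/=; under eq_fun do rewrite big_nil mul1r addr0.
    move=> me.
    apply: (eq_measurable_fun (fun x : g_sigma_algebraType G => ln (expR x.1))).
      by move=> x _; rewrite expRK.
    by apply: measurableT_comp me; exact: measurable_ln.
  apply: (@measurable_fun_base_sum _ (g_sigma_algebraType G) (fun x => x.2)) => l.
  have := mG (0%N, l).
  by rewrite /base_sum/=; under eq_fun do rewrite mul0r add0r.
Qed.

End laplace_classes.

Lemma range_countable_enum {T : Type} {M : countType} (m0 : M) (E : M -> T) :
  range (fun n => E (odflt m0 (choice.unpickle n))) = range E.
Proof.
apply/seteqP; split=> _ [m _ <-]; first by exists (odflt m0 (choice.unpickle m)).
by exists (choice.pickle m) => //; rewrite choice.pickleK.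
Qed.

Lemma measurable_fun_from_nat {d} {T : measurableType d} (f : nat -> T) :
  measurable_fun setT f.
Proof. by []. Qed.

Lemma measurable_fun_to_nat {d} {T : measurableType d} (f : T -> nat) :
  (forall k, measurable [set x | f x = k]) -> measurable_fun setT f.
Proof.
move=> mf _ Y _; rewrite setTI.
rewrite (_ : f @^-1` Y = \bigcup_(k in Y) [set x | f x = k]).
  by apply: bigcup_measurable => k _; exact: mf.
by apply/seteqP; split=> [x Yx|x [k Yk fx]]; [exists (f x)|rewrite /= fx].
Qed.

Lemma ge0_nneseriesZr {R : realType} (f : nat -> \bar R) (c : \bar R) :
  (forall k, 0 <= f k) -> 0 <= c ->
  \sum_(0 <= k <oo) f k * c = (\sum_(0 <= k <oo) f k) * c.
Proof.
move=> f0 c0; rewrite -!ge0_integral_count//; last by move=> k; rewrite mule_ge0.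
by rewrite ge0_integralZr.
Qed.

(** * Independent counts and the Poisson process *)

Section independent_counts.
Context {R : realType} {d} {T : measurableType d} (P : probability T R).

Let eseries_pred1 (k : nat) (p : nat -> \bar R) : (forall k, 0 <= p k) ->
  \sum_(0 <= l <oo) (l == k)%:R%:E * p l = p k.
Proof.
move=> p0; rewrite (@nneseriesD1 _ _ k)//; last by move=> l _; rewrite mule_ge0.
rewrite eqxx mul1e eseries0 ?adde0// => l _ /negbTE ->.
by rewrite mul0e.
Qed.

(** Induction on the number [j] of coordinates carrying an arbitrary factor, the others carrying the
    indicator of a single value. For j = 0 the claim is the hypothesis on joint probabilities. *)
Lemma integral_prod_counts n (N : 'I_n -> T -> nat) (p phi : 'I_n -> nat -> \bar R) :
  (forall i, measurable_fun setT (N i)) -> (forall i k, 0 <= p i k) ->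
  (forall k : 'I_n -> nat, P [set x | forall i, N i x = k i] = \prod_(i < n) p i (k i)) ->
  (forall i k, 0 <= phi i k) ->
  \int[P]_x \prod_(i < n) phi i (N i x) =
  \prod_(i < n) \sum_(0 <= k <oo) phi i k * p i k.
Proof.
move=> mN p0 Pp.
suff : forall j, (j <= n)%N -> forall phi : 'I_n -> nat -> \bar R, (forall i k, 0 <= phi i k) ->
    (forall i : 'I_n, (j <= i)%N -> exists k0, phi i = fun k => (k == k0)%:R%:E) ->
    \int[P]_x \prod_(i < n) phi i (N i x) =
    \prod_(i < n) \sum_(0 <= k <oo) phi i k * p i k.
  by move=> /(_ n (leqnn n)) h ?; apply: h => // i; rewrite leqNgt ltn_ord.
elim=> [|j IHj] jn {}phi phi0 phij.
  have /choice[k0 k0E] : forall i, exists k0, phi i = fun k => (k == k0)%:R%:E.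
    by move=> i; exact: phij.
  have mA : measurable [set x | forall i, N i x = k0 i].
    rewrite (_ : [set x | _] = \bigcap_(i in [set: 'I_n]) (N i @^-1` [set k0 i])).
      apply: fin_bigcap_measurable; first exact: finite_finset.
      by move=> i _; rewrite -[X in measurable X]setTI; exact: mN.
    by apply/seteqP; split=> x /= h i => [_|]; exact: h.
  transitivity (\int[P]_x (\1_[set x | forall i, N i x = k0 i] x)%:E).
    apply: eq_integral => x _; rewrite indicE.
    have [h|/existsNP[i hi]] := pselect (forall i, N i x = k0 i).
      by rewrite mem_set// big1// => i _; rewrite k0E h eqxx.
    rewrite memNset; last by move=> /(_ i).
    by rewrite (bigD1 i)//= k0E (negbTE (introN eqP hi)) mul0e.
  rewrite integral_indic// setIT; transitivity (\prod_(i < n) p i (k0 i)); first exact: Pp.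
  apply: eq_bigr => i _.
  by rewrite k0E eseries_pred1.
pose i0 := Ordinal jn.
(* The factor at [i0] is expanded over its values [k]. Each term has one arbitrary factor fewer, and
   nonnegativity allows the series to leave the integral. *)
pose phik k (i : 'I_n) := if i == i0 then (fun l => (l == k)%:R%:E) else phi i.
have phik0 k i l : 0 <= phik k i l by rewrite /phik; case: ifP.
have phikE k (f : 'I_n -> (nat -> \bar R) -> \bar R) : \prod_(i < n) f i (phik k i) =
    f i0 (fun l => (l == k)%:R%:E) * \prod_(i < n | i != i0) f i (phi i).
  rewrite (bigD1 i0)//= {1}/phik eqxx; congr (_ * _).
  by apply: eq_bigr => i /negbTE ii0; rewrite /phik ii0.
have mphi (f : 'I_n -> nat -> \bar R) (Q : pred 'I_n) :
    measurable_fun setT (fun x => \prod_(i < n | Q i) f i (N i x)).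
  elim: (index_enum _) => [|i s IHs].
    by under eq_fun do rewrite big_nil; exact: measurable_cst.
  under eq_fun do rewrite big_cons; case: (Q i) => //.
  by apply: emeasurable_funM => //; exact: measurableT_comp (mN i).
have prod_ge0 (Q : pred 'I_n) x : 0 <= \prod_(i < n | Q i) phi i (N i x).
  by apply: prode_ge0.
transitivity (\int[P]_x \sum_(0 <= k <oo) phi i0 k * \prod_(i < n) phik k i (N i x)).
  apply: eq_integral => x _; rewrite (bigD1 i0)//=.
  under eq_eseriesr => k _ do rewrite (phikE k (fun i g => g (N i x))) muleA.
  rewrite ge0_nneseriesZr//; last by move=> k; rewrite mule_ge0.
  congr (_ * _).
  under eq_eseriesr => k _ do rewrite muleC eq_sym.
  by rewrite eseries_pred1.
rewrite integral_nneseries//; last 2 first.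
- by move=> k; apply: emeasurable_funM => //; exact: mphi.
- by move=> k x _; rewrite mule_ge0// prode_ge0.
transitivity (\sum_(0 <= k <oo) phi i0 k * (p i0 k *
    \prod_(i < n | i != i0) \sum_(0 <= l <oo) phi i l * p i l)).
  apply: eq_eseriesr => k _; rewrite ge0_integralZl//; last first.
    by move=> x _; exact: prode_ge0.
  congr (_ * _); rewrite IHj//; last 2 first.
  - exact: ltnW.
  - move=> i ji; rewrite /phik; case: eqVneq => [_|ii0]; first by exists k.
    by apply: phij; rewrite ltn_neqAle ji andbT; apply: contra_neq ii0 => ij; exact: val_inj.
  rewrite (phikE k (fun i g => \sum_(0 <= l <oo) g l * p i l)).
  by rewrite eseries_pred1.
under eq_eseriesr do rewrite muleA.
rewrite ge0_nneseriesZr; last 2 first.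
- by move=> k; rewrite mule_ge0.
- by apply: prode_ge0 => i _; apply: nneseries_ge0 => k _ _; rewrite mule_ge0.
by rewrite [RHS](bigD1 i0).
Qed.

End independent_counts.

Lemma poisson_generating_function {R : realType} (r s : R) : (0 <= r)%R -> (0 <= s)%R ->
  \sum_(0 <= k <oo) (s ^+ k)%:E * poisson_prob r 0%N [set k] =
  (expR (- (r * (1 - s))))%:E.
Proof.
move=> r0 s0; have [r_gt0|] := ltP 0%R r; last first.
  move=> r_le0; have -> : r = 0%R by apply/eqP; rewrite eq_le r_le0.
  rewrite mul0r oppr0 expR0 (@nneseriesD1 _ _ 0%N)//; last first.
    by move=> k _; rewrite mule_ge0// lee_fin exprn_ge0.
  rewrite /poisson_prob ltxx expr0 mul1e diracE mem_set//= eseries0 ?adde0// => k _ k0.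
  by rewrite diracE memNset ?mule0// => /= k00; move: k0; rewrite -k00.
have -> : (expR (- (r * (1 - s))))%:E = (expR (- r))%:E * (expR (s * r))%:E.
  by rewrite -EFinM -expRD; congr (expR _)%:E; ring.
have ge0 k : 0 <= (exp_coeff (s * r) k)%:E by rewrite lee_fin exp_coeff_ge0// mulr_ge0.
transitivity (\sum_(0 <= k <oo) (expR (- r))%:E * (exp_coeff (s * r) k)%:E).
  apply: eq_eseriesr => k _.
  rewrite /poisson_prob r_gt0 esum_set1; last by rewrite lee_fin poisson_pmf_ge0.
  by rewrite /poisson_pmf r_gt0 -!EFinM; congr EFin; rewrite /exp_coeff /= exprMn; ring.
rewrite nneseriesZl//; congr (_ * _).
rewrite /expR -EFin_lim; last exact: is_cvg_series_exp_coeff.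
by apply/congr_lim/funext => n; rewrite /= -sumEFin.
Qed.

Section counts.
Context {R : realType} {X : polishType R}.
Implicit Types (B : set (borel X)) (mu : pmeasure X).

Definition cnt B mu : nat := Num.trunc (fine (mu B)).

Lemma cntE B mu : bounded_borel B -> mu B = (cnt B mu)%:R%:E.
Proof. by move=> bB; rewrite /cnt; have [n ->] := pm_int mu bB; rewrite /= truncnK. Qed.

Lemma cnt_eqP B mu k : bounded_borel B -> (cnt B mu = k) <-> (mu B = k%:R%:E).
Proof.
move=> bB; rewrite (cntE _ bB); split=> [->//|[] /eqP].
by rewrite eqr_nat => /eqP.
Qed.

Lemma measurable_cnt B : bounded_borel B -> measurable_fun setT (cnt B).
Proof.
move=> bB; apply: measurable_fun_to_nat => k.
rewrite (_ : [set _ | _] = (fun mu : pmeasure X => mu B) @^-1` [set k%:R%:E]).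
  by rewrite -[X in measurable X]setTI; exact: measurable_pm_eval_bounded.
by apply/seteqP; split=> mu /=; rewrite cnt_eqP.
Qed.

Lemma measurable_cnt_comp B (f : nat -> R) : bounded_borel B ->
  measurable_fun setT (f \o cnt B).
Proof.
move=> bB; apply: (measurableT_comp (measurable_fun_from_nat f)).
exact: measurable_cnt.
Qed.

Lemma pm_add1E mu (x : X) B : pm_add1 mu x B = mu B + \d_(x : borel X) B.
Proof. exact: measure_addE. Qed.

Lemma cnt_add1_in B mu (x : X) : bounded_borel B -> B x ->
  cnt B (pm_add1 mu x) = (cnt B mu).+1.
Proof.
move=> bB Bx; apply/cnt_eqP => //.
by rewrite pm_add1E diracE mem_set// (cntE mu bB) -EFinD natr1.
Qed.

Lemma cnt_add1_notin B mu (x : X) : bounded_borel B -> ~ B x ->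
  cnt B (pm_add1 mu x) = cnt B mu.
Proof.
move=> bB nBx; apply/cnt_eqP => //.
by rewrite pm_add1E diracE memNset// adde0 (cntE mu bB).
Qed.

Lemma poisson_laplace (kappa : lfmeasure X) (P : probability (pmeasure X) R)
    n (B : 'I_n -> set (borel X)) (a : 'I_n -> R) :
  is_poisson_process kappa P -> (forall i, bounded_borel (B i)) -> trivIset setT B ->
  (forall i, 0 <= a i)%R ->
  \int[P]_mu (expR (- \sum_(i < n) a i * (cnt (B i) mu)%:R)%R)%:E =
  (expR (- \sum_(i < n) fine (kappa (B i)) * (1 - expR (- a i)))%R)%:E.
Proof.
move=> Pk bB tB a0.
pose p i k := poisson_prob (fine (kappa (B i))) 0%N [set k].
pose phi (i : 'I_n) k := (expR (- a i) ^+ k)%:E.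
transitivity (\int[P]_mu \prod_(i < n) phi i (cnt (B i) mu)).
  apply: eq_integral => mu _; rewrite prodEFin; congr EFin.
  rewrite -sumrN expR_sum; apply: eq_bigr => i _.
  by rewrite -expRM_natr mulNr.
rewrite (integral_prod_counts (p := p))//.
- rewrite -sumrN expR_sum -prodEFin; apply: eq_bigr => i _.
  by rewrite /p /phi poisson_generating_function ?expR_ge0// fine_ge0.
- by move=> i; exact: measurable_cnt.
- move=> k; rewrite -Pk//; congr (P _); apply/seteqP; split=> mu h i /=;
    by have := h i => /= hi; apply/cnt_eqP.
- by move=> i k; rewrite lee_fin exprn_ge0// expR_ge0.
Qed.

End counts.

Section polya.
Context {R : realType} {X : polishType R}.
Variables (z : R) (rho : lfmeasure X) (P : probability (pmeasure X) R).
Hypothesis z01 : (0 < z < 1)%R.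
Hypothesis polyaP : polya_sum_equation z rho P.
Variables (B : set (borel X)).
Hypothesis bB : bounded_borel B.
Let m := fine (rho B).

(** The shift in [psi] comes from the point added inside [B], which [G] does not notice. Boundedness
    of [psi] reflects that the defining equation is given for bounded test functions, so moments
    will be reached by truncation. *)
Lemma polya_count (psi : nat -> R) (G : pmeasure X -> R) (M : R) :
  (forall k, 0 <= psi k <= M)%R -> measurable_fun setT G -> (forall mu, 0 <= G mu <= 1)%R ->
  (forall mu x, B x -> G (pm_add1 mu x) = G mu) ->
  \int[P]_mu ((cnt B mu)%:R * psi (cnt B mu) * G mu)%:E =
  z%:E * \int[P]_mu ((m + (cnt B mu)%:R) * psi (cnt B mu).+1 * G mu)%:E.
Proof.
move=> psi0M mG G01 GB; have mB := bounded_borelW bB.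
pose w mu := (psi (cnt B mu) * G mu)%R.
have w0 mu : (0 <= w mu)%R.
  by have /andP[? _] := psi0M (cnt B mu); have /andP[? _] := G01 mu; rewrite mulr_ge0.
have mw : measurable_fun setT w by apply: measurable_funM => //; exact: measurable_cnt_comp.
pose h (y : borel X * pmeasure X) := (\1_B y.1 * w y.2)%R.
have mh : measurable_fun setT h.
  apply: measurable_funM; first by apply: measurableT_comp => //; exact: measurable_indic.
  exact: measurableT_comp.
have h0 y : (0 <= h y)%R by rewrite mulr_ge0.
have hM : exists M : R, forall y, (h y <= M)%R.
  exists M => y; have /andP[? ?] := psi0M (cnt B y.2); have /andP[? ?] := G01 y.2.
  have M0 : (0 <= M)%R by have /andP[p0 p1] := psi0M 0%N; exact: le_trans p1.
  rewrite /h indicE; case: (_ \in _); rewrite ?mul0r// mul1r /w.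
  by rewrite -[leRHS]mulr1 ler_pM.
have := polyaP mh h0 hM.
have int_h (kappa : {measure set (borel X) -> \bar R}) (c : R) : (0 <= c)%R ->
    \int[kappa]_x (\1_B x * c)%:E = c%:E * kappa B.
  move=> c0; under eq_integral do rewrite mulrC EFinM.
  by rewrite ge0_integralZl// ?integral_indic ?setIT//; exact/measurable_EFinP/measurable_indic.
rewrite [X in X = _ -> _](_ : _ = \int[P]_mu ((cnt B mu)%:R * psi (cnt B mu) * G mu)%:E); last first.
  apply: eq_integral => mu _; rewrite /h /= int_h// (cntE mu bB) -EFinM; congr EFin.
  by rewrite /w; ring.
move=> ->; congr (_ * _); apply: eq_integral => mu _.
have psi1 : (0 <= psi (cnt B mu).+1 * G mu)%R.
  by have /andP[? _] := psi0M (cnt B mu).+1; have /andP[? _] := G01 mu; rewrite mulr_ge0.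
rewrite (eq_integral (fun x => (\1_B x * (psi (cnt B mu).+1 * G mu))%:E)); last first.
  move=> x _; rewrite /h /= indicE; case: (boolP (x \in B)) => [/set_mem Bx|]; last by rewrite !mul0r.
  by rewrite !mul1r /w cnt_add1_in// GB.
rewrite int_h// [lfm_add rho mu B](measure_addE rho mu) (cntE mu bB).
rewrite -(fineK (lfm_fin_num rho bB)) -EFinD -EFinM -/m; congr EFin.
ring.
Qed.

End polya.

(** * The Pólya sum process *)

(** Carries uniform bounds through the two approximations used below: truncated counts, and occupied
    cells in place of distinct points. *)
Lemma fatou_le {d} {T : measurableType d} {R : realType} (mu : {measure set T -> \bar R})
    (g : nat -> T -> \bar R) (f : T -> \bar R) (c : \bar R) :
  (forall n, measurable_fun setT (g n)) -> (forall n x, 0 <= g n x) ->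
  (forall x, g n x @[n --> \oo] --> f x) -> (forall n, \int[mu]_x g n x <= c) ->
  \int[mu]_x f x <= c.
Proof.
move=> mg g0 gf gc.
have -> : \int[mu]_x f x = \int[mu]_x limn_einf (g ^~ x).
  by apply: eq_integral => x _; rewrite (cvg_limn_einf_sup (gf x)).1.
apply: (le_trans (fatou mu measurableT mg _)) => //.
rewrite limn_einf_lim; apply: lime_le; first exact: is_cvg_einfs.
apply: nearW => n; apply: le_trans (gc n).
by rewrite /einfs; apply: ereal_inf_lbound; exists n => /=.
Qed.

Section polya_law.
Context {R : realType} {X : polishType R}.
Variables (z : R) (rho : lfmeasure X) (P : probability (pmeasure X) R).
Hypothesis z01 : (0 < z < 1)%R.
Hypothesis polyaP : polya_sum_equation z rho P.

Lemma probability_lty {d} {T : measurableType d} (Q : probability T R) : Q setT < +oo.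
Proof. by rewrite (le_lt_trans (probability_le1 _ _))// ltry. Qed.

Lemma integral_probability_cst {d} {T : measurableType d} (Q : probability T R) (c : R) :
  \int[Q]_x c%:E = c%:E.
Proof. by rewrite integral_cst// (_ : _ setT = 1) ?mule1//; exact: probability_setT. Qed.

Lemma integral_unit_fin {d} {T : measurableType d} (Q : probability T R) (f : T -> R) :
  measurable_fun setT f -> (forall x, 0 <= f x <= 1)%R ->
  \int[Q]_x (f x)%:E = (fine (\int[Q]_x (f x)%:E))%:E.
Proof.
move=> mf f01; rewrite fineK//; apply: integrable_fin_num => //.
exact: (unit_integrable (probability_lty Q)).
Qed.

(** The weighted probabilities E[1(mu(B) = k) G] obey the negative binomial recurrence whatever [G]
    is. The resulting factorization is the independence of the count in [B] from everything
    unaffected by it. *)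
Lemma polya_generating_function (B : set (borel X)) (G : pmeasure X -> R) (s : R) :
  bounded_borel B -> measurable_fun setT G -> (forall mu, 0 <= G mu <= 1)%R ->
  (forall mu x, B x -> G (pm_add1 mu x) = G mu) -> (0 <= s <= 1)%R ->
  \int[P]_mu (s ^+ cnt B mu * G mu)%:E =
  (expR (- (fine (rho B) * (ln (1 - z * s) - ln (1 - z)))))%:E * \int[P]_mu (G mu)%:E.
Proof.
move=> bB mG G01 GB s01; set m := fine (rho B).
have m0 : (0 <= m)%R by exact: fine_ge0.
have mI k : measurable_fun setT (fun mu => (cnt B mu == k)%:R * G mu)%R.
  apply: measurable_funM => //.
  exact: (measurable_cnt_comp (fun l => (l == k)%:R)%R bB).
have I01 k mu : (0 <= (cnt B mu == k)%:R * G mu <= 1)%R.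
  by case: (_ == _); rewrite ?mul1r// mul0r lexx ler01.
pose p k := fine (\int[P]_mu ((cnt B mu == k)%:R * G mu)%:E).
have pE k : \int[P]_mu ((cnt B mu == k)%:R * G mu)%:E = (p k)%:E.
  exact: integral_unit_fin.
have p0 k : (0 <= p k)%R.
  by apply: fine_ge0; apply: integral_ge0 => mu _; rewrite lee_fin; case/andP: (I01 k mu).
have zint (c : R) k : (0 <= c)%R ->
    \int[P]_mu (c * ((cnt B mu == k)%:R * G mu))%:E = (c * p k)%:E.
  move=> c0; under eq_integral do rewrite EFinM.
  rewrite ge0_integralZl//; last 2 first.
  - exact/measurable_EFinP.
  - by move=> mu _; rewrite lee_fin; case/andP: (I01 k mu).
  by rewrite pE.
have rec k : (k.+1%:R * p k.+1 = z * (m + k%:R) * p k)%R.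
  apply: EFin_inj; rewrite -zint// -mulrA EFinM -zint ?addr_ge0//.
  pose psi l : R := (l == k.+1)%:R%R.
  have psi01 l : (0 <= psi l <= 1)%R by rewrite /psi; case: (_ == _); rewrite ?lexx ler01.
  have := polya_count polyaP bB psi01 mG G01 GB; rewrite /psi.
  rewrite [X in X = _ -> _](_ : _ =
      \int[P]_mu (k.+1%:R * ((cnt B mu == k.+1)%:R * G mu))%:E); last first.
    apply: eq_integral => mu _; congr EFin.
    by case: eqVneq => [->|_]; rewrite ?mul0r ?mulr0 ?mul0r// !mul1r mulr1.
  move=> ->; congr (_ * _); apply: eq_integral => mu _; congr EFin.
  rewrite eqSS; case: eqVneq => [->|_]; first by rewrite mulr1 mul1r.
  by rewrite mulr0 !mul0r mulr0.
have gen t : (0 <= t <= 1)%R ->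
    \int[P]_mu (t ^+ cnt B mu * G mu)%:E = (p 0%N * expR (- (m * ln (1 - z * t))))%:E.
  move=> t01; have /andP[t0 _] := t01.
  transitivity (\int[P]_mu \sum_(0 <= k <oo) (t ^+ k * ((cnt B mu == k)%:R * G mu))%:E).
    apply: eq_integral => mu _.
    rewrite (@nneseriesD1 _ _ (cnt B mu))//; last first.
      move=> k _; rewrite lee_fin mulr_ge0 ?exprn_ge0//.
      by case/andP: (I01 k mu).
    rewrite eqxx mul1r eseries0 ?adde0// => k _ kN.
    by rewrite eq_sym (negbTE kN) mul0r mulr0.
  rewrite integral_nneseries//; last 2 first.
  - move=> k; apply/measurable_EFinP; exact: measurable_funM.
  - move=> k mu _; rewrite lee_fin mulr_ge0 ?exprn_ge0//.
    by case/andP: (I01 k mu).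
  under eq_eseriesr => k _ do rewrite zint ?exprn_ge0// mulrC.
  apply/cvg_lim => //.
  rewrite (_ : (fun n => _) = EFin \o series (fun k => p k * t ^+ k)%R); last first.
    by apply/funext => n; rewrite /= sumEFin.
  apply: cvg_EFin; first exact: nearW.
  exact: negative_binomial_series.
(* The recurrence leaves [p 0] free; the value at s = 1 fixes it. *)
have -> : \int[P]_mu (G mu)%:E = (p 0%N * expR (- (m * ln (1 - z))))%:E.
  rewrite -[X in (1 - X)%R](mulr1 z) -gen ?lexx ?ler01//; apply: eq_integral => mu _.
  by rewrite expr1n mul1r.
rewrite gen// -EFinM; congr EFin; rewrite mulrCA -expRD; congr (_ * expR _)%R.
by ring.
Qed.

(** The sets are peeled off one at a time, the exponential of the remaining counts acting as the
    weight [G]; disjointness makes it insensitive to points of the set removed. *)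
Lemma polya_laplace n (B : 'I_n -> set (borel X)) (a : 'I_n -> R) :
  (forall i, bounded_borel (B i)) -> trivIset setT B -> (forall i, 0 <= a i)%R ->
  \int[P]_mu (expR (- \sum_(i < n) a i * (cnt (B i) mu)%:R)%R)%:E =
  (expR (- \sum_(i < n) fine (rho (B i)) * (ln (1 - z * expR (- a i)) - ln (1 - z)))%R)%:E.
Proof.
move=> bB tB a0.
suff : forall r : seq 'I_n, uniq r ->
    \int[P]_mu (expR (- \sum_(i <- r) a i * (cnt (B i) mu)%:R)%R)%:E =
    (expR (- \sum_(i <- r) fine (rho (B i)) * (ln (1 - z * expR (- a i)) - ln (1 - z)))%R)%:E.
  by apply; rewrite index_enum_uniq.
elim=> [_|i r IHr /= /andP[ir ur]].
  under eq_integral do rewrite big_nil oppr0 expR0.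
  by rewrite big_nil oppr0 expR0 integral_probability_cst.
pose G mu := expR (- \sum_(i <- r) a i * (cnt (B i) mu)%:R)%R.
transitivity (\int[P]_mu (expR (- a i) ^+ cnt (B i) mu * G mu)%:E).
  apply: eq_integral => mu _; rewrite big_cons opprD expRD; congr (_ * _)%:E.
  by rewrite -expRM_natr mulNr.
rewrite polya_generating_function//.
- by rewrite IHr// -EFinM -expRD big_cons opprD.
- apply: measurableT_comp => //; apply: measurableT_comp => //; apply: measurable_sum => j.
  apply: measurable_funM => //.
  exact: (measurable_cnt_comp (fun k => k%:R)%R (bB j)).
- move=> mu; rewrite expR_ge0 -expR0 ler_expR oppr_le0 sumr_ge0// => j _.
  by rewrite mulr_ge0.
- move=> mu x Bix; rewrite /G; congr (expR (- _)).
  apply: eq_big_seq => j jr; rewrite cnt_add1_notin// => Bjx.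
  have ij : i = j by apply: tB => //; exists x.
  by move: ir; rewrite ij jr.
- by rewrite expR_ge0/= -expR0 ler_expR oppr_le0.
Qed.

(** * First and second moments of the counts *)

Section moments.
Variable B : set (borel X).
Hypothesis bB : bounded_borel B.
Let m := fine (rho B).
Let N mu : R := (cnt B mu)%:R.
Let u := (z / (1 - z))%R.

Let mNf (f : nat -> R) : measurable_fun setT (fun mu => (f (cnt B mu))%:E).
Proof. by apply/measurable_EFinP; exact: measurable_cnt_comp. Qed.

Let m0 : (0 <= m)%R. Proof. exact: fine_ge0. Qed.
Let z0 : (0 < z)%R. Proof. by case/andP: z01. Qed.
Let z1 : (0 < 1 - z)%R. Proof. by rewrite subr_gt0; case/andP: z01. Qed.
Let u0 : (0 <= u)%R. Proof. by rewrite divr_ge0// ltW. Qed.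

Let count1 (psi : nat -> R) (M : R) : (forall k, 0 <= psi k <= M)%R ->
  \int[P]_mu (N mu * psi (cnt B mu))%:E =
  z%:E * \int[P]_mu ((m + N mu) * psi (cnt B mu).+1)%:E.
Proof.
move=> psiM.
have := @polya_count _ _ z rho P polyaP B bB psi (cst 1%R) M psiM.
rewrite /=; under eq_integral do rewrite mulr1.
under [X in _ * X]eq_integral do rewrite mulr1.
by apply => // mu; rewrite ler01 lexx.
Qed.

(** Solving for [Q] is meaningless when it is infinite, so moments are first truncated and the
    bound, uniform in the truncation, is passed to the limit. *)
Let solve_le (Q : \bar R) (C : R) : Q \is a fin_num -> Q <= z%:E * (C%:E + Q) ->
  Q <= (u * C)%:E.
Proof.
move=> /fineK <-; rewrite -EFinD -EFinM !lee_fin => h.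
by rewrite /u mulrAC ler_pdivlMr//; lra.
Qed.

(** Truncation by 1(N <= K) closes up under the recurrence, because N + 1 <= K implies N <= K. This
    yields the upper bound and finiteness. *)
Lemma polya_mean : \int[P]_mu (N mu)%:E = (u * m)%:E.
Proof.
have Mle : \int[P]_mu (N mu)%:E <= (u * m)%:E.
  pose g K mu := (N mu * (cnt B mu <= K)%N%:R)%:E.
  have g0 K mu : 0 <= g K mu by rewrite lee_fin mulr_ge0.
  have mg K : measurable_fun setT (g K).
    exact: (mNf (fun k => k%:R * (k <= K)%N%:R)%R).
  have gle K : \int[P]_mu g K mu <= (u * m)%:E.
    apply: solve_le.
      rewrite ge0_fin_numE ?integral_ge0//.
      apply: (@le_lt_trans _ _ (\int[P]_mu K%:R%:E)).
        apply: ge0_le_integral => // mu _; rewrite lee_fin /N.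
        by case: leqP => h; rewrite ?mulr1 ?mulr0// ler_nat.
      by rewrite integral_probability_cst ltry.
    rewrite /g [leLHS](count1 (psi := fun k => (k <= K)%N%:R) (M := 1)); last first.
      by move=> k; case: (k <= K)%N; rewrite ?lexx ler01.
    apply: lee_wpmul2l; first by rewrite lee_fin ltW.
    have -> : m%:E = \int[P]_mu m%:E.
      by rewrite integral_probability_cst.
    rewrite -ge0_integralD//; last 2 first.
    - by move=> mu _; exact: g0.
    - exact: mg.
    apply: ge0_le_integral => //.
    - by move=> mu _; rewrite lee_fin mulr_ge0// addr_ge0.
    - exact: (mNf (fun k => (m + k%:R) * (k.+1 <= K)%N%:R)%R).
    - by apply: emeasurable_funD => //; exact: mg.
    - move=> mu _; rewrite -EFinD lee_fin -/(N mu).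
      case: (ltnP (cnt B mu) K) => h; last by rewrite mulr0 addr_ge0// mulr_ge0.
      by rewrite (ltnW h) !mulr1.
  apply: (fatou_le mg g0 _ gle) => mu.
  apply: cvg_near_cst; exists (cnt B mu) => // K /= NK.
  by rewrite /g NK mulr1.
have N0 : 0 <= \int[P]_mu (N mu)%:E by apply: integral_ge0 => mu _; rewrite lee_fin.
have Nfin : \int[P]_mu (N mu)%:E \is a fin_num.
  by rewrite ge0_fin_numE// (le_lt_trans Mle)// ltry.
(* With the mean known to be finite, the untruncated equation E N = z (m + E N) can be solved
   exactly. *)
have := @count1 (cst 1%R) 1%R (fun=> _); rewrite /= => h.
have {h} := h ltac:(by rewrite ler01 lexx).
under eq_integral do rewrite mulr1.
under [X in _ * X]eq_integral do rewrite mulr1 EFinD.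
rewrite ge0_integralD//; last 2 first.
- by move=> mu _; rewrite lee_fin.
- exact: (mNf (fun k => k%:R)%R).
rewrite integral_probability_cst -(fineK Nfin) -EFinD -EFinM => -[h].
congr EFin.
have : (fine (\int[P]_mu (N mu)%:E) * (1 - z) = z * m)%R by move: h; lra.
by rewrite /u => /(canRL (mulfK _)) ->; rewrite ?gt_eqF//; ring.
Qed.

(** The right-hand side is the variance of the negative binomial law. The truncation is N min(N, K),
    and min(N + 1, K) <= min(N, K) + 1 returns the truncated moment on the right of the
    recurrence. *)
Lemma polya_second_moment :
  \int[P]_mu ((N mu - u * m) ^+ 2)%:E <= ((u + u ^+ 2) * m)%:E.
Proof.
have mean := polya_mean.
have Q : \int[P]_mu (N mu ^+ 2)%:E <= (u * (m * (u * m) + m + u * m))%:E.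
  pose g K mu := (N mu * (minn (cnt B mu) K)%:R)%:E.
  have g0 K mu : 0 <= g K mu by rewrite lee_fin mulr_ge0.
  have mg K : measurable_fun setT (g K).
    exact: (mNf (fun k => k%:R * (minn k K)%:R)%R).
  apply: (fatou_le mg g0) => [mu|K].
    apply: cvg_near_cst; exists (cnt B mu) => // K /= NK.
    by rewrite /g (minn_idPl NK) expr2.
  apply: solve_le.
    rewrite ge0_fin_numE ?integral_ge0//.
    apply: (@le_lt_trans _ _ (\int[P]_mu (K%:R%:E * (N mu)%:E))).
      apply: ge0_le_integral => //.
      - exact: (mNf (fun k => K%:R * k%:R)%R).
      - move=> mu _; rewrite -EFinM lee_fin [leRHS]mulrC ler_wpM2l// ler_nat.
        exact: geq_minr.
    rewrite ge0_integralZl//; last 2 first.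
    - exact: (mNf (fun k => k%:R)%R).
    - by move=> mu _; rewrite lee_fin.
    by rewrite mean -EFinM ltry.
  rewrite /g [leLHS](@count1 (fun k => (minn k K)%:R)%R K%:R); last first.
    by move=> k; rewrite ler0n ler_nat geq_minr.
  apply: lee_wpmul2l; first by rewrite lee_fin ltW.
  have -> : (m * (u * m) + m + u * m)%:E = \int[P]_mu (m * N mu + m + N mu)%:E.
    under eq_integral do rewrite 2!EFinD EFinM.
    have mN1 : measurable_fun setT (fun mu => (N mu)%:E) by exact: (mNf (fun k => k%:R)%R).
    have mN2 : measurable_fun setT (fun mu => m%:E * (N mu)%:E).
      exact: (mNf (fun k => m * k%:R)%R).
    have mN3 : measurable_fun setT (fun mu => m%:E * (N mu)%:E + m%:E).
      exact: (mNf (fun k => m * k%:R + m)%R).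
    rewrite ge0_integralD//; last 2 first.
    - by move=> mu _; rewrite -EFinM -EFinD lee_fin addr_ge0// mulr_ge0.
    - by move=> mu _; rewrite lee_fin.
    rewrite ge0_integralD//; last first.
      by move=> mu _; rewrite -EFinM lee_fin mulr_ge0.
    rewrite ge0_integralZl//; last by move=> mu _; rewrite lee_fin.
    by rewrite mean integral_probability_cst.
  have h0 mu : (0 <= m * N mu + m + N mu)%R by rewrite !addr_ge0// mulr_ge0.
  have mh : measurable_fun setT (fun mu => (m * N mu + m + N mu)%:E).
    exact: (mNf (fun k => m * k%:R + m + k%:R)%R).
  rewrite -ge0_integralD//; last 3 first.
  - by move=> mu _; rewrite lee_fin.
  - by move=> mu _; exact: g0.
  - exact: mg.
  apply: ge0_le_integral => //.
  - by move=> mu _; rewrite lee_fin mulr_ge0// addr_ge0.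
  - exact: (mNf (fun k => (m + k%:R) * (minn k.+1 K)%:R)%R).
  - by apply: emeasurable_funD => //; exact: mg.
  - move=> mu _; rewrite -EFinD lee_fin.
    have k1 : ((minn (cnt B mu).+1 K)%:R <= (minn (cnt B mu) K)%:R + 1 :> R)%R.
      rewrite natr1 ler_nat; case: (leqP K (cnt B mu)) => h.
        by rewrite (minn_idPr (leqW h)) leqW.
      by rewrite geq_minl.
    have k2 : ((minn (cnt B mu) K)%:R <= N mu)%R by rewrite ler_nat geq_minl.
    have mN0 : (0 <= m + N mu)%R by rewrite addr_ge0.
    apply: (le_trans (ler_wpM2l mN0 k1)).
    have := ler_wpM2l m0 k2; rewrite mulrDr mulr1 mulrDl; lra.
have mN1 : measurable_fun setT (fun mu => (N mu)%:E) by exact: (mNf (fun k => k%:R)%R).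
have um0 : (0 <= u * m)%R by rewrite mulr_ge0.
(* The square is expanded as (N - um)^2 + 2umN = N^2 + (um)^2, so that only nonnegative functions
   are integrated. *)
have : \int[P]_mu ((N mu - u * m) ^+ 2)%:E + (2 * (u * m) * (u * m))%:E <=
       (u * (m * (u * m) + m + u * m) + (u * m) ^+ 2)%:E.
  apply: (@le_trans _ _ (\int[P]_mu (N mu ^+ 2)%:E + ((u * m) ^+ 2)%:E)); last first.
    by rewrite EFinD leeD2r.
  have -> : (2 * (u * m) * (u * m))%:E = \int[P]_mu ((2 * (u * m))%:E * (N mu)%:E).
    rewrite ge0_integralZl// ?mean -?EFinM//.
      by move=> mu _; rewrite lee_fin.
    by rewrite lee_fin mulr_ge0.
  have -> : ((u * m) ^+ 2)%:E = \int[P]_mu ((u * m) ^+ 2)%:E.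
    by rewrite integral_probability_cst.
  rewrite -!ge0_integralD//; last 7 first.
  - by move=> mu _; rewrite lee_fin sqr_ge0.
  - exact: (mNf (fun k => k%:R ^+ 2)%R).
  - by move=> mu _; rewrite lee_fin sqr_ge0.
  - by move=> mu _; rewrite lee_fin sqr_ge0.
  - exact: (mNf (fun k => (k%:R - u * m) ^+ 2)%R).
  - by move=> mu _; rewrite -EFinM lee_fin mulr_ge0// mulr_ge0.
  - exact: (mNf (fun k => (2 * (u * m)) * k%:R)%R).
  rewrite le_eqVlt; apply/orP; left; apply/eqP; apply: eq_integral => mu _.
  by rewrite -EFinM -!EFinD; congr EFin; ring.
rewrite -leeBrDr// => /le_trans; apply; rewrite -EFinB lee_fin.
by rewrite le_eqVlt; apply/orP; left; apply/eqP; ring.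
Qed.

End moments.
End polya_law.

(** * Reduction to disjoint sets *)

Lemma measure_fin_partition {d} {T : measurableType d} {R : realType} {I : finType}
    (mu : {measure set T -> \bar R}) (f : T -> I) (B : set T) :
  measurable B -> (forall c, measurable (B `&` [set x | f x = c])) ->
  mu B = \sum_(c : I) mu (B `&` [set x | f x = c]).
Proof.
move=> mB mf.
have muE C : measurable C -> mu C = \int[mu]_x (\1_C x)%:E.
  by move=> mC; rewrite integral_indic// setIT.
rewrite muE//; under [RHS]eq_bigr do rewrite muE//.
rewrite -ge0_integral_sum//; last first.
  by move=> c; apply/measurable_EFinP.
apply: eq_integral => x _; rewrite (bigD1 (f x))//= big1 ?adde0; last first.
  by move=> c /eqP cf; rewrite indicE memNset//= => -[_ fc]; apply: cf.
congr EFin; rewrite !indicE; congr (nat_of_bool _)%:R; apply: asbool_equiv_eq => /=.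
by split=> [|[]].
Qed.

Section joint_laws.
Context {d1 d2} {T1 : measurableType d1} {T2 : measurableType d2} {R : realType}.

Definition pairl (t : T1) (o : T2) : T1 * T2 := (t, o).

Lemma measurable_pairl t : measurable_fun setT (pairl t).
Proof. exact: pair1_measurable. Qed.

HB.instance Definition _ t := isMeasurableFun.Build _ _ _ _ _ (@measurable_pairl t).

Definition pairr (o : T2) (t : T1) : T1 * T2 := (t, o).

Lemma measurable_pairr o : measurable_fun setT (pairr o).
Proof. exact: pair2_measurable. Qed.

HB.instance Definition _ o := isMeasurableFun.Build _ _ _ _ _ (@measurable_pairr o).

(** Each side is integration against a probability on the product, a mixture of images of the
    kernels under pairing. Two such probabilities coincide once they agree on a determining
    class. *)
Lemma joint_integral_eq (P1 : probability T1 R) (K1 : T1 -> probability T2 R)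
    (P2 : probability T2 R) (K2 : T2 -> probability T1 R) (E : set (T1 * T2 -> R)) :
  measurable_family K1 -> measurable_family K2 -> determining_class E ->
  (forall e, E e -> \int[P1]_t \int[K1 t]_o (e (t, o))%:E =
                    \int[P2]_o \int[K2 o]_t (e (t, o))%:E) ->
  forall f : T1 * T2 -> \bar R, measurable_fun setT f -> (forall x, 0 <= f x) ->
  \int[P1]_t \int[K1 t]_o f (t, o) = \int[P2]_o \int[K2 o]_t f (t, o).
Proof.
move=> mK1 mK2 dE PE.
pose J1 t : probability (T1 * T2)%type R := distribution (K1 t) (pairl t).
pose J2 o : probability (T1 * T2)%type R := distribution (K2 o) (pairr o).
have J1E t (f : T1 * T2 -> \bar R) : measurable_fun setT f -> (forall x, 0 <= f x) ->
    \int[J1 t]_x f x = \int[K1 t]_o f (t, o).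
  by move=> mf f0; rewrite ge0_integral_distribution.
have J2E o (f : T1 * T2 -> \bar R) : measurable_fun setT f -> (forall x, 0 <= f x) ->
    \int[J2 o]_x f x = \int[K2 o]_t f (t, o).
  by move=> mf f0; rewrite ge0_integral_distribution.
have mJ1 : measurable_family J1.
  move=> A mA; rewrite (_ : (fun t => _) = fun t => \int[K1 t]_o (\1_A (t, o))%:E).
    apply: (measurable_fun_integral_family2 mK1 (f := fun x => (\1_A x)%:E)) => //.
    by apply/measurable_EFinP.
  apply/funext => t; rewrite -(J1E t (fun x => (\1_A x)%:E))//.
    by rewrite integral_indic// setIT.
  exact/measurable_EFinP.
have mJ2 : measurable_family J2.
  move=> A mA; rewrite (_ : (fun t => _) = fun o => \int[K2 o]_t (\1_A (t, o))%:E).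
    apply: (measurable_fun_integral_family2 mK2 (f := fun x => (\1_A (x.2, x.1))%:E)) => //.
    apply: (measurableT_comp (f := fun x : T1 * T2 => (\1_A x)%:E)) => //.
      exact/measurable_EFinP.
    exact: measurable_swap.
  apply/funext => o; rewrite -(J2E o (fun x => (\1_A x)%:E))//.
    by rewrite integral_indic// setIT.
  exact/measurable_EFinP.
pose M1 : probability (T1 * T2)%type R := mixture P1 mJ1.
pose M2 : probability (T1 * T2)%type R := mixture P2 mJ2.
have M1E (f : T1 * T2 -> \bar R) : measurable_fun setT f -> (forall x, 0 <= f x) ->
    \int[M1]_x f x = \int[P1]_t \int[K1 t]_o f (t, o).
  move=> mf f0; rewrite (integral_mixture mJ1 (V := P1) (P := M1))//.
  by apply: eq_integral => t _; exact: J1E.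
have M2E (f : T1 * T2 -> \bar R) : measurable_fun setT f -> (forall x, 0 <= f x) ->
    \int[M2]_x f x = \int[P2]_o \int[K2 o]_t f (t, o).
  move=> mf f0; rewrite (integral_mixture mJ2 (V := P2) (P := M2))//.
  by apply: eq_integral => t _; exact: J2E.
have M12 : measure_eq M1 M2.
  apply: (finite_measure_eq dE); [exact: probability_lty|exact: probability_lty|].
  move=> e Ee; have [_ _ e01 me] := dE.1.
  have me' : measurable_fun setT (fun x => (e x)%:E) by apply/measurable_EFinP; exact: me.
  have e0 x : 0 <= (e x)%:E by rewrite lee_fin; case/andP: (e01 _ Ee x).
  by rewrite M1E// M2E//; exact: PE.
move=> f mf f0; rewrite -M1E// -M2E//.
by apply: eq_measure_integral => A mA _; exact: M12.
Qed.

End joint_laws.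

Section base_atoms.
Context {R : realType} {X : polishType R}.
Variable Bn : nat -> set (borel X).
Hypothesis Bn_bounded : forall n, bounded_borel (Bn n).
Hypothesis Bn_increasing : forall n, Bn n `<=` Bn n.+1.
Variable A : nat -> set X.
Hypothesis A_open : forall n, open (A n).

Local Notation C := (base_set Bn A).

(** The atoms of the finite algebra generated by the base sets in [l], cut down to one [Bn K] to
    stay bounded. One family of atoms serves all sublists, so two functionals can be expanded over
    the same disjoint sets. *)
Lemma base_atoms (l : seq (seq nat * nat)) :
  exists n, exists B : 'I_n -> set (borel X),
    [/\ forall i, bounded_borel (B i), trivIset setT B &
      forall l', {subset l' <= l} -> exists2 a : 'I_n -> R, (forall i, 0 <= a i)%R &
        forall kappa : lfmeasure X,
          base_sum Bn A l' kappa = (\sum_(i < n) a i * fine (kappa (B i)))%R].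
Proof.
have bC i : bounded_borel (C i) by exact: bounded_base_set.
have [K CK] : exists K, forall i, i \in l -> C i `<=` Bn K.
  exists (\max_(i <- l) i.2) => i il x [_ Bx].
  have h : (i.2 <= \max_(j <- l) j.2)%N by exact: leq_bigmax_seq.
  exact: (Bn_homo Bn_increasing h) Bx.
have mfl (s : seq _) (t : seq bool) :
    measurable ([set x : X | map (fun i => x \in (C i : set X)) s = t] : set (borel X)).
  elim: s t => [|i s IH] [|b t].
  - by rewrite (_ : [set x | _] = setT)//; apply/seteqP; split.
  - by rewrite (_ : [set x | _] = set0)//; apply/seteqP; split.
  - by rewrite (_ : [set x | _] = set0)//; apply/seteqP; split.
  - rewrite (_ : [set x | _] = (if b then C i else ~` C i) `&`
        [set x : X | map (fun i => x \in (C i : set X)) s = t]).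
      apply: measurableI => //; case: b; first exact: bounded_borelW.
      by apply: measurableC; exact: bounded_borelW.
    apply/seteqP; split=> x /=.
      move=> [<- <-]; split=> //; case: ifPn; first by rewrite inE.
      by rewrite notin_setE.
    by move=> [h <-]; congr (_ :: _); case: b h => h; [exact: mem_set|exact: memNset].
pose f (x : X) := map_tuple (fun i => x \in (C i : set X)) (in_tuple l).
pose At (c : (size l).-tuple bool) : set (borel X) := Bn K `&` [set x : X | f x = c].
have mf c : measurable ([set x : X | f x = c] : set (borel X)).
  rewrite (_ : [set x : X | f x = c] =
      [set x : X | map (fun i => x \in (C i : set X)) l = c]); last first.
    by apply/seteqP; split=> x /= => [<-//|fc]; apply: val_inj.
  exact: mfl.
have bAt c : bounded_borel (At c) by rewrite /At setIC; exact: bounded_borelI.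
exists #|{: (size l).-tuple bool}|, (fun i => At (enum_val i)); split.
- by [].
- by move=> i j _ _ [x [[_ /= fi] [_ /= fj]]]; apply: enum_val_inj; rewrite -fi -fj.
move=> l' ll'.
(* The weight of an atom is the number of entries of [l'], with repetitions, whose component of the
   tuple is true. *)
exists (fun j => \sum_(i <- l') (nth false (enum_val j : (size l).-tuple bool) (index i l))%:R)%R.
  by move=> j; exact: sumr_ge0.
move=> kappa; rewrite /base_sum.
under [RHS]eq_bigr do rewrite mulr_suml.
rewrite exchange_big/=; apply: eq_big_seq => i /ll' il.
rewrite -(big_enum_val (idx := 0%R) (op := +%R) (A := {: (size l).-tuple bool})
  (fun c => (nth false c (index i l))%:R * fine (kappa (At c))))%R/=.
have Cat c : C i `&` At c = if nth false c (index i l) then At c else set0.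
  have At_nth x : At c x -> nth false c (index i l) = (x \in (C i : set X)).
    move=> [_ /= <-]; rewrite (nth_map i) ?index_mem//.
    by rewrite nth_index.
  apply/seteqP; split=> x.
    by move=> [Cx Ax]; rewrite (At_nth x Ax) mem_set.
  case: ifPn => // h Ax; split=> //; apply: set_mem.
  by rewrite -(At_nth x Ax).
have mAt c : measurable (C i `&` [set x : X | f x = c] : set (borel X)).
  by apply: measurableI => //; exact: bounded_borelW.
rewrite (measure_fin_partition kappa _ mAt); last exact: bounded_borelW.
rewrite -sum_fine; last first.
  move=> c _; apply: lfm_fin_num; rewrite setIC.
  exact: bounded_borelI (mf c) (bC i).
apply: eq_bigr => c _.
have -> : C i `&` [set x : X | f x = c] = C i `&` At c.
  apply/seteqP; split=> x; [move=> [Cx fx]|move=> [Cx [_ fx]]]; split=> //.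
  by split=> //; exact: CK Cx.
by rewrite Cat; case: ifP => _; rewrite ?mul1r// measure0 mul0r.
Qed.

End base_atoms.

(** * The Poisson-Gamma random measure *)

Lemma measurable_invr {R : realType} : measurable_fun setT (@GRing.inv R).
Proof.
rewrite (_ : @GRing.inv R = fun x => x * expR (- ln (x ^+ 2)))%R; last first.
  apply/funext => x; have [->|x0] := eqVneq x 0%R; first by rewrite invr0 mul0r.
  rewrite expRN lnK ?posrE ?exprn_even_gt0 ?x0//.
  by rewrite expr2 invfM mulrA mulfV// mul1r.
apply: measurable_funM => //; apply: measurableT_comp => //; apply: measurableT_comp => //.
by apply: measurableT_comp => //; exact: exprn_measurable.
Qed.

Lemma integral_dirac_setT {d} {T : measurableType d} {R : realType} (a : T) (f : T -> \bar R) :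
  measurable_fun setT f -> \int[dirac a : probability T R]_x f x = f a.
Proof.
move=> mf; transitivity (\d_a setT * f a); first exact: integral_dirac.
by rewrite diracT mul1e.
Qed.

Section separation.
Context {R : realType} {X : polishType R}.

(** Stands in for extensionality: the sets that do not separate [rho] from [rho'] form a
    sigma-algebra containing the generators. *)
Lemma measurable_lfm_measure_eq (g : lfmeasure X -> \bar R) (rho rho' : lfmeasure X) :
  measurable_fun setT g -> measure_eq rho rho' -> g rho = g rho'.
Proof.
move=> mg rr'; suff : [set A : set (lfmeasure X) | A rho <-> A rho'] (g @^-1` [set g rho]).
  by move=> /= [/(_ erefl) ->].
have : measurable (g @^-1` [set g rho]) by rewrite -[X in measurable X]setTI; exact: mg.
apply: smallest_sub; first split.
- by [].
- by move=> A /= h; split=> -[_ nA]; split=> // Ar; apply: nA; apply/h.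
- by move=> F /= h; split=> -[i _ Fi]; exists i => //; apply/h.
by move=> A [B bB [Y _ <-]] /=; rewrite (rr' _ (bounded_borelW bB)).
Qed.

End separation.

Section poisson_gamma.
Context {R : realType} {X : polishType R}.
Implicit Types (kappa rho : lfmeasure X).

Lemma integral_sum_indic kappa (I : finType) (B : I -> set (borel X)) (b : I -> R) :
  (forall i, bounded_borel (B i)) -> (forall i, 0 <= b i)%R ->
  \int[kappa]_x (\sum_i b i * \1_(B i) x)%:E = (\sum_i b i * fine (kappa (B i)))%:E.
Proof.
move=> bB b0; under eq_integral do rewrite -sumEFin.
rewrite ge0_integral_sum//; last 2 first.
- move=> i; apply/measurable_EFinP; apply: measurable_funM => //.
  by apply: measurable_indic; exact: bounded_borelW.
- by move=> i x _; rewrite lee_fin mulr_ge0.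
rewrite -sumEFin; apply: eq_bigr => i _; under eq_integral do rewrite EFinM.
have mBi := bounded_borelW (bB i).
rewrite ge0_integralZl ?lee_fin//; last first.
  by apply/measurable_EFinP; exact: measurable_indic.
by rewrite integral_indic// setIT EFinM fineK// lfm_fin_num.
Qed.

(** Tested with a step function, the inner Levy integral is the one of [frullani] at a = (1 - z)/z.
    Since a point lies in at most one [B i], the logarithm passes through the sum of steps. *)
Lemma poisson_gamma_laplace_sets z rho (Q : probability (lfmeasure X) R)
    n (B : 'I_n -> set (borel X)) (b : 'I_n -> R) :
  (0 < z < 1)%R -> poisson_gamma_laplace z rho Q ->
  (forall i, bounded_borel (B i)) -> trivIset setT B -> (forall i, 0 <= b i)%R ->
  \int[Q]_kappa (expR (- \sum_(i < n) b i * fine (kappa (B i)))%R)%:E =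
  (expR (- \sum_(i < n) fine (rho (B i)) * ln (1 + b i * (z / (1 - z))))%R)%:E.
Proof.
move=> /andP[z0 z1] PG bB tB b0.
pose h (x : borel X) : R := (\sum_(i < n) b i * \1_(B i) x)%R.
have mh : measurable_fun setT h.
  apply: measurable_sum => i; apply: measurable_funM => //.
  by apply: measurable_indic; exact: bounded_borelW.
have h0 x : (0 <= h x)%R by apply: sumr_ge0 => i _; rewrite mulr_ge0.
have z1' : (0 < 1 - z)%R by rewrite subr_gt0.
have hM : exists M : R, forall x, (h x <= M)%R.
  exists (\sum_(i < n) b i)%R => x; apply: ler_sum => i _.
  by rewrite ler_piMr// indicE; case: (_ \in _); rewrite ?lexx ler01.
have := PG h mh h0 hM; rewrite /h.
under eq_integral do rewrite integral_sum_indic//.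
move=> ->.
have lnh x : ln (1 + h x / ((1 - z) / z)) =
    (\sum_(i < n) ln (1 + b i * (z / (1 - z))) * \1_(B i) x)%R.
  rewrite invf_div; have [[k Bk]|nB] := pselect (exists k, B k x).
    have Bi i : i != k -> \1_(B i) x = 0%R :> R.
      move=> ik; rewrite indicE memNset// => Bi; move/negP: ik; apply; apply/eqP.
      by apply: tB => //; exists x.
    rewrite /h (bigD1 k)//= big1 ?addr0; last by move=> i ik; rewrite Bi ?mulr0.
    rewrite [RHS](bigD1 k)//= [X in _ = (_ + X)%R]big1; last by move=> i ik; rewrite Bi ?mulr0.
    by rewrite addr0 !indicE mem_set// !mulr1.
  have Bi i : \1_(B i) x = 0%R :> R.
    by rewrite indicE memNset// => Bi; apply: nB; exists i.
  rewrite /h big1 ?mul0r ?addr0 ?ln1; last by move=> i _; rewrite Bi mulr0.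
  by rewrite big1// => i _; rewrite Bi mulr0.
rewrite (eq_integral (fun x => (\sum_(i < n) ln (1 + b i * (z / (1 - z))) * \1_(B i) x)%R%:E));
  last by move=> x _; rewrite -lnh -frullani ?divr_gt0.
rewrite integral_sum_indic//; last first.
  by move=> i; rewrite ln_ge0// lerDl mulr_ge0// divr_ge0// ltW.
by rewrite /=; congr (expR (- _))%:E; apply: eq_bigr => i _; rewrite mulrC.
Qed.

End poisson_gamma.

Lemma integral_expRND {d} {T : measurableType d} {R : realType}
    (P : {measure set T -> \bar R}) (c : R) (Y : T -> R) : measurable_fun setT Y ->
  \int[P]_x (expR (- (c + Y x)))%:E = (expR (- c))%:E * \int[P]_x (expR (- Y x))%:E.
Proof.
move=> mY; rewrite -ge0_integralZl//.
- by apply: eq_integral => x _; rewrite opprD expRD EFinM.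
- apply/measurable_EFinP; apply: measurableT_comp => //; exact: measurableT_comp.
Qed.

(** The algebra behind conjugacy. With q = 1 + bz and s = e^{-a}, both sides are ln((q - zs)/(1 -
    z)). *)
Lemma laplace_exponents {R : realType} (z a b : R) : (0 < z < 1)%R -> (0 <= a)%R -> (0 <= b)%R ->
  (ln (1 + b * z) + (ln (1 - z * expR (- (a + ln (1 + b * z)))) - ln (1 - z)) =
   ln (1 + (b + (1 - expR (- a))) * (z / (1 - z))))%R.
Proof.
move=> /andP[z0 z1] a0 b0; have z1' : (0 < 1 - z)%R by rewrite subr_gt0.
have s1 : (expR (- a) <= 1)%R by rewrite -expR0 ler_expR oppr_le0.
have q0 : (1 <= 1 + b * z)%R by rewrite lerDl mulr_ge0// ltW.
have q_gt0 := lt_le_trans ltr01 q0.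
rewrite opprD expRD (expRN (ln _)) lnK ?posrE//.
set s := expR (- a) in s1 *; set q := (1 + b * z)%R in q0 q_gt0 *.
have qzs : (0 < q - z * s)%R.
  rewrite subr_gt0 (lt_le_trans _ q0)// (le_lt_trans _ z1)// ler_piMr// ltW//.
have -> : (1 + (b + (1 - s)) * (z / (1 - z)) = (q - z * s) / (1 - z))%R.
  by rewrite /q; field; rewrite gt_eqF.
have -> : (1 - z * (s / q) = (q - z * s) / q)%R by field; rewrite gt_eqF.
rewrite !ln_div ?posrE//; ring.
Qed.

Lemma measurable_fun_integral_family_swap {d1 d2} {T1 : measurableType d1}
    {T2 : measurableType d2} {R : realType} (K : T2 -> probability T1 R) (f : T1 * T2 -> \bar R) :
  measurable_family K -> measurable_fun setT f -> (forall x, 0 <= f x) ->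
  measurable_fun setT (fun o => \int[K o]_t f (t, o)).
Proof.
move=> mK mf f0.
apply: (measurable_fun_integral_family2 mK (f := fun x => f (x.2, x.1))) => //.
by apply: (measurableT_comp mf); exact: measurable_swap.
Qed.

(** The Poisson-Gamma law depends on its first parameter through the odds z/(1 - z), and z/(1 + z)
    is the parameter with odds z. This is where [Z'] and the factor [Z] in the estimator come
    from. *)
Lemma posterior_odds {R : realType} (z : R) : (0 < z)%R ->
  (z / (1 + z) / (1 - z / (1 + z)) = z)%R.
Proof.
move=> z0; have q0 : (0 < 1 + z)%R by rewrite addr_gt0.
have -> : (1 - z / (1 + z) = (1 + z)^-1)%R by field; rewrite gt_eqF.
by rewrite invrK mulfVK// gt_eqF.
Qed.

Lemma poisson_prob_recurrence {R : realType} (r : R) (k : nat) : (0 <= r)%R ->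
  k.+1%:R%:E * poisson_prob r 0%N [set k.+1] = r%:E * poisson_prob r 0%N [set k].
Proof.
move=> r0; rewrite /poisson_prob; case: ltP => r_gt0; last first.
  have -> : r = 0%R by apply/eqP; rewrite eq_le r_gt0.
  by rewrite mul0e diracE memNset ?mule0.
rewrite !esum_set1 ?lee_fin ?poisson_pmf_ge0// /poisson_pmf r_gt0 -!EFinM; congr EFin.
rewrite exprS factS natrM; field.
by rewrite pnatr_eq0 -lt0n fact_gt0/= nat1r pnatr_eq0.
Qed.

Lemma poisson_series_mean {R : realType} (r : R) : (0 <= r)%R ->
  \sum_(0 <= k <oo) k%:R%:E * poisson_prob r 0%N [set k] = r%:E.
Proof.
move=> r0.
have sumE : \sum_(0 <= k <oo) r%:E * poisson_prob r 0%N [set k] = r%:E.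
  rewrite nneseriesZl//.
  have := poisson_generating_function r0 (ler01 : (0 <= (1 : R))%R).
  under eq_eseriesr => k _ do rewrite expr1n mul1e.
  by move=> ->; rewrite subrr mulr0 oppr0 expR0 mule1.
have E : (fun n => \sum_(0 <= k < n.+1) k%:R%:E * poisson_prob r 0%N [set k]) =
         (fun n => \sum_(0 <= k < n) r%:E * poisson_prob r 0%N [set k]).
  apply/funext => n /=; rewrite big_nat_recl// mul0e add0e.
  by apply: eq_bigr => k _; exact: poisson_prob_recurrence.
have h : (\sum_(0 <= k < n) r%:E * poisson_prob r 0%N [set k]) @[n --> \oo] --> r%:E.
  by rewrite -[X in _ --> X]sumE; apply: is_cvg_nneseries => k _ _; rewrite mule_ge0.
by apply/cvg_lim => //; rewrite -cvg_shiftS /= E.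
Qed.

Lemma poisson_mean {R : realType} {X : polishType R} (kappa : lfmeasure X)
    (P : probability (pmeasure X) R) (B : set (borel X)) :
  is_poisson_process kappa P -> bounded_borel B -> \int[P]_mu mu B = kappa B.
Proof.
move=> Pk bB.
pose p (i : 'I_1) k := poisson_prob (fine (kappa B)) 0%N [set k].
have := @integral_prod_counts _ _ _ P 1 (fun=> cnt B) p (fun _ k => k%:R%:E).
rewrite big_ord1 poisson_series_mean ?fine_ge0// fineK ?lfm_fin_num// => <-.
- by apply: eq_integral => mu _; rewrite big_ord1 -cntE.
- by move=> i; exact: measurable_cnt.
- by move=> i k; exact: measure_ge0.
- move=> k; rewrite -(Pk 1%N (fun=> B) k (fun=> bB)).
    by congr (P _); apply/seteqP; split=> mu h i; apply/(cnt_eqP _ _ bB); exact: h.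
  by move=> i j _ _ _; rewrite (ord1 i) (ord1 j).
- by move=> i k; rewrite lee_fin.
Qed.

(** * Densities of points *)

Section void_probabilities.
Context {R : realType} {X : polishType R}.
Variables (z : R) (rho : lfmeasure X) (P : probability (pmeasure X) R).
Hypothesis z01 : (0 < z < 1)%R.
Hypothesis polyaP : polya_sum_equation z rho P.

(** The void probability (1 - z)^rho(C); [v] is the indicator of the corresponding event. *)
Let q (C : set (borel X)) : R := expR (fine (rho C) * ln (1 - z)).
Let v (C : set (borel X)) (mu : pmeasure X) : R := (cnt C mu == 0%N)%:R.

Let mv C : bounded_borel C -> measurable_fun setT (v C).
Proof. by move=> bC; exact: (measurable_cnt_comp (fun k => (k == 0%N)%:R)%R bC). Qed.

Let v01 C mu : (0 <= v C mu <= 1)%R.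
Proof. by rewrite /v; case: (_ == _); rewrite ?lexx ler01. Qed.

Let q01 C : (0 <= q C <= 1)%R.
Proof.
have /andP[z0 z1] := z01.
rewrite expR_ge0/= -expR0 ler_expR mulr_ge0_le0 ?fine_ge0// ln_le0//; lra.
Qed.

Let void_general C (G : pmeasure X -> R) :
  bounded_borel C -> measurable_fun setT G -> (forall mu, 0 <= G mu <= 1)%R ->
  (forall mu x, C x -> G (pm_add1 mu x) = G mu) ->
  \int[P]_mu (v C mu * G mu)%:E = (q C)%:E * \int[P]_mu (G mu)%:E.
Proof.
move=> bC mG G01 GC.
(* The generating function at s = 0 sees exactly the event of no points. *)
have s01 : (0 <= (0 : R) <= 1)%R by rewrite lexx ler01.
have := polya_generating_function z01 polyaP bC mG G01 GC s01.
under eq_integral => mu _ do rewrite expr0n -/(v C mu).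
by move=> ->; rewrite mulr0 subr0 ln1 sub0r mulrN opprK.
Qed.

Lemma polya_void C : bounded_borel C -> \int[P]_mu (v C mu)%:E = (q C)%:E.
Proof.
move=> bC; have := @void_general C (cst 1%R) bC (measurable_cst _).
rewrite integral_probability_cst mule1 => <- //.
- by apply: eq_integral => mu _; rewrite mulr1.
- by move=> mu; rewrite ler01 lexx.
Qed.

Lemma polya_void2 C C' : bounded_borel C -> bounded_borel C' -> C `&` C' = set0 ->
  \int[P]_mu (v C mu * v C' mu)%:E = (q C * q C')%:E.
Proof.
move=> bC bC' CC'; rewrite void_general ?polya_void//.
- exact: mv.
- move=> mu x Cx; rewrite /v cnt_add1_notin// => C'x.
  by have : (C `&` C') x by []; rewrite CC'.
Qed.

(** Occupation indicators of disjoint sets are pairwise independent Bernoulli variables, so the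
    variance is the sum of q(1 - q), which the mean dominates. *)
Lemma polya_occupied_second_moment (I : finType) (C : I -> set (borel X)) :
  (forall c, bounded_borel (C c)) -> trivIset setT C ->
  \int[P]_mu ((\sum_c (1 - v (C c) mu) - \sum_c (1 - q (C c))) ^+ 2)%:E <=
  (\sum_c (1 - q (C c)))%:E.
Proof.
move=> bC tC.
pose Q := (\sum_c q (C c))%R; pose N mu := (\sum_c v (C c) mu)%R.
have Q0 : (0 <= Q)%R by apply: sumr_ge0 => c _; case/andP: (q01 (C c)).
have v0 c mu : (0 <= v (C c) mu)%R by case/andP: (v01 (C c) mu).
have N0 mu : (0 <= N mu)%R by apply: sumr_ge0.
have mN : measurable_fun setT N by apply: measurable_sum => c; exact: mv.
have EN : \int[P]_mu (N mu)%:E = Q%:E.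
  rewrite /N; under eq_integral do rewrite -sumEFin.
  rewrite ge0_integral_sum//; last 2 first.
  - by move=> c; apply/measurable_EFinP; exact: mv.
  - by move=> c mu _; rewrite lee_fin.
  by under eq_bigr do rewrite polya_void//; rewrite sumEFin.
have ENN : \int[P]_mu (N mu ^+ 2)%:E = (Q ^+ 2 + \sum_c q (C c) * (1 - q (C c)))%:E.
  transitivity (\int[P]_mu \sum_c \sum_d (v (C c) mu * v (C d) mu)%:E).
    apply: eq_integral => mu _; rewrite expr2 /N mulr_suml -sumEFin.
    by apply: eq_bigr => c _; rewrite mulr_sumr -sumEFin.
  have mvv c d : measurable_fun setT (fun mu => (v (C c) mu * v (C d) mu)%:E).
    by apply/measurable_EFinP; apply: measurable_funM; exact: mv.
  have vv0 c d mu : 0 <= (v (C c) mu * v (C d) mu)%:E by rewrite lee_fin mulr_ge0.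
  rewrite ge0_integral_sum//; last 2 first.
  - by move=> c; apply: emeasurable_sum => d; exact: mvv.
  - by move=> c mu _; apply: sume_ge0.
  rewrite expr2 /Q mulr_suml -big_split/= -sumEFin; apply: eq_bigr => c _.
  rewrite ge0_integral_sum// (bigD1 c)//= [in RHS](bigD1 c)//=.
  have -> : \int[P]_mu (v (C c) mu * v (C c) mu)%:E = (q (C c))%:E.
    rewrite -polya_void//; apply: eq_integral => mu _; rewrite /v.
    by case: (_ == _); rewrite ?mulr1 ?mulr0.
  rewrite (eq_bigr (fun d => (q (C c) * q (C d))%:E)); last first.
    move=> d dc; apply: polya_void2 => //.
    by move/trivIsetP: tC; apply=> //; rewrite eq_sym.
  rewrite sumEFin -EFinD; congr EFin; rewrite mulrDr mulr_sumr; ring.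
have msq : measurable_fun setT (fun mu => ((N mu - Q) ^+ 2)%:E).
  by apply/measurable_EFinP; apply: measurable_funX; exact: measurable_funB.
have -> : \int[P]_mu ((\sum_c (1 - v (C c) mu) - \sum_c (1 - q (C c))) ^+ 2)%:E =
          \int[P]_mu ((N mu - Q) ^+ 2)%:E.
  apply: eq_integral => mu _; congr EFin; rewrite -[RHS]sqrrN; congr (_ ^+ 2)%R.
  by rewrite !sumrB /N /Q; ring.
have : \int[P]_mu ((N mu - Q) ^+ 2)%:E + (2 * Q * Q)%:E =
    (Q ^+ 2 + \sum_c q (C c) * (1 - q (C c)) + Q ^+ 2)%:E.
  have -> : (2 * Q * Q)%:E = \int[P]_mu ((2 * Q)%:E * (N mu)%:E).
    rewrite ge0_integralZl ?EN -?EFinM//.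
    - exact/measurable_EFinP.
    - by move=> mu _; rewrite lee_fin.
    - by rewrite lee_fin mulr_ge0.
  rewrite [RHS]EFinD -ENN -[(Q ^+ 2)%:E](integral_probability_cst P).
  rewrite -!ge0_integralD//.
  - apply: eq_integral => mu _; rewrite -EFinM -!EFinD; congr EFin; ring.
  - by move=> mu _; rewrite lee_fin sqr_ge0.
  - by apply/measurable_EFinP; exact: measurable_funX.
  - by move=> mu _; rewrite lee_fin sqr_ge0.
  - by move=> mu _; rewrite lee_fin sqr_ge0.
  - by move=> mu _; rewrite -EFinM lee_fin mulr_ge0// mulr_ge0.
  - by apply/measurable_EFinP; exact: measurable_funM.
move=> h; rewrite -(leeD2rE (x := (2 * Q * Q)%:E))// h -EFinD lee_fin.
have : (\sum_c q (C c) * (1 - q (C c)) <= \sum_c (1 - q (C c)))%R.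
  apply: ler_sum => c _; have /andP[qc0 qc1] := q01 (C c).
  by rewrite ler_piMl// subr_ge0.
lra.
Qed.

End void_probabilities.

Section cells.
Context {R : realType} {X : polishType R}.
Variable A : nat -> set X.
Hypothesis A_open : forall n, open (A n).
Hypothesis A_base : forall U x, open U -> U x -> exists2 n, A n x & A n `<=` U.
Variables (rho : lfmeasure X) (B : set (borel X)).
Hypothesis rho_diffuse : forall x, rho [set x] = 0.
Hypothesis bB : bounded_borel B.

Let C n (c : {ffun 'I_n -> bool}) : set (borel X) := B `&` cell A c.
Let x_ n c : R := fine (rho (@C n c)).

Lemma bounded_borel_cell n c : bounded_borel (@C n c).
Proof. by rewrite /C setIC; apply: bounded_borelI => //; exact: measurable_cell. Qed.

Lemma sum_measure_cells n : (\sum_c x_ (n := n) c)%R = fine (rho B).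
Proof.
rewrite (measure_fin_partition rho (f := code A n) (bounded_borelW bB)).
  rewrite -sum_fine// => c _; apply: lfm_fin_num; exact: bounded_borel_cell.
by move=> c; apply: bounded_borelW; exact: bounded_borel_cell.
Qed.

(** The sum is the integral over [B] of the mass of the cell around x. Cells shrink to the
    singleton, which is null as [rho] is diffuse, and rho(B) dominates. *)
Lemma cvg_sum_sqr_cells : (\sum_c x_ (n := n) c ^+ 2)%R @[n --> \oo] --> (0 : R)%R.
Proof.
pose f n x : R := (\sum_c x_ (n := n) c * \1_(C (n := n) c) x)%R.
have x0 n c : (0 <= x_ (n := n) c)%R by exact: fine_ge0.
have fE n x : B x -> f n x = x_ (code A n x).
  move=> Bx; rewrite /f (bigD1 (code A n x))//= big1 ?addr0; last first.
    by move=> c /eqP cx; rewrite indicE memNset ?mulr0// => -[_ /esym].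
  by rewrite indicE mem_set ?mulr1.
have fNE n x : ~ B x -> f n x = 0%R.
  by move=> Bx; rewrite /f big1// => c _; rewrite indicE memNset ?mulr0// => -[].
have mf n : measurable_fun setT (f n).
  apply: measurable_sum => c; apply: measurable_funM => //.
  by apply: measurable_indic; apply: bounded_borelW; exact: bounded_borel_cell.
have f_cvg x : (f n x)%:E @[n --> \oo] --> 0.
  have [Bx|nBx] := pselect (B x); last first.
    by under eq_fun do rewrite fNE//; exact: cvg_cst.
  have mF n : measurable (C (code A n x)).
    by apply: bounded_borelW; exact: bounded_borel_cell.
  have F1 : \bigcap_n C (code A n x) = [set x].
    apply/seteqP; split=> [y h|y ->]; last by [].
    apply: contrapT => /eqP yx; have /(near_code_inj A_base) : uniq [:: y; x] by rewrite /= inE yx.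
    move=> [n _ /(_ n (leqnn n))] /=; rewrite inE andbT => /eqP; apply.
    by have [] := h n I.
  have := @nonincreasing_cvg_mu _ _ _ rho (fun n => C (code A n x)).
  rewrite F1 rho_diffuse => /(_ _ mF _ _) h.
  rewrite (_ : (fun n => _) = rho \o (fun n => C (code A n x))).
    apply: h.
    - by apply: lfm_fin; exact: bounded_borel_cell.
    - exact: measurable_singleton.
    - move=> m n mn; apply/subsetPset => y [By /= cy]; split=> //=.
      apply/ffunP => i; have /ffunP/(_ (widen_ord mn i)) := cy.
      by rewrite !ffunE.
  apply/funext => n /=; rewrite fE// fineK//; apply: lfm_fin_num; exact: bounded_borel_cell.
have f_le n x : `|(f n x)%:E| <= (fine (rho B) * \1_B x)%:E.
  rewrite gee0_abs; last by rewrite lee_fin; apply: sumr_ge0 => c _; rewrite mulr_ge0.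
  have [Bx|nBx] := pselect (B x); last first.
    by rewrite fNE// indicE memNset// mulr0.
  rewrite fE// indicE mem_set// mulr1 -(sum_measure_cells n) (bigD1 (code A n x))//= lee_fin.
  by rewrite lerDl sumr_ge0.
have ig : rho.-integrable setT (fun x => (fine (rho B) * \1_B x)%:E).
  apply/integrableP; split.
    apply/measurable_EFinP; apply: measurable_funM => //.
    by apply: measurable_indic; exact: bounded_borelW.
  under eq_integral => x _ do rewrite gee0_abs ?lee_fin ?mulr_ge0 ?fine_ge0// EFinM.
  rewrite ge0_integralZl ?lee_fin ?fine_ge0//; last first.
    by apply/measurable_EFinP; apply: measurable_indic; exact: bounded_borelW.
  rewrite integral_indic ?setIT//; last exact: bounded_borelW.
  by rewrite fineK ?lfm_fin_num// lte_mul_pinfty ?lfm_fin_num ?lfm_fin.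
have := @dominated_cvg _ _ _ rho setT measurableT (fun n x => (f n x)%:E) (cst 0)
  (fun x => (fine (rho B) * \1_B x)%:E).
rewrite integral0 => h.
have {}h : \int[rho]_x (f n x)%:E @[n --> \oo] --> 0.
  apply: h => //; first by move=> n; apply/measurable_EFinP.
  by move=> x _; exact: f_cvg.
rewrite (_ : (fun n => _) = fine \o (fun n => \int[rho]_x (f n x)%:E)).
  exact: fine_cvg h.
apply/funext => n /=; rewrite integral_sum_indic//; last by move=> c; exact: bounded_borel_cell.
Qed.

End cells.

Section polya_support.
Context {R : realType} {X : polishType R}.
Variable A : nat -> set X.
Hypothesis A_open : forall n, open (A n).
Hypothesis A_base : forall U x, open U -> U x -> exists2 n, A n x & A n `<=` U.
Variables (z : R) (rho : lfmeasure X) (P : probability (pmeasure X) R).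
Hypothesis z01 : (0 < z < 1)%R.
Hypothesis polyaP : polya_sum_equation z rho P.
Hypothesis rho_diffuse : forall x, rho [set x] = 0.

Let q (C : set (borel X)) : R := expR (fine (rho C) * ln (1 - z)).
Let p n B : R := (\sum_(c : {ffun 'I_n -> bool}) (1 - q (B `&` cell A c)))%R.
Let lambda : R := (- ln (1 - z))%R.

Let lambda0 : (0 <= lambda)%R.
Proof. by have /andP[z0 z1] := z01; rewrite /lambda oppr_ge0 ln_le0//; lra. Qed.

Let qE C : (1 - q C = 1 - expR (- (lambda * fine (rho C))))%R.
Proof. by rewrite /q /lambda mulNr opprK mulrC. Qed.

Let p_le n B : bounded_borel B -> (p n B <= lambda * fine (rho B))%R.
Proof.
move=> bB; rewrite -(sum_measure_cells A_open rho bB n) mulr_sumr; apply: ler_sum => c _.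
by rewrite qE onemexpRN_le.
Qed.

(** The linear and quadratic bounds on 1 - e^{-x} sandwich [p n B] between lambda rho(B) and that
    value less lambda^2 times the sum of squared cell masses. *)
Let p_cvg B : bounded_borel B -> p n B @[n --> \oo] --> (lambda * fine (rho B))%R.
Proof.
move=> bB; have := cvg_sum_sqr_cells A_open A_base rho_diffuse bB.
move=> /(cvgM (cvg_cst (lambda ^+ 2)%R))/(cvgB (cvg_cst (lambda * fine (rho B))%R)).
rewrite mulr0 subr0 => h.
apply: squeeze_cvgr h (cvg_cst (lambda * fine (rho B))%R).
apply: nearW => n; rewrite p_le// andbT.
rewrite [leLHS](_ : _ = lambda * fine (rho B) - lambda ^+ 2 *
  \sum_(c : {ffun 'I_n -> bool}) fine (rho (B `&` cell A c)) ^+ 2)%R//.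
rewrite -(sum_measure_cells A_open rho bB n) !mulr_sumr -sumrB; apply: ler_sum => c _.
by rewrite qE -exprMn onemexpRN_ge// mulr_ge0// fine_ge0.
Qed.

(** The bound for occupied cells is uniform in the partition, so Fatou carries it to the number of
    distinct points. *)
Lemma polya_mstar_second_moment B : bounded_borel B ->
  \int[P]_mu ((fine (mstar mu B) - lambda * fine (rho B)) ^+ 2)%:E <=
  (lambda * fine (rho B))%:E.
Proof.
move=> bB; have bC n c := bounded_borel_cell A_open bB (n := n) c.
have occE n (mu : pmeasure X) : occupied_cells A n mu B =
    (\sum_(c : {ffun 'I_n -> bool}) (1 - (cnt (B `&` cell A c) mu == 0%N)%:R))%R.
  apply: eq_bigr => c _; rewrite (cntE mu (bC n c)) eqe pnatr_eq0.
  by case: (_ == _); rewrite /= ?subrr ?subr0.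
apply: (@fatou_le _ _ _ P (fun n (mu : pmeasure X) => ((occupied_cells A n mu B - p n B) ^+ 2)%:E)).
- move=> n; apply/measurable_EFinP; apply: measurable_funX; apply: measurable_funB => //.
  under eq_fun do rewrite occE.
  apply: measurable_sum => c.
  exact: (measurable_cnt_comp (fun k => 1 - (k == 0%N)%:R)%R (bC n c)).
- by move=> n mu; rewrite lee_fin sqr_ge0.
- move=> mu; apply: cvg_EFin; first exact: nearW.
  rewrite /comp/=.
  have h : occupied_cells A n mu B @[n --> \oo] --> fine (mstar mu B).
    apply: cvg_near_cst; near=> n; apply: EFin_inj; rewrite fineK; last exact: mstar_fin_num.
    near: n; exact: (occupied_cells_mstar A_open A_base).
  have {}h : (occupied_cells A n mu B - p n B)%R @[n --> \oo] -->
      (fine (mstar mu B) - lambda * fine (rho B))%R.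
    exact: cvgB h (p_cvg bB).
  exact: (cvgM h h).
- move=> n; apply: (@le_trans _ _ (p n B)%:E); last by rewrite lee_fin p_le.
  under eq_integral => mu _ do rewrite occE.
  apply: (polya_occupied_second_moment z01 polyaP (C := fun c => B `&` cell A c)); first exact: bC.
  by move=> c d _ _ [x [[_ /= <-] [_ /= <-]]].
Unshelve. all: by end_near.
Qed.

End polya_support.

Section densities_lln.
Context {R : realType} {X : polishType R}.
Variable rho0 : lfmeasure X.
Hypothesis rho0_infinite : rho0 setT = +oo.
Hypothesis rho0_diffuse : forall x : X, rho0 [set x] = 0.
Variable Bn : nat -> set (borel X).
Hypothesis Bn_bounded : forall n, bounded_borel (Bn n).
Hypothesis Bn_increasing : forall n, Bn n `<=` Bn n.+1.
Hypothesis Bn_exhaust : forall A, bounded_borel A -> exists n, A `<=` Bn n.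
Variable A : nat -> set X.
Hypothesis A_open : forall n, open (A n).
Hypothesis A_base : forall U x, open U -> U x -> exists2 n, A n x & A n `<=` U.

Let s n : R := fine (rho0 (Bn n)).

Let s_homo : {homo s : m n / (m <= n)%N >-> (m <= n)%R}.
Proof.
move=> m n mn; rewrite /s fine_le ?lfm_fin_num//; apply: le_measure.
- by apply: mem_set; exact: bounded_borelW.
- by apply: mem_set; exact: bounded_borelW.
- exact: Bn_homo.
Qed.

Lemma reference_unbounded a : exists n, (a <= s n)%R.
Proof.
have := cvg_measure_Bn Bn_bounded Bn_increasing Bn_exhaust (mu := rho0) measurableT.
rewrite rho0_infinite => /cvgeyPge/(_ a)[n _ /(_ n (leqnn n))].
rewrite setTI => h; exists n; rewrite -lee_fin fineK//; exact: lfm_fin_num.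
Qed.

Lemma polya_densities (z w : R) (rho : lfmeasure X) (P : probability (pmeasure X) R) :
  (0 < z < 1)%R -> (0 < w)%R -> measure_eq rho (lfm_scale w rho0) ->
  polya_sum_equation z rho P ->
  {ae P, forall mu, density_seq rho0 Bn mu @ \oo --> (w * (z / (1 - z)))%R /\
                    density_star_seq rho0 Bn mu @ \oo --> (- w * ln (1 - z))%R}.
Proof.
move=> z01 w0 rhoE polyaP.
have scaleE B : measurable B -> rho B = w%:E * rho0 B.
  by move=> mB; rewrite rhoE//= /mscale/= gtr0_norm.
have fineE B : bounded_borel B -> fine (rho B) = (w * fine (rho0 B))%R.
  by move=> bB; rewrite scaleE ?fineM ?lfm_fin_num//; exact: bounded_borelW.
have rho_diffuse x : rho [set x] = 0.
  by rewrite scaleE ?rho0_diffuse ?mule0//; exact: measurable_singleton.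
have /andP[z0 z1] := z01; have z1' : (0 < 1 - z)%R by rewrite subr_gt0.
have mB n := bounded_borelW (Bn_bounded n).
have l0 : (0 <= - ln (1 - z))%R by rewrite oppr_ge0 ln_le0//; lra.
have U1 : {ae P, forall mu : pmeasure X,
    (fine (mu (Bn n)) / s n)%R @[n --> \oo] --> (w * (z / (1 - z)))%R}.
  apply: (@lln_second_moment _ _ _ P (fun n (mu : pmeasure X) => fine (mu (Bn n))) s _
    ((z / (1 - z) + (z / (1 - z)) ^+ 2) * w)%R) => //.
  - move=> n; apply: (measurableT_comp (fine_measurable _)) => //.
    exact: measurable_pm_eval_bounded.
  - move=> mu m n mn; apply: fine_le; rewrite ?lfm_fin_num//.
    apply: le_measure; first exact: mem_set.
      exact: mem_set.
    exact: Bn_homo.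
  - exact: reference_unbounded.
  - by rewrite mulr_ge0 ?(ltW w0)// addr_ge0 ?sqr_ge0// divr_ge0// ltW.
  - move=> n; under eq_integral => mu _ do rewrite (cntE mu (Bn_bounded n))/=.
    have := polya_second_moment z01 polyaP (Bn_bounded n).
    rewrite fineE// (_ : (z / (1 - z) * (w * fine (rho0 (Bn n))) = w * (z / (1 - z)) * s n)%R).
      by rewrite -/(s n) (mulrA _ w).
    by rewrite -[RHS]mulrA mulrCA.
have U2 : {ae P, forall mu : pmeasure X,
    (fine (mstar mu (Bn n)) / s n)%R @[n --> \oo] --> (- w * ln (1 - z))%R}.
  apply: (@lln_second_moment _ _ _ P (fun n mu => fine (mstar mu (Bn n))) s _
    (- ln (1 - z) * w)%R) => //.
  - move=> n; apply: (measurableT_comp (fine_measurable _)) => //.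
    apply: (measurable_mstar A_open A_base) => // C mC CB.
    by apply: measurable_pm_eval_bounded; exact: bounded_borelS mC CB (Bn_bounded n).
  - by move=> n mu; apply: fine_ge0; exact: mstar_ge0.
  - move=> mu m n mn; apply: fine_le.
    + exact: mstar_fin_num.
    + exact: mstar_fin_num.
    + apply: (mstar_mono A_open A_base) => //; exact: Bn_homo.
  - exact: reference_unbounded.
  - by rewrite mulr_ge0 ?(ltW w0).
  - move=> n; have := polya_mstar_second_moment A_open A_base z01 polyaP rho_diffuse (Bn_bounded n).
    rewrite fineE// (_ : (- ln (1 - z) * (w * fine (rho0 (Bn n))) = - w * ln (1 - z) * s n)%R).
      by rewrite (_ : (- w * ln (1 - z) = - ln (1 - z) * w)%R)//; ring.
    by rewrite /s; ring.
by apply: filterS2 U1 U2 => mu.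
Qed.

End densities_lln.

(** * Recovering the parameters *)

Section measurable_limits.
Context {R : realType}.

Definition converges (a : R^nat) : bool := `[< cvgn a >].

Let aE (a : R^nat) n := (a n)%:E.

Let cvg_aE a l : a @ \oo --> l -> aE a @ \oo --> l%:E.
Proof. by move=> al; apply: cvg_EFin => //; exact: nearW. Qed.

Let convergesE a : converges a =
  (limn_esup (aE a) <= limn_einf (aE a)) && (limn_esup (aE a) \is a fin_num).
Proof.
apply/asboolP/andP => [/cvg_ex[l al]|[le_ei fin]].
  have := cvg_limn_einf_sup (cvg_aE al) => -[-> ->].
  by rewrite lexx.
have eq_ei : limn_einf (aE a) = limn_esup (aE a).
  by apply/eqP; rewrite eq_le limn_einf_sup le_ei.
have : aE a @ \oo --> limn_esup (aE a).
  apply: (@squeeze_cvge _ _ _ _ (einfs (aE a)) (aE a) (esups (aE a))).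
  - apply: nearW => n; apply/andP; split.
      by apply: ereal_inf_lbound; exists n => /=.
    by apply: ereal_sup_ubound; exists n => /=.
  - by rewrite -eq_ei limn_einf_lim; exact: is_cvg_einfs.
  - by rewrite limn_esup_lim; exact: is_cvg_esups.
rewrite -(fineK fin) => /fine_cvg h; apply/cvg_ex; exists (fine (limn_esup (aE a))).
exact: h.
Qed.

Let limn_converges a : converges a -> limn a = fine (limn_esup (aE a)).
Proof.
move=> /asboolP/cvg_ex[l al].
have [_ ->] := cvg_limn_einf_sup (cvg_aE al).
exact: cvg_lim.
Qed.

Context {d} {T : measurableType d}.
Variable a : nat -> T -> R.
Hypothesis ma : forall n, measurable_fun setT (a n).

Let mesup : measurable_fun setT (fun x => limn_esup (aE (a ^~ x))).
Proof. by apply: measurable_fun_limn_esup => n; exact/measurable_EFinP. Qed.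

Let meinf : measurable_fun setT (fun x => limn_einf (aE (a ^~ x))).
Proof.
rewrite /limn_einf; apply: measurableT_comp => //.
apply: (measurable_fun_limn_esup (f := fun n x => - (a n x)%:E)) => n.
by apply: measurableT_comp => //; exact/measurable_EFinP.
Qed.

Lemma measurable_converges : measurable_fun setT (fun x => converges (a ^~ x)).
Proof.
under eq_fun do rewrite convergesE; apply: measurable_and; first exact: measurable_fun_lee.
apply: (measurable_fun_bool true) => //; exact: emeasurable_fin_num.
Qed.

(** Off convergence [limn] has no useful value; there 0 is substituted, and elsewhere the limit is
    the upper limit, which is measurable. *)
Lemma measurable_limn_converges :
  measurable_fun setT (fun x => if converges (a ^~ x) then limn (a ^~ x) else 0%R).
Proof.
rewrite (_ : (fun x => _) = fun x =>
    if converges (a ^~ x) then fine (limn_esup (aE (a ^~ x))) else 0%R); last first.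
  by apply/funext => x; case: ifPn => // /limn_converges.
apply: measurable_fun_ifT => //; first exact: measurable_converges.
exact: (measurableT_comp (fine_measurable _)).
Qed.

End measurable_limits.

Section parameter_equations.
Context {R : realType}.
Implicit Types (z w u v y : R).
Local Open Scope ring_scope.

(* In the variable [y = - ln (1 - z)] the equations read
   [w (expR y - 1) = u] and [w y = v]. *)
Definition log_parameter (r : R) : R := xget 0 [set y | 0 < y /\ expR y - 1 = r * y].

Let expRB1_gt y : 0 < y -> y < expR y - 1.
Proof. by move=> y0; rewrite ltrBrDl; apply: expR_gt1Dx; rewrite gt_eqF. Qed.

Lemma log_parameter_gt1 r : 1 < r ->
  0 < log_parameter r /\ expR (log_parameter r) - 1 = r * log_parameter r.
Proof.
move=> r1; rewrite /log_parameter; case: xgetP => [y -> //|h].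
by have [y y0 yE] := expRB1_div_surj r1; case: (h y).
Qed.

Lemma log_parameter_le1 r : r <= 1 -> log_parameter r = 0.
Proof.
move=> r1; rewrite /log_parameter; case: xgetP => [y _ [y0 yE]|//].
have := expRB1_gt y0; rewrite yE => /lt_le_trans/(_ (ler_wpM2r (ltW y0) r1)).
by rewrite mul1r ltxx.
Qed.

Lemma log_parameter_unique r y : 0 < y -> expR y - 1 = r * y -> log_parameter r = y.
Proof.
move=> y0 yE.
have r1 : 1 < r.
  rewrite ltNge; apply/negP => r1; have := expRB1_gt y0; rewrite yE.
  by move=> /lt_le_trans/(_ (ler_wpM2r (ltW y0) r1)); rewrite mul1r ltxx.
have [l0 lE] := log_parameter_gt1 r1.
have [ly|yl|//] := ltgtP (log_parameter r) y.
  have := expRB1_div_lt l0 ly; rewrite lE yE; lra.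
have := expRB1_div_lt y0 yl; rewrite lE yE; lra.
Qed.

(** Monotonicity, from convexity of the exponential, gives measurability of a function defined by
    choice. *)
Lemma nondecreasing_log_parameter : nondecreasing_fun log_parameter.
Proof.
move=> r r' rr'; have [r1|r1] := ltP 1 r; last first.
  rewrite log_parameter_le1//; have [r'1|r'1] := ltP 1 r'; last by rewrite log_parameter_le1.
  by have [/ltW] := log_parameter_gt1 r'1.
have [l0 lE] := log_parameter_gt1 r1.
have [l'0 l'E] := log_parameter_gt1 (lt_le_trans r1 rr').
rewrite leNgt; apply/negP => l'l.
have := expRB1_div_lt l'0 l'l; rewrite lE l'E.
have := ler_wpM2r (ltW (mulr_gt0 l0 l'0)) rr'; lra.
Qed.

Lemma measurable_log_parameter : measurable_fun setT log_parameter.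
Proof. by apply: nondecreasing_measurable => //; exact: nondecreasing_log_parameter. Qed.

(** For u/v <= 1 the value of [log_parameter] is 0, and then 1 - e^0 = 0 and v/0 = 0. The formula
    thus returns (0,0), the prescribed default, whenever the equations have no solution. *)
Definition density_parameters u v : R * R :=
  if 0 < v then (1 - expR (- log_parameter (u / v)), v / log_parameter (u / v))
  else (0, 0).

Definition parameter_equations u v (zw : R * R) :=
  [/\ (0 < zw.1 < 1) /\ 0 < zw.2 \/ zw = (0, 0),
      zw.2 * (zw.1 / (1 - zw.1)) = u & - zw.2 * ln (1 - zw.1) = v].

Lemma parameter_equations_unique u v zw :
  parameter_equations u v zw -> zw = density_parameters u v.
Proof.
case: zw => z w [/= [[/andP[z0 z1] w0]|[-> ->]]]; last first.
  by rewrite oppr0 !mul0r => _ <-; rewrite /density_parameters ltxx.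
have z1' : 0 < 1 - z by rewrite subr_gt0.
pose y := - ln (1 - z).
have y0 : 0 < y by rewrite /y oppr_gt0 ln_lt0//; lra.
have eyN : expR (- y) = 1 - z by rewrite /y opprK lnK.
have zE : z = 1 - expR (- y) by rewrite eyN; ring.
have odds : z / (1 - z) = expR y - 1.
  by rewrite -eyN expRN invrK zE expRN mulrBl mul1r mulVf ?gt_eqF ?expR_gt0.
rewrite odds mulNr -mulrN -/y => uE vE.
have v0 : 0 < v by rewrite -vE mulr_gt0.
rewrite /density_parameters v0 (@log_parameter_unique _ y)//; last first.
  by rewrite -uE -vE; field; rewrite !gt_eqF.
by rewrite -zE -vE mulfK ?gt_eqF.
Qed.

Lemma density_parameters_no_solution u v :
  (forall zw, ~ parameter_equations u v zw) -> density_parameters u v = (0, 0).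
Proof.
move=> h; rewrite /density_parameters; case: ifPn => // v0.
have [r1|r1] := ltP 1 (u / v); last first.
  by rewrite log_parameter_le1// oppr0 expR0 subrr invr0 mulr0.
have [l0 lE] := log_parameter_gt1 r1; set y := log_parameter _ in l0 lE *.
case: (h (1 - expR (- y), v / y)); split => /=.
- left; rewrite divr_gt0// subr_gt0 -expR0 ltr_expR oppr_lt0 l0 ltrBlDr ltrDl expR_gt0//.
- have -> : (1 - expR (- y)) / (1 - (1 - expR (- y))) = expR y - 1.
    rewrite subKr expRN invrK mulrBl mul1r mulVf ?gt_eqF ?expR_gt0//.
  by rewrite lE; field; rewrite !gt_eqF.
- by rewrite subKr expRK mulNr mulrN opprK mulfVK// gt_eqF.
Qed.

Lemma measurable_density_parameters {d} {T : measurableType d} (u v : T -> R) :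
  measurable_fun setT u -> measurable_fun setT v ->
  measurable_fun setT (fun x => (density_parameters (u x) (v x)).1) /\
  measurable_fun setT (fun x => (density_parameters (u x) (v x)).2).
Proof.
move=> mu mv.
have ml : measurable_fun setT (fun x => log_parameter (u x / v x)).
  apply: (measurableT_comp measurable_log_parameter); apply: measurable_funM => //.
  exact: (measurableT_comp (@measurable_invr R)).
have mb : measurable_fun setT (fun x => 0 < v x) by exact: measurable_fun_ltr.
split.
- rewrite (_ : (fun x => _) = fun x =>
      if 0 < v x then 1 - expR (- log_parameter (u x / v x)) else 0).
    apply: measurable_fun_ifT => //; apply: measurable_funB => //.
    by apply: measurableT_comp => //; exact: measurableT_comp.
  by apply/funext => x; rewrite /density_parameters; case: ifP.
- rewrite (_ : (fun x => _) = fun x => if 0 < v x then v x / log_parameter (u x / v x) else 0).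
    apply: measurable_fun_ifT => //; apply: measurable_funM => //.
    exact: (measurableT_comp (@measurable_invr R)).
  by apply/funext => x; rewrite /density_parameters; case: ifP.
Qed.

End parameter_equations.

(** * Measurability of the reconstructed parameters *)

Section tail_parameters.
Context {R : realType} {X : polishType R}.
Variable rho0 : lfmeasure X.
Variable Bn : nat -> set (borel X).
Hypothesis Bn_bounded : forall n, bounded_borel (Bn n).
Hypothesis Bn_increasing : forall n, Bn n `<=` Bn n.+1.
Hypothesis Bn_exhaust : forall A, bounded_borel A -> exists n, A `<=` Bn n.
Variable A : nat -> set X.
Hypothesis A_open : forall n, open (A n).
Hypothesis A_base : forall U x, open U -> U x -> exists2 n, A n x & A n `<=` U.

Definition limit_parameters (a b : R^nat) : R * R :=
  if converges a && converges b then density_parameters (limn a) (limn b) else (0%R, 0%R).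

Lemma solutionsE (mu : pmeasure X) zw : solutions rho0 Bn mu zw <->
  [/\ cvgn (density_seq rho0 Bn mu), cvgn (density_star_seq rho0 Bn mu) &
      parameter_equations (U rho0 Bn mu) (Ustar rho0 Bn mu) zw].
Proof. by split=> [[? ? ? ? ?]|[? ? [? ? ?]]]; split. Qed.

(** Uniqueness of solutions and matching defaults turn the choice in [ZW] into a formula that is
    measurable in the two density sequences. *)
Lemma ZWE (mu : pmeasure X) :
  ZW rho0 Bn mu = limit_parameters (density_seq rho0 Bn mu) (density_star_seq rho0 Bn mu).
Proof.
rewrite /ZW /limit_parameters; case: xgetP =>
  [zw -> /solutionsE[c1 c2 /parameter_equations_unique ->]|h].
  by rewrite /converges !asboolT.
case: ifPn => // /andP[/asboolP c1 /asboolP c2].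
rewrite -/(U _ _ _) -/(Ustar _ _ _) density_parameters_no_solution// => zw zwE.
by apply: (h zw); apply/solutionsE.
Qed.

Lemma solutions_set1 (mu : pmeasure X) zw : solutions rho0 Bn mu zw ->
  solutions rho0 Bn mu = [set (Z rho0 Bn mu, W rho0 Bn mu)] /\
  zw = (Z rho0 Bn mu, W rho0 Bn mu).
Proof.
rewrite /Z /W -surjective_pairing => h.
have E zw' : solutions rho0 Bn mu zw' -> zw' = ZW rho0 Bn mu.
  move=> /solutionsE[c1 c2 e]; rewrite ZWE /limit_parameters /converges !asboolT//=.
  exact: parameter_equations_unique.
split; last exact: E.
by apply/seteqP; split=> [zw' /E ->//|_ ->]; rewrite -(E _ h).
Qed.

Lemma measurable_limit_parameters {d} {T : measurableType d} (a b : nat -> T -> R) :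
  (forall n, measurable_fun setT (a n)) -> (forall n, measurable_fun setT (b n)) ->
  measurable_fun setT (fun x => (limit_parameters (a ^~ x) (b ^~ x)).1) /\
  measurable_fun setT (fun x => (limit_parameters (a ^~ x) (b ^~ x)).2).
Proof.
move=> ma mb.
have mcc : measurable_fun setT (fun x => converges (a ^~ x) && converges (b ^~ x)).
  by apply: measurable_and; exact: measurable_converges.
have [m1 m2] := measurable_density_parameters
  (measurable_limn_converges ma) (measurable_limn_converges mb).
split.
- rewrite (_ : (fun x => _) = fun x => if converges (a ^~ x) && converges (b ^~ x) then
      (density_parameters (if converges (a ^~ x) then limn (a ^~ x) else 0)
         (if converges (b ^~ x) then limn (b ^~ x) else 0)).1 else 0)%R.
    exact: measurable_fun_ifT.
  by apply/funext => x; rewrite /limit_parameters; case: ifP => // /andP[-> ->].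
- rewrite (_ : (fun x => _) = fun x => if converges (a ^~ x) && converges (b ^~ x) then
      (density_parameters (if converges (a ^~ x) then limn (a ^~ x) else 0)
         (if converges (b ^~ x) then limn (b ^~ x) else 0)).2 else 0)%R.
    exact: measurable_fun_ifT.
  by apply/funext => x; rewrite /limit_parameters; case: ifP => // /andP[-> ->].
Qed.

(** Dropping the terms before [Bn k] contains [B] is what brings the parameters into the
    sigma-algebra of [B]. *)
Lemma limit_parameters_shift (a b : R^nat) k :
  limit_parameters a b = limit_parameters (fun n => a (n + k)%N) (fun n => b (n + k)%N).
Proof.
have cE (c : R^nat) : converges (fun n => c (n + k)%N) = converges c.
  rewrite /converges; congr asbool; apply/propext; split=> /cvg_ex[l cl]; apply/cvg_ex; exists l.
    by rewrite -(cvg_shiftn k).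
  by rewrite (cvg_shiftn k).
have lE (c : R^nat) : converges c -> limn (fun n => c (n + k)%N) = limn c.
  by move=> /asboolP cl; apply/cvg_lim => //; rewrite (cvg_shiftn k).
rewrite /limit_parameters !cE; case: ifP => // /andP[ca cb].
by rewrite !lE.
Qed.

Section fixed_set.
Variable B : set (borel X).
Hypothesis bB : bounded_borel B.

Let G : set (set (pmeasure X)) := initial_sets (fun mu : pmeasure X => mu B)
  `|` initial_sets (fun mu => mstar mu B)
  `|` \bigcup_(C in [set C | bounded_borel C /\ C `&` B = set0])
        initial_sets (fun mu : pmeasure X => mu C).

Let T := g_sigma_algebraType G.

Let mT (f : T -> \bar R) : initial_sets f `<=` G -> measurable_fun setT f.
Proof. by move=> fG _ Y mY; apply: sub_gen_smallest; apply: fG; exists Y. Qed.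

Let mT_B : measurable_fun setT (fun mu : T => (mu : pmeasure X) B).
Proof. by apply: mT => Y hY; left; left. Qed.

Let mT_star : measurable_fun setT (fun mu : T => mstar (mu : pmeasure X) B).
Proof. by apply: mT => Y hY; left; right. Qed.

Let mT_disj C : bounded_borel C -> C `&` B = set0 ->
  measurable_fun setT (fun mu : T => (mu : pmeasure X) C).
Proof. by move=> bC CB; apply: mT => Y hY; right; exists C. Qed.

(** Once [B] lies in [Bn n], counts with and without multiplicity split into the part on [B], which
    is a generator, and the part on the difference, which depends only on counts of bounded sets
    disjoint from [B]. *)
Let parameters_measurable :
  measurable_fun setT (fun mu : T => Z rho0 Bn (mu : pmeasure X)) /\
  measurable_fun setT (fun mu : T => W rho0 Bn (mu : pmeasure X)).
Proof.
have [k Bk] := Bn_exhaust bB.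
have mB := bounded_borelW bB.
have BBn n : B `<=` Bn (n + k) by apply: (subset_trans Bk); apply: Bn_homo => //; rewrite leq_addl.
have bD n : bounded_borel (Bn n `\` B) by exact: bounded_borelD.
have DB n : (Bn n `\` B) `&` B = set0 by rewrite setDE -setIA setICl setI0.
have BI n : Bn (n + k) `&` B = B by apply/setIidr.
have ma n : measurable_fun setT (fun mu : T => density_seq rho0 Bn (mu : pmeasure X) (n + k)%N).
  apply: measurable_funM => //; apply: (measurableT_comp (fine_measurable _)) => //.
  rewrite (_ : (fun mu : T => _) = fun mu : T =>
      (mu : pmeasure X) (Bn (n + k) `\` B) + (mu : pmeasure X) B).
    by apply: emeasurable_funD => //; exact: mT_disj.
  apply/funext => mu; rewrite (measureDI _ (bounded_borelW (Bn_bounded (n + k))) mB).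
  by rewrite BI.
have mb n : measurable_fun setT (fun mu : T =>
    density_star_seq rho0 Bn (mu : pmeasure X) (n + k)%N).
  apply: measurable_funM => //; apply: (measurableT_comp (fine_measurable _)) => //.
  rewrite (_ : (fun mu : T => _) = fun mu : T =>
      mstar (mu : pmeasure X) (Bn (n + k) `\` B) + mstar (mu : pmeasure X) B).
    apply: emeasurable_funD => //.
    apply: (measurable_mstar A_open A_base (f := fun mu : T => (mu : pmeasure X))) => // C mC CD.
    apply: mT_disj; first exact: bounded_borelS mC CD (bD _).
    by apply/seteqP; split=> // x [/CD[_ nBx] Bx].
  apply/funext => mu; rewrite (mstarD A_open A_base _ (bounded_borelW (Bn_bounded (n + k))) mB).
  by rewrite BI.
have := measurable_limit_parameters ma mb.
under eq_fun do rewrite -limit_parameters_shift -ZWE.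
by under [X in _ /\ measurable_fun _ X]eq_fun do rewrite -limit_parameters_shift -ZWE.
Qed.

Lemma tailB_parameters (Y : set R) : measurable Y ->
  tailB B (Z rho0 Bn @^-1` Y) /\ tailB B (W rho0 Bn @^-1` Y).
Proof.
move=> mY; have [mZ mW] := parameters_measurable.
by split; [have := mZ measurableT _ mY|have := mW measurableT _ mY]; rewrite setTI.
Qed.

End fixed_set.

Lemma tail_measurable_parameters :
  tail_measurable (Z rho0 Bn) /\ tail_measurable (W rho0 Bn).
Proof.
by split=> Y mY B bB; [have [] := tailB_parameters bB mY|have [] := tailB_parameters bB mY].
Qed.

Lemma measurable_density_seq n :
  measurable_fun setT (fun mu : pmeasure X => density_seq rho0 Bn mu n).
Proof.
apply: measurable_funM => //; apply: (measurableT_comp (fine_measurable _)) => //.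
exact: measurable_pm_eval_bounded.
Qed.

Lemma measurable_density_star_seq n :
  measurable_fun setT (fun mu : pmeasure X => density_star_seq rho0 Bn mu n).
Proof.
apply: measurable_funM => //; apply: (measurableT_comp (fine_measurable _)) => //.
apply: (measurable_mstar A_open A_base) => // C mC CB.
by apply: measurable_pm_eval_bounded; exact: bounded_borelS mC CB (Bn_bounded n).
Qed.

Lemma measurable_parameters :
  measurable_fun setT (Z rho0 Bn : pmeasure X -> R) /\
  measurable_fun setT (W rho0 Bn : pmeasure X -> R).
Proof.
have := measurable_limit_parameters measurable_density_seq measurable_density_star_seq.
under eq_fun do rewrite -ZWE.
by under [X in _ /\ measurable_fun _ X]eq_fun do rewrite -ZWE.
Qed.

End tail_parameters.

(** * Conjugacy and Bayes kernels *)

Section families.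
Context {R : realType} {X : polishType R}.
Variable Bn : nat -> set (borel X).
Hypothesis Bn_bounded : forall n, bounded_borel (Bn n).
Hypothesis Bn_increasing : forall n, Bn n `<=` Bn n.+1.
Hypothesis Bn_exhaust : forall A, bounded_borel A -> exists n, A `<=` Bn n.
Variable A : nat -> set X.
Hypothesis A_open : forall n, open (A n).
Hypothesis A_base : forall U x, open U -> U x -> exists2 n, A n x & A n `<=` U.

Variable Po : lfmeasure X -> probability (pmeasure X) R.
Hypothesis Po_poisson : forall kappa, is_poisson_process kappa (Po kappa).
Variable D : R * lfmeasure X -> probability (lfmeasure X) R.
Hypothesis D_poisson_gamma : poisson_gamma_family D.
Variable S : R * lfmeasure X -> probability (pmeasure X) R.
Hypothesis S_polya_sum : polya_sum_family S.

Local Notation bsum := (base_sum Bn A).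

Let disjoint_atoms := base_atoms Bn_bounded Bn_increasing A_open.

Lemma base_sum_cnt n (B : 'I_n -> set (borel X)) (a : 'I_n -> R) l :
  (forall i, bounded_borel (B i)) ->
  (forall kappa : lfmeasure X, bsum l kappa = (\sum_(i < n) a i * fine (kappa (B i)))%R) ->
  forall mu : pmeasure X, bsum l mu = (\sum_(i < n) a i * (cnt (B i) mu)%:R)%R.
Proof.
by move=> bB lE mu; rewrite lE; apply: eq_bigr => i _; rewrite (cntE mu (bB i)).
Qed.

Lemma measurable_sum_cnt n (B : 'I_n -> set (borel X)) (a : 'I_n -> R) :
  (forall i, bounded_borel (B i)) ->
  measurable_fun setT (fun mu : pmeasure X => (\sum_(i < n) a i * (cnt (B i) mu)%:R)%R).
Proof.
move=> bB; apply: measurable_sum => i; apply: measurable_funM => //.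
exact: (measurable_cnt_comp (fun k => k%:R)%R (bB i)).
Qed.

Lemma measurable_fine_lfm (B : set (borel X)) : bounded_borel B ->
  measurable_fun setT (fun kappa : lfmeasure X => fine (kappa B)).
Proof.
move=> bB; apply: (measurableT_comp (fine_measurable _)) => //.
exact: measurable_lfm_eval_bounded.
Qed.

Lemma measurable_poisson : measurable_family Po.
Proof.
apply: (measurable_familyP (determining_pm Bn_bounded Bn_exhaust A_open A_base)).
move=> _ [l _ <-]; have [n [B [bB tB /(_ l)[//|a a0 lE]]]] := disjoint_atoms l.
rewrite (_ : (fun kappa : lfmeasure X => _) = fun kappa : lfmeasure X =>
    (expR (- \sum_(i < n) fine (kappa (B i)) * (1 - expR (- a i)))%R)%:E).
  apply/measurable_EFinP; apply: measurableT_comp => //; apply: measurableT_comp => //.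
  apply: measurable_sum => i; apply: measurable_funM => //.
  exact: measurable_fine_lfm.
apply/funext => kappa; rewrite -(poisson_laplace (Po_poisson kappa) bB tB a0).
by apply: eq_integral => mu _; rewrite (base_sum_cnt bB lE).
Qed.

(** The values of [D] for [t.1] outside (0,1) are replaced by the Dirac measure at zero. The result
    is measurable everywhere and agrees with [D] on [Theta]. *)
Definition poisson_gamma_kernel (t : R * lfmeasure X) : probability (lfmeasure X) R :=
  if (0 < t.1 < 1)%R then D t else dirac (@lfm_zero R X).

Definition polya_kernel (t : R * lfmeasure X) : probability (pmeasure X) R :=
  if (0 < t.1 < 1)%R then S t else dirac (@pm_zero R X).

Let measurable_itv01 : measurable_fun setT (fun t : R * lfmeasure X => 0 < t.1 < 1)%R.
Proof. by apply: measurable_and; apply: measurable_fun_ltr. Qed.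

Lemma base_sum_zero l : bsum l (@lfm_zero R X) = 0%R.
Proof. by rewrite /base_sum big1. Qed.

Let measurable_family_if (f g : R * lfmeasure X -> \bar R) :
  measurable_fun setT g ->
  (forall t, (0 < t.1 < 1)%R -> f t = g t) -> (forall t, ~~ (0 < t.1 < 1)%R -> f t = 1) ->
  measurable_fun setT f.
Proof.
move=> mg fg f1; rewrite (_ : f = fun t => if (0 < t.1 < 1)%R then g t else 1).
  exact: measurable_fun_ifT.
by apply/funext => t; case: ifPn => [/fg|/f1].
Qed.

Lemma measurable_poisson_gamma : measurable_family poisson_gamma_kernel.
Proof.
apply: (measurable_familyP (determining_lfm Bn_bounded Bn_exhaust A_open A_base)).
move=> _ [l _ <-]; have [n [B [bB tB /(_ l)[//|a a0 lE]]]] := disjoint_atoms l.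
apply: (@measurable_family_if _ (fun t =>
    (expR (- \sum_(i < n) fine (t.2 (B i)) * ln (1 + a i * (t.1 / (1 - t.1))))%R)%:E)).
- apply/measurable_EFinP; apply: measurableT_comp => //; apply: measurableT_comp => //.
  apply: measurable_sum => i; apply: measurable_funM => //.
    by apply: (measurableT_comp (measurable_fine_lfm (bB i))).
  apply: measurableT_comp => //; apply: measurable_funD => //; apply: measurable_funM => //.
  apply: measurable_funM => //; apply: (measurableT_comp (@measurable_invr R)) => //.
  exact: measurable_funB.
- move=> [z rho] t01; rewrite /poisson_gamma_kernel t01.
  rewrite -(poisson_gamma_laplace_sets t01 (D_poisson_gamma.1 _ rho t01) bB tB a0).
  by apply: eq_integral => kappa _; rewrite lE.
- move=> t /negbTE t01; rewrite /poisson_gamma_kernel t01 integral_dirac_setT.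
    by rewrite base_sum_zero oppr0 expR0.
  by apply/measurable_EFinP; apply: measurableT_comp => //; apply: measurableT_comp => //;
    exact: measurable_base_sum.
Qed.

Lemma measurable_polya : measurable_family polya_kernel.
Proof.
apply: (measurable_familyP (determining_pm Bn_bounded Bn_exhaust A_open A_base)).
move=> _ [l _ <-]; have [n [B [bB tB /(_ l)[//|a a0 lE]]]] := disjoint_atoms l.
apply: (@measurable_family_if _ (fun t => (expR (- \sum_(i < n)
    fine (t.2 (B i)) * (ln (1 - t.1 * expR (- a i)) - ln (1 - t.1)))%R)%:E)).
- apply/measurable_EFinP; apply: measurableT_comp => //; apply: measurableT_comp => //.
  apply: measurable_sum => i; apply: measurable_funM => //.
    by apply: (measurableT_comp (measurable_fine_lfm (bB i))).
  apply: measurable_funB; apply: measurableT_comp => //; apply: measurable_funB => //.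
  exact: measurable_funM.
- move=> [z rho] t01; rewrite /polya_kernel t01.
  rewrite -(polya_laplace t01 (S_polya_sum.1 _ rho t01) bB tB a0).
  by apply: eq_integral => mu _; rewrite (base_sum_cnt bB lE).
- move=> t /negbTE t01; rewrite /polya_kernel t01 integral_dirac_setT.
    by rewrite base_sum_zero oppr0 expR0.
  apply/measurable_EFinP; apply: measurableT_comp => //; apply: measurableT_comp => //.
  exact: measurableT_comp (measurable_base_sum _ _ _) measurable_pm_val.
Qed.

Lemma lfm_addE (rho kappa : lfmeasure X) (B : set (borel X)) :
  lfm_add rho kappa B = rho B + kappa B.
Proof. exact: measure_addE. Qed.

Lemma measurable_lfm_add {d} {T : measurableType d} (f g : T -> lfmeasure X) :
  measurable_fun setT f -> measurable_fun setT g ->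
  measurable_fun setT (fun t => lfm_add (f t) (g t)).
Proof.
move=> mf mg; apply: measurable_fun_lfm => B bB; under eq_fun do rewrite lfm_addE.
by apply: emeasurable_funD; exact: (measurableT_comp (measurable_lfm_eval_bounded bB)).
Qed.

Lemma poisson_zero : measure_eq (Po (@lfm_zero R X)) (dirac (@pm_zero R X)).
Proof.
apply: (finite_measure_eq (determining_pm Bn_bounded Bn_exhaust A_open A_base)).
- exact: probability_lty.
- exact: probability_lty.
move=> _ [l _ <-]; have [n [B [bB tB /(_ l)[//|a a0 lE]]]] := disjoint_atoms l.
rewrite integral_dirac_setT; last first.
  apply/measurable_EFinP; apply: measurableT_comp => //; apply: measurableT_comp => //.
  exact: measurableT_comp (measurable_base_sum _ _ _) measurable_pm_val.
rewrite base_sum_zero oppr0 expR0.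
under eq_integral do rewrite (base_sum_cnt bB lE).
rewrite (poisson_laplace (Po_poisson _) bB tB a0) big1 ?oppr0 ?expR0// => i _.
by rewrite mul0r.
Qed.

Lemma bayes_conjugacy_laplace z rho l : (0 < z < 1)%R ->
  \int[S (z, rho)]_mu \int[D (z / (1 + z), lfm_add rho mu)%R]_kappa
    (expR (- (bsum l.1 mu + bsum l.2 kappa)))%:E =
  \int[D (z, rho)]_kappa \int[Po kappa]_mu
    (expR (- (bsum l.1 mu + bsum l.2 kappa)))%:E.
Proof.
move=> z01; have /andP[z0 z1] := z01.
have [n [B [bB tB lB]]] := disjoint_atoms (l.1 ++ l.2).
have [|a a0 l1E] := lB l.1; first by move=> i i1; rewrite mem_cat i1.
have [|b b0 l2E] := lB l.2; first by move=> i i2; rewrite mem_cat i2 orbT.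
have l1N := base_sum_cnt bB l1E.
have q0 : (0 < 1 + z)%R by rewrite addr_gt0.
have z'01 : (0 < z / (1 + z) < 1)%R.
  by rewrite divr_gt0// ltr_pdivrMr// mul1r ltrDr ltr01.
have z'E := posterior_odds z0.
have lnb0 i : (0 <= ln (1 + b i * z))%R by rewrite ln_ge0// lerDl mulr_ge0// ltW.
(* The common value is the Poisson-Gamma Laplace transform at weights b_i + 1 - e^{-a_i}:
   integrating out the Poisson process turns a_i into 1 - e^{-a_i}. *)
transitivity ((expR (- \sum_(i < n) fine (rho (B i)) *
    ln (1 + (b i + (1 - expR (- a i))) * (z / (1 - z))))%R)%:E).
  rewrite (eq_integral (fun mu : pmeasure X => (expR
    (- (\sum_(i < n) fine (rho (B i)) * ln (1 + b i * z) +
        \sum_(i < n) (a i + ln (1 + b i * z)) * (cnt (B i) mu)%:R)))%R%:E)); last first.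
    move=> mu _; rewrite integral_expRND; last exact: measurable_base_sum.
    under eq_integral do rewrite l2E.
    rewrite (poisson_gamma_laplace_sets z'01 (D_poisson_gamma.1 _ _ z'01) bB tB b0) z'E.
    rewrite -EFinM -expRD -opprD l1N; congr (expR (- _))%:E.
    rewrite -!big_split/=; apply: eq_bigr => i _; rewrite lfm_addE (cntE mu (bB i)).
    rewrite fineD ?lfm_fin_num//=; ring.
  rewrite integral_expRND; last exact: measurable_sum_cnt.
  rewrite (polya_laplace z01 (S_polya_sum.1 _ rho z01) bB tB); last first.
    by move=> i; rewrite addr_ge0.
  rewrite -EFinM -expRD -opprD; congr (expR (- _))%:E.
  rewrite -big_split/=; apply: eq_bigr => i _.
  by rewrite -mulrDr laplace_exponents.
under [RHS]eq_integral => kappa _.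
  under eq_integral => mu _ do rewrite addrC l1N.
  rewrite integral_expRND; last exact: measurable_sum_cnt.
  rewrite (poisson_laplace (Po_poisson _) bB tB a0) l2E -EFinM -expRD -opprD -big_split/=.
  under eq_bigr => i _ do rewrite [X in (_ + X)%R]mulrC -mulrDl.
  over.
rewrite (poisson_gamma_laplace_sets z01 (D_poisson_gamma.1 _ _ z01) bB tB)//.
move=> i; rewrite addr_ge0// subr_ge0 -expR0 ler_expR oppr_le0//.
Qed.

Lemma measurable_posterior {d} {T : measurableType d} (z : T -> R) (rho : T -> lfmeasure X) :
  measurable_fun setT z -> measurable_fun setT rho ->
  measurable_family (fun t => poisson_gamma_kernel (z t, rho t)).
Proof.
move=> mz mrho C mC; apply: (measurableT_comp (measurable_poisson_gamma mC)).
exact: measurable_fun_pair.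
Qed.

Lemma bayes_conjugacy (t : R * lfmeasure X) (f : pmeasure X * lfmeasure X -> \bar R) :
  (0 <= t.1 < 1)%R -> measurable_fun setT f -> (forall x, 0 <= f x) ->
  \int[polya_kernel t]_mu
    \int[poisson_gamma_kernel (t.1 / (1 + t.1), lfm_add t.2 mu)%R]_kappa f (mu, kappa) =
  \int[poisson_gamma_kernel t]_kappa \int[Po kappa]_mu f (mu, kappa).
Proof.
move=> /andP[t0 t1] mf f0.
have mK : measurable_family (fun mu : pmeasure X =>
    poisson_gamma_kernel (t.1 / (1 + t.1), lfm_add t.2 mu)%R).
  apply: measurable_posterior => //; apply: measurable_lfm_add => //.
  exact: measurable_pm_val.
have dE := determining_pm_lfm Bn_bounded Bn_exhaust A_open A_base.
apply: (joint_integral_eq mK measurable_poisson dE) => // _ [l _ <-] /=.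
have [t_gt0|t_le0] := ltP 0%R t.1.
  have t01 : (0 < t.1 < 1)%R by rewrite t_gt0.
  have t'01 : (0 < t.1 / (1 + t.1) < 1)%R.
    by rewrite divr_gt0 ?addr_gt0// ltr_pdivrMr ?addr_gt0// mul1r ltrDr ltr01.
  have := bayes_conjugacy_laplace t.2 l t01; rewrite -surjective_pairing.
  rewrite /polya_kernel /poisson_gamma_kernel t01.
  by move=> <-; apply: eq_integral => mu _; rewrite /= t'01.
(* At z = 0 also z/(1 + z) = 0, and both sides collapse to the value at the zero measures, the
   Poisson process of intensity zero being empty. *)
have t0E : t.1 = 0%R by apply/eqP; rewrite eq_le t0 t_le0.
have mb : measurable_fun setT (fun x : pmeasure X * lfmeasure X =>
    (expR (- (bsum l.1 x.1 + bsum l.2 x.2)))%:E).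
  apply/measurable_EFinP; have [[_ _ _ mE] _] := dE; apply: mE; exists l => //.
have e0 x : 0 <= (expR (- (bsum l.1 (x : pmeasure X * lfmeasure X).1 + bsum l.2 x.2)))%:E.
  by rewrite lee_fin expR_ge0.
have kDE rho z : z = 0%R ->
    poisson_gamma_kernel (z, rho) = dirac (@lfm_zero R X) :> probability _ _.
  by move=> z0; rewrite /poisson_gamma_kernel/= z0 ltxx.
have kSE : polya_kernel t = dirac (@pm_zero R X) :> probability _ _.
  by rewrite /polya_kernel t0E ltxx.
transitivity (expR (- (bsum l.1 (@pm_zero R X) + bsum l.2 (@lfm_zero R X))))%:E.
  rewrite kSE integral_dirac_setT; last exact: (measurable_fun_integral_family2 mK mb e0).
  rewrite kDE ?t0E ?mul0r// integral_dirac_setT//.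
  exact: (measurableT_comp mb (pair1_measurable _)).
rewrite [X in poisson_gamma_kernel X]surjective_pairing kDE// integral_dirac_setT; last first.
  exact: (measurable_fun_integral_family_swap measurable_poisson mb e0).
transitivity (\int[dirac (@pm_zero R X) : probability _ R]_mu
    (expR (- (bsum l.1 mu + bsum l.2 (@lfm_zero R X))))%:E).
  rewrite integral_dirac_setT//; exact: (measurableT_comp mb (pair2_measurable _)).
by apply: eq_measure_integral => C mC _; rewrite poisson_zero.
Qed.

(** Conjugacy tested with mu(B) equates the mean intensity with the mean Pólya count, so no Laplace
    transform has to be differentiated. Monotone convergence along [Bn] reaches unbounded sets. *)
Lemma poisson_gamma_mean (z : R) (rho : lfmeasure X) (C : set (borel X)) :
  (0 < z < 1)%R -> measurable C ->
  \int[D (z, rho)]_kappa kappa C = (z / (1 - z))%:E * rho C.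
Proof.
move=> z01 mC; have /andP[z0 z1] := z01.
have u0 : (0 <= z / (1 - z))%R by rewrite divr_ge0 ?subr_ge0// ltW.
have mean B : bounded_borel B -> \int[D (z, rho)]_kappa kappa B = (z / (1 - z))%:E * rho B.
  move=> bB; have t01 : (0 <= (z, rho).1 < 1)%R by rewrite /= ltW.
  have mf : measurable_fun setT (fun x : pmeasure X * lfmeasure X => x.1 B).
    by apply: (measurableT_comp (measurable_pm_eval_bounded bB)).
  have := bayes_conjugacy t01 mf (fun=> measure_ge0 _ _).
  rewrite /poisson_gamma_kernel /polya_kernel/= z01.
  under [RHS]eq_integral do rewrite (poisson_mean (Po_poisson _) bB).
  move=> <-; rewrite -[X in _ * X]fineK ?lfm_fin_num// -EFinM.
  rewrite -(polya_mean z01 (S_polya_sum.1 _ rho z01) bB).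
  apply: eq_integral => mu _; rewrite (cntE mu bB).
  exact: integral_probability_cst.
have mCB n : measurable (C `&` Bn n) by apply: measurableI => //; exact: bounded_borelW.
have bCB n : bounded_borel (C `&` Bn n) by exact: bounded_borelI.
have := @cvg_monotone_convergence _ _ _ (D (z, rho)) setT measurableT
  (fun n (kappa : lfmeasure X) => kappa (C `&` Bn n)).
under eq_integral => kappa _.
  rewrite (cvg_lim _ (cvg_measure_Bn Bn_bounded Bn_increasing Bn_exhaust (mu := kappa) mC))//.
  over.
move=> h; have {}h : \int[D (z, rho)]_kappa kappa (C `&` Bn n) @[n --> \oo] -->
    \int[D (z, rho)]_kappa kappa C.
  apply: h.
  - by move=> n; exact: measurable_lfm_eval_bounded.
  - by [].
  - move=> kappa _ m n mn; apply: le_measure; [exact: mem_set|exact: mem_set|].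
    by apply: setIS; exact: Bn_homo.
rewrite -(cvg_lim _ h)//; apply/cvg_lim => //.
rewrite (_ : (fun n => _) = fun n => (z / (1 - z))%:E * rho (C `&` Bn n)); last first.
  by apply/funext => n; exact: mean.
apply: cvgeZl => //.
exact: (cvg_measure_Bn Bn_bounded Bn_increasing Bn_exhaust (mu := rho) mC).
Qed.

(** * Reconstruction of the parameters from one observation *)

Section reconstruction.
Variable rho0 : lfmeasure X.
Hypothesis rho0_infinite : rho0 setT = +oo.
Hypothesis rho0_diffuse : forall x : X, rho0 [set x] = 0.

Local Notation Z := (Z rho0 Bn).
Local Notation W := (W rho0 Bn).
Local Notation solutions := (solutions rho0 Bn).

Let mZ : measurable_fun setT (Z : pmeasure X -> R).
Proof. by have [] := measurable_parameters rho0 Bn_bounded A_open A_base. Qed.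
Let mW : measurable_fun setT (W : pmeasure X -> R).
Proof. by have [] := measurable_parameters rho0 Bn_bounded A_open A_base. Qed.

Lemma parameters_range (mu : pmeasure X) :
  (0 < Z mu < 1)%R /\ (0 < W mu)%R \/ Z mu = 0%R /\ W mu = 0%R.
Proof.
rewrite /Z /W /ZW; case: xgetP => [zw _ [[?|->] _ _ _ _]|_]; [by left|by right|by right].
Qed.

Lemma Theta_range t : Theta rho0 t -> (0 <= t.1 < 1)%R.
Proof.
by case=> [[/andP[t0 t1] _]|[-> _]]; rewrite ?t1 ?lexx ?ltr01// ltW.
Qed.

Lemma polya_kernel_Theta t : Theta rho0 t -> measure_eq (S t) (polya_kernel t).
Proof.
case: t => z rho [[/= z01 _]|[/= -> rhoE]]; rewrite /polya_kernel/=.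
  by rewrite z01.
by rewrite ltxx; exact: S_polya_sum.2.
Qed.

Lemma poisson_gamma_kernel_Theta t : Theta rho0 t -> measure_eq (D t) (poisson_gamma_kernel t).
Proof.
case: t => z rho [[/= z01 _]|[/= -> rhoE]]; rewrite /poisson_gamma_kernel/=.
  by rewrite z01.
by rewrite ltxx; exact: D_poisson_gamma.2.
Qed.

Definition parameters (mu : pmeasure X) : R * lfmeasure X := (Z mu, lfm_scale (W mu) rho0).

Lemma lfm_scaleE (w : R) (B : set (borel X)) : (0 <= w)%R ->
  lfm_scale w rho0 B = w%:E * rho0 B.
Proof. by move=> w0; rewrite /= /mscale/= ger0_norm. Qed.

Lemma parameters_Theta mu : Theta rho0 (parameters mu).
Proof.
have [[z01 w0]|[z0 w0]] := parameters_range mu; rewrite /Theta /parameters /=.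
  by left; split=> //; exists (W mu).
by right; split=> // B mB; rewrite w0 lfm_scaleE// mul0e.
Qed.

Lemma measurable_lfm_scale {d} {T : measurableType d} (w : T -> R) :
  measurable_fun setT w -> measurable_fun setT (fun t => lfm_scale (w t) rho0).
Proof.
move=> mw; apply: measurable_fun_lfm => B bB; rewrite /= /mscale /=.
apply: emeasurable_funM => //; apply/measurable_EFinP.
exact: (measurableT_comp (@normr_measurable _ _)).
Qed.

Lemma measurable_parameters_pair : measurable_fun setT parameters.
Proof. by apply: measurable_fun_pair => //; exact: measurable_lfm_scale. Qed.

(** The last clause is for the degenerate parameter: [D] at z = 0 is prescribed only for a zero
    measure, so the posterior measure W rho0 + mu has to vanish there. *)
Definition reconstructs (t : R * lfmeasure X) (mu : pmeasure X) :=
  [/\ t.1 = Z mu, measure_eq t.2 (lfm_scale (W mu) rho0), solutions mu (Z mu, W mu) &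
      Z mu = 0%R -> forall n, mu (Bn n) = 0].

Lemma solutions_zero (mu : pmeasure X) : (forall n, mu (Bn n) = 0) -> solutions mu (0, 0)%R.
Proof.
move=> mu0.
have star0 n : mstar mu (Bn n) = 0.
  by apply/eqP; rewrite eq_le mstar_ge0 andbT -(mu0 n) mstar_le.
have E1 : density_seq rho0 Bn mu = cst 0%R.
  by apply/funext => n; rewrite /density_seq mu0 mul0r.
have E2 : density_star_seq rho0 Bn mu = cst 0%R.
  by apply/funext => n; rewrite /density_star_seq star0 mul0r.
split => /=.
- by right.
- by rewrite E1; exact: is_cvg_cst.
- by rewrite E2; exact: is_cvg_cst.
- by rewrite /U E1 lim_cst// mul0r.
- by rewrite /Ustar E2 lim_cst// oppr0 mul0r.
Qed.

Lemma measurable_null_counts : measurable (\bigcap_n [set mu : pmeasure X | mu (Bn n) = 0]).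
Proof.
apply: bigcap_measurable => // n _.
have := measurable_pm_eval_bounded (Bn_bounded n) measurableT (emeasurable_set1 0).
by rewrite setTI.
Qed.

Lemma ae_reconstructs t : Theta rho0 t -> {ae polya_kernel t, forall mu, reconstructs t mu}.
Proof.
case: t => z rho [[/= z01 [w w0 rhoE]]|[/= -> rhoE]]; rewrite /polya_kernel/=.
  rewrite z01; have := polya_densities rho0_infinite rho0_diffuse Bn_bounded
    Bn_increasing Bn_exhaust A_open A_base z01 w0 rhoE (S_polya_sum.1 _ rho z01).
  apply: filterS => mu [h1 h2].
  have sol : solutions mu (z, w).
    split => /=; first by left.
    - by apply/cvg_ex; eexists; exact: h1.
    - by apply/cvg_ex; eexists; exact: h2.
    - by apply/esym/cvg_lim.
    - by apply/esym/cvg_lim.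
  have [_ [zE wE]] := solutions_set1 sol.
  split=> /=; rewrite -?zE -?wE// => z0.
  by move: z01; rewrite z0 ltxx.
rewrite ltxx; exists (~` \bigcap_n [set mu : pmeasure X | mu (Bn n) = 0]); split.
- exact: measurableC measurable_null_counts.
- by rewrite /= diracE memNset//= => h; apply: h => n _.
move=> mu /= nrec mu0; apply: nrec.
have {}mu0 n : mu (Bn n) = 0 by exact: mu0.
have [_ [zE wE]] := solutions_set1 (solutions_zero mu0).
split=> /=; rewrite -?zE -?wE//; last exact: solutions_zero.
by move=> B mB; rewrite rhoE// lfm_scaleE// mul0e.
Qed.

(** Under the law at [t] the unknown parameter may be replaced by its reconstruction. The two
    measures are equal only on measurable sets, which a measurable [h] cannot detect. *)
Lemma integral_reconstructs t (h : pmeasure X * (R * lfmeasure X) -> \bar R) :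
  Theta rho0 t -> measurable_fun setT h -> (forall x, 0 <= h x) ->
  \int[polya_kernel t]_mu h (mu, t) = \int[polya_kernel t]_mu h (mu, parameters mu).
Proof.
move=> tT mh h0; apply: ge0_ae_eq_integral => //.
- exact: (measurableT_comp mh (pair2_measurable _)).
- apply: (measurableT_comp mh); apply: measurable_fun_pair => //.
  exact: measurable_parameters_pair.
apply: filterS (ae_reconstructs tT) => mu [tE rhoE _ _] _.
rewrite [t in LHS]surjective_pairing tE /parameters.
apply: (measurable_lfm_measure_eq (g := fun rho => h (mu, (Z mu, rho)))) => //.
apply: (measurableT_comp mh); apply: measurable_fun_pair => //.
Qed.

(** * Mixtures over the prior and their Bayes kernels *)

Section mixtures.
Variable V : probability (R * lfmeasure X)%type R.
Hypothesis V_Theta : {ae V, forall p, Theta rho0 p}.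
Variable SV : probability (pmeasure X) R.
Hypothesis SV_mixture : is_mixture (Theta rho0) V S SV.
Variable DV : probability (lfmeasure X) R.
Hypothesis DV_mixture : is_mixture (Theta rho0) V D DV.

Lemma integral_eq_Theta (F G : R * lfmeasure X -> \bar R) :
  measurable_fun setT F -> measurable_fun setT G ->
  (forall t, 0 <= F t) -> (forall t, 0 <= G t) ->
  (forall t, Theta rho0 t -> F t = G t) -> \int[V]_t F t = \int[V]_t G t.
Proof.
move=> mF mG F0 G0 FG.
rewrite -(integral_ae_domain V_Theta mF F0 (fun _ _ => erefl)).
exact: (integral_ae_domain V_Theta mG G0 FG).
Qed.

Lemma integral_SV (f : pmeasure X -> \bar R) : measurable_fun setT f -> (forall x, 0 <= f x) ->
  \int[SV]_mu f mu = \int[V]_t \int[polya_kernel t]_mu f mu.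
Proof.
apply: integral_mixture; first exact: measurable_polya.
move=> C mC; transitivity (\int[V]_(t in Theta rho0) S t C); first exact: SV_mixture.
apply: (integral_ae_domain V_Theta) => //; first exact: measurable_polya.
by move=> t /polya_kernel_Theta; exact.
Qed.

Lemma integral_DV (f : lfmeasure X -> \bar R) : measurable_fun setT f -> (forall x, 0 <= f x) ->
  \int[DV]_kappa f kappa = \int[V]_t \int[poisson_gamma_kernel t]_kappa f kappa.
Proof.
apply: integral_mixture; first exact: measurable_poisson_gamma.
move=> C mC; transitivity (\int[V]_(t in Theta rho0) D t C); first exact: DV_mixture.
apply: (integral_ae_domain V_Theta) => //; first exact: measurable_poisson_gamma.
by move=> t /poisson_gamma_kernel_Theta; exact.
Qed.

Lemma cox_mixture : is_mixture setT DV Po SV.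
Proof.
move=> C mC.
have m1C : measurable_fun setT (fun x : pmeasure X => (\1_C x : R)%:E).
  by apply/measurable_EFinP; exact: measurable_indic.
have PoE kappa : Po kappa C = \int[Po kappa]_mu (\1_C mu)%:E.
  by rewrite integral_indic// setIT.
rewrite integral_DV//; last exact: measurable_poisson.
have -> : SV C = \int[SV]_mu (\1_C mu)%:E by rewrite integral_indic// setIT.
rewrite integral_SV//.
apply: integral_eq_Theta.
- by apply: (measurable_fun_integral_family measurable_polya) => // mu; rewrite lee_fin.
- exact: (measurable_fun_integral_family measurable_poisson_gamma (measurable_poisson mC)).
- by move=> t; apply: integral_ge0 => mu _; rewrite lee_fin.
- by move=> t; exact: integral_ge0.
(* The Cox representation is conjugacy for a test function that ignores the intensity, the posterior
   having total mass one. *)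
move=> t tT; under [RHS]eq_integral do rewrite PoE.
rewrite -(bayes_conjugacy (f := fun x => (\1_C x.1)%:E) (Theta_range tT))//.
- by apply: eq_integral => mu _; rewrite /= integral_probability_cst.
- exact: (measurableT_comp m1C measurable_fst).
Qed.

(** A null set of the mixture is obtained by integrating null sets over [V], which requires one
    measurable exceptional set. Hence the solution property is recast as the measurable Boolean
    [good], with limits set to 0 off convergence. *)
Lemma ae_observation : {ae SV, forall mu,
  solutions mu = [set (Z mu, W mu)] /\ (Z mu = 0%R -> forall n, mu (Bn n) = 0)}.
Proof.
pose a n (mu : pmeasure X) := density_seq rho0 Bn mu n.
pose b n (mu : pmeasure X) := density_star_seq rho0 Bn mu n.
have ma n : measurable_fun setT (a n) by exact: measurable_density_seq.
have mb n : measurable_fun setT (b n) by exact: (measurable_density_star_seq _ _ A_open A_base).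
pose u mu := if converges (a ^~ mu) then limn (a ^~ mu) else 0%R.
pose v mu := if converges (b ^~ mu) then limn (b ^~ mu) else 0%R.
pose good mu := [&& converges (a ^~ mu), converges (b ^~ mu),
  (W mu * (Z mu / (1 - Z mu)) == u mu)%R & (- W mu * ln (1 - Z mu) == v mu)%R].
have mgood : measurable_fun setT good.
  apply: measurable_and; first exact: measurable_converges.
  apply: measurable_and; first exact: measurable_converges.
  apply: measurable_and; apply: measurable_fun_eqr.
  - apply: measurable_funM => //; apply: measurable_funM => //.
    by apply: (measurableT_comp (@measurable_invr R)); exact: measurable_funB.
  - exact: measurable_limn_converges.
  - apply: measurable_funM; first exact: measurableT_comp.
    by apply: measurableT_comp => //; exact: measurable_funB.
  - exact: measurable_limn_converges.
pose Q := good @^-1` [set true] `&`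
  ((fun mu => Z mu == 0%R) @^-1` [set false] `|` \bigcap_n [set mu : pmeasure X | mu (Bn n) = 0]).
have mQ : measurable Q.
  apply: measurableI; first by rewrite -[X in measurable X]setTI; exact: mgood.
  apply: measurableU.
    by rewrite -[X in measurable X]setTI; apply: measurable_fun_eqr.
  exact: measurable_null_counts.
exists (~` Q); split; first exact: measurableC.
- have mC : measurable_fun setT (fun mu => (\1_(~` Q) mu)%:E : \bar R).
    by apply/measurable_EFinP; apply: measurable_indic; exact: measurableC.
  have -> : SV (~` Q) = \int[SV]_mu (\1_(~` Q) mu)%:E.
    by rewrite integral_indic ?setIT//; exact: measurableC.
  rewrite integral_SV//.
  rewrite -[RHS](integral0 V setT); apply: integral_eq_Theta => //.
  + by apply: (measurable_fun_integral_family measurable_polya) => // mu; rewrite lee_fin.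
  + by move=> t; apply: integral_ge0 => mu _; rewrite lee_fin.
  move=> t tT; rewrite integral_indic ?setIT//; last exact: measurableC.
  apply/negligibleP; first exact: measurableC.
  apply: negligibleS (ae_reconstructs tT) => mu nQ [_ _ [_ c1 c2 e1 e2] z0]; apply: nQ.
  split.
    rewrite /= /good /u /v /converges !asboolT//=.
    by rewrite e1 e2 /U /Ustar !eqxx.
  have [Z0|Z0] := pselect (Z mu = 0%R); first by right=> n _; exact: z0.
  by left; exact/negbTE/eqP.
move=> mu /= h [gmu Zmu]; apply: h; split; last first.
  move=> Z0; case: Zmu => [|h n]; last exact: h.
  by rewrite /= Z0 eqxx.
move: gmu; rewrite /= /good /u /v => /and4P[c1 c2]; rewrite c1 c2 => /eqP e1 /eqP e2.
have [|//] := @solutions_set1 _ _ rho0 Bn mu (Z mu, W mu).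
split=> //=; last 2 first.
- exact/asboolP.
- exact/asboolP.
by have [?|[-> ->]] := parameters_range mu; [left|right].
Qed.

Definition parameter_dirac (mu : pmeasure X) : probability (R * lfmeasure X)%type R :=
  dirac (parameters mu).

Lemma measurable_parameter_dirac : measurable_family parameter_dirac.
Proof.
move=> C mC; rewrite (_ : (fun mu => _) = fun mu => (\1_C (parameters mu))%:E).
  apply/measurable_EFinP; apply: (measurableT_comp (f := (\1_C : R * lfmeasure X -> R))).
    exact: measurable_indic.
  exact: measurable_parameters_pair.
by apply/funext => mu; rewrite indicE; exact: diracE.
Qed.

(** Defined with the patched kernel to be measurable in [mu]; agreement with [D] holds almost surely
    and is shown separately. *)
Definition posterior (mu : pmeasure X) : probability (lfmeasure X) R :=
  poisson_gamma_kernel (Z' rho0 Bn mu, lfm_add (lfm_scale (W mu) rho0) mu).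

Lemma measurable_posterior_law : measurable_family posterior.
Proof.
apply: (measurable_posterior).
  apply: measurable_funM => //; apply: (measurableT_comp (@measurable_invr R)).
  exact: measurable_funD.
apply: measurable_lfm_add; first exact: measurable_lfm_scale.
exact: measurable_pm_val.
Qed.

Lemma bayes_kernel_parameters :
  is_bayes_kernel (Theta rho0) V S SV (pkern measurable_parameter_dirac).
Proof.
move=> f mf f0.
have mg : measurable_fun setT (fun mu => f (mu, parameters mu)).
  apply: (measurableT_comp mf); apply: measurable_fun_pair => //.
  exact: measurable_parameters_pair.
transitivity (\int[SV]_mu f (mu, parameters mu)); last first.
  apply: eq_integral => mu _; rewrite integral_dirac_setT//.
  exact: (measurableT_comp mf (pair1_measurable _)).
rewrite integral_SV//; apply: (integral_ae_domain V_Theta).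
- exact: (measurable_fun_integral_family measurable_polya).
- by move=> t; exact: integral_ge0.
move=> t tT; rewrite -(integral_reconstructs tT mf f0).
by apply: eq_measure_integral => C mC _; exact: polya_kernel_Theta.
Qed.

(** At fixed [t] conjugacy gives a posterior depending on both [t] and [mu]. Replacing [t] by
    [parameters mu] leaves a kernel of [mu] alone, and the integral over [V] becomes one over
    [SV]. *)
Lemma bayes_kernel_intensity : is_bayes_kernel setT DV Po SV (pkern measurable_posterior_law).
Proof.
move=> f mf f0.
pose post (x : pmeasure X * (R * lfmeasure X)) :=
  poisson_gamma_kernel (x.2.1 / (1 + x.2.1), lfm_add x.2.2 x.1)%R.
have mpost : measurable_family post.
  apply: (measurable_posterior).
    apply: measurable_funM; first exact: (measurableT_comp measurable_fst).
    apply: (measurableT_comp (@measurable_invr R)); apply: measurable_funD => //.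
    exact: (measurableT_comp measurable_fst).
  apply: measurable_lfm_add; first exact: (measurableT_comp measurable_snd).
  exact: (measurableT_comp measurable_pm_val).
pose h (x : pmeasure X * (R * lfmeasure X)) := \int[post x]_kappa f (x.1, kappa).
have mh : measurable_fun setT h.
  apply: (measurable_fun_integral_family2 mpost (f := fun y => f (y.1.1, y.2))) => //.
  apply: (measurableT_comp mf); apply: measurable_fun_pair => //.
  exact: (measurableT_comp measurable_fst).
have h0 x : 0 <= h x by exact: integral_ge0.
have mhp : measurable_fun setT (fun mu => h (mu, parameters mu)).
  apply: (measurableT_comp mh); apply: measurable_fun_pair => //.
  exact: measurable_parameters_pair.
have mPof : measurable_fun setT (fun kappa => \int[Po kappa]_mu f (mu, kappa)).
  exact: (measurable_fun_integral_family_swap measurable_poisson).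
rewrite integral_DV//; last by move=> kappa; exact: integral_ge0.
transitivity (\int[SV]_mu h (mu, parameters mu)); last by [].
rewrite integral_SV//; apply: integral_eq_Theta.
- apply: (measurable_fun_integral_family measurable_poisson_gamma) => // kappa.
  exact: integral_ge0.
- exact: (measurable_fun_integral_family measurable_polya).
- by move=> t; apply: integral_ge0 => kappa _; exact: integral_ge0.
- by move=> t; exact: integral_ge0.
move=> t tT; rewrite -(integral_reconstructs tT mh h0).
rewrite -(bayes_conjugacy (Theta_range tT))//.
Qed.

Lemma ae_parameter_dirac tB : is_bayes_kernel (Theta rho0) V S SV tB ->
  {ae SV, forall mu, measure_eq (tB mu) (\d_(parameters mu))}.
Proof.
move=> btB.
have dE := determining_R_lfm Bn_bounded Bn_exhaust A_open A_base.
rewrite -(range_countable_enum (0%N, [::])) in dE.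
apply: filterS (ae_kernel_unique (B1 := tB) (B2 := pkern measurable_parameter_dirac)
  (P := SV) dE _) => // f mf f0.
by rewrite -btB// -bayes_kernel_parameters.
Qed.

Lemma ae_posterior BV : is_bayes_kernel setT DV Po SV BV ->
  {ae SV, forall mu, measure_eq (BV mu) (posterior mu)}.
Proof.
move=> bBV.
have dE := determining_lfm Bn_bounded Bn_exhaust A_open A_base.
rewrite -(range_countable_enum [::]) in dE.
apply: filterS (ae_kernel_unique (B1 := BV) (B2 := pkern measurable_posterior_law)
  (P := SV) dE _) => // f mf f0.
by rewrite -bBV// -bayes_kernel_intensity.
Qed.

Lemma posterior_poisson_gamma (mu : pmeasure X) : (Z mu = 0%R -> forall n, mu (Bn n) = 0) ->
  measure_eq (posterior mu) (D (Z' rho0 Bn mu, lfm_add (lfm_scale (W mu) rho0) mu)).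
Proof.
move=> Z0mu; rewrite /posterior /poisson_gamma_kernel /= /Z'.
have [[/andP[z0 z1] w0]|[z0 w0]] := parameters_range mu.
  have q0 : (0 < 1 + Z mu)%R by rewrite addr_gt0.
  by rewrite divr_gt0// ltr_pdivrMr// mul1r ltrDr ltr01.
rewrite z0 mul0r ltxx /= => C mC; apply/esym; apply: D_poisson_gamma.2 => // B mB.
have muB : mu B = 0.
  have := cvg_measure_Bn Bn_bounded Bn_increasing Bn_exhaust (mu := mu) mB => h.
  rewrite -(cvg_lim _ h)//; apply/cvg_lim => //; apply: cvg_near_cst; apply: nearW => n.
  apply/eqP; rewrite eq_le measure_ge0 andbT -(Z0mu z0 n); apply: le_measure => //.
  - by apply: mem_set; apply: measurableI => //; exact: bounded_borelW.
  - by apply: mem_set; exact: bounded_borelW.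
by rewrite lfm_addE w0 lfm_scaleE// mul0e add0e muB.
Qed.

Lemma posterior_mean (mu : pmeasure X) (C : set (borel X)) : measurable C ->
  \int[posterior mu]_kappa kappa C = (Z mu)%:E * ((W mu)%:E * rho0 C + mu C).
Proof.
move=> mC; rewrite /posterior /poisson_gamma_kernel /= /Z'.
have [[/andP[z0 z1] w0]|[z0 w0]] := parameters_range mu.
  have q0 : (0 < 1 + Z mu)%R by rewrite addr_gt0.
  have z'01 : (0 < Z mu / (1 + Z mu) < 1)%R.
    by rewrite divr_gt0// ltr_pdivrMr// mul1r ltrDr ltr01.
  rewrite z'01 (poisson_gamma_mean _ z'01 mC).
  by rewrite posterior_odds// lfm_addE lfm_scaleE// ltW.
rewrite z0 mul0r ltxx /= mul0e integral_dirac_setT//.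
exact: (measurable_lfm_eval Bn_bounded Bn_increasing Bn_exhaust).
Qed.

End mixtures.
End reconstruction.
End families.

Unset Implicit Arguments.

Theorem theorem3p2 (R : realType) (X : polishType R)
  (rho0 : lfmeasure X)
  (rho0_infinite : rho0 setT = +oo)
  (rho0_diffuse : forall x : X, rho0 [set x] = 0)
  (Bn : nat -> set (borel X))
  (Bn_bounded : forall n, bounded_borel (Bn n))
  (Bn_increasing : forall n, Bn n `<=` Bn n.+1)
  (Bn_exhaust : forall A, bounded_borel A -> exists n, A `<=` Bn n)
  (Po : lfmeasure X -> probability (pmeasure X) R)
  (Po_poisson : forall kappa, is_poisson_process kappa (Po kappa))
  (D : R * lfmeasure X -> probability (lfmeasure X) R)
  (D_poisson_gamma : poisson_gamma_family D)
  (S : R * lfmeasure X -> probability (pmeasure X) R)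
  (S_polya_sum : polya_sum_family S)
  (V : probability (R * lfmeasure X)%type R)
  (V_Theta : {ae V, forall p, Theta rho0 p})
  (SV : probability (pmeasure X) R)
  (SV_mixture : is_mixture (Theta rho0) V S SV)
  (DV : probability (lfmeasure X) R)
  (DV_mixture : is_mixture (Theta rho0) V D DV) :
  is_mixture setT DV Po SV /\
  ([/\ exists tB, is_bayes_kernel (Theta rho0) V S SV tB,
       ergodically_decomposable (Theta rho0) V S SV,
       {ae SV, forall mu,
         solutions rho0 Bn mu = [set (Z rho0 Bn mu, W rho0 Bn mu)]},
       tail_measurable (Z rho0 Bn) /\ tail_measurable (W rho0 Bn) &
       forall tB, is_bayes_kernel (Theta rho0) V S SV tB ->
         {ae SV, forall mu, measure_eq (tB mu)
           (\d_((Z rho0 Bn mu, lfm_scale (W rho0 Bn mu) rho0)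
              : R * lfmeasure X))}] /\
  [/\ exists BV, is_bayes_kernel setT DV Po SV BV,
      forall BV, is_bayes_kernel setT DV Po SV BV ->
        {ae SV, forall mu : pmeasure X, measure_eq (BV mu)
          (D (Z' rho0 Bn mu, lfm_add (lfm_scale (W rho0 Bn mu) rho0) mu))} &
      forall BV, is_bayes_kernel setT DV Po SV BV ->
        {ae SV, forall mu : pmeasure X, forall A : set (borel X), measurable A ->
          \int[BV mu]_kappa kappa A =
          (Z rho0 Bn mu)%:E * ((W rho0 Bn mu)%:E * rho0 A + mu A)}]).
Proof.
have [A [A_open A_base]] := @polish_countable_base R X.
split.
  exact: (cox_mixture Bn_bounded Bn_increasing Bn_exhaust A_open A_base Po_poisson
    D_poisson_gamma S_polya_sum V_Theta SV_mixture DV_mixture).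
have tBE tB : is_bayes_kernel (Theta rho0) V S SV tB ->
    {ae SV, forall mu, measure_eq (tB mu) (\d_(parameters Bn rho0 mu))}.
  exact: (ae_parameter_dirac Bn_bounded Bn_increasing Bn_exhaust
    A_open A_base S_polya_sum rho0_infinite rho0_diffuse V_Theta SV_mixture).
have ae_obs := ae_observation Bn_bounded Bn_increasing Bn_exhaust
  A_open A_base S_polya_sum rho0_infinite rho0_diffuse V_Theta SV_mixture.
have BVE BV : is_bayes_kernel setT DV Po SV BV ->
    {ae SV, forall mu, measure_eq (BV mu) (posterior Bn D rho0 mu)}.
  exact: (ae_posterior Bn_bounded Bn_increasing Bn_exhaust
    A_open A_base Po_poisson D_poisson_gamma S_polya_sum rho0_infinite rho0_diffuse
    V_Theta SV_mixture DV_mixture).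
split; split.
- eexists.
  exact: (bayes_kernel_parameters Bn_bounded Bn_increasing Bn_exhaust
    A_open A_base S_polya_sum rho0_infinite rho0_diffuse V_Theta SV_mixture).
- move=> tB /tBE; apply: filterS => mu h.
  by exists (parameters Bn rho0 mu) => //; exact: parameters_Theta.
- by apply: filterS ae_obs => mu [].
- exact: (tail_measurable_parameters rho0 Bn_bounded Bn_increasing Bn_exhaust A_open A_base).
- exact: tBE.
- eexists.
  exact: (bayes_kernel_intensity Bn_bounded Bn_increasing Bn_exhaust
    A_open A_base Po_poisson D_poisson_gamma S_polya_sum rho0_infinite rho0_diffuse
    V_Theta SV_mixture DV_mixture).
(* [ae_obs] supplies the empty configuration when [Z mu = 0], so that [D] is evaluated at a
   parameter where it is prescribed. *)
- move=> BV /BVE; apply: filterS2 ae_obs => mu [_ Z0mu] h C mC; rewrite h//.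
  exact: (posterior_poisson_gamma Bn_bounded Bn_increasing Bn_exhaust D_poisson_gamma Z0mu).
- move=> BV /BVE; apply: filterS => mu h C mC.
  rewrite -(posterior_mean Bn_bounded Bn_increasing Bn_exhaust A_open A_base Po_poisson
    D_poisson_gamma S_polya_sum rho0 mu mC).
  by apply: eq_measure_integral => E mE _; exact: h.
Qed.
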